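(* Let $D=\mathbb S^2\setminus\bigcup_i\Delta_i$ be a spherical billiard with circular obstacles $\Delta_i$. Let $A$ be the radius (for the spherical metric) of the largest obstacle and let $H$ be the horizon of $D$. If $H<\pi/2$ and $2\tan(\pi/2-A)>\tan(H)$, then the billiard flow of $D$ is uniformly hyperbolic. In particular, this is the case if $A+H<\pi/2$.
   Context: $\mathbb S^2$ is the unit sphere with its round metric. A spherical billiard with circular obstacles is a set $D=\mathbb S^2\setminus\bigcup_i\Delta_i$, where $(\Delta_i)$ is a finite (nonempty) family of open metric disks of $\mathbb S^2$ whose closures are pairwise disjoint and whose spherical radii $r_i$ satisfy $r_i<\pi/2$. Billiard flow $\phi^t$: outside the obstacles a particle follows the geodesics of $\mathbb S^2$ with unit speed; when it hits an obstacle it bounces according to the usual reflection law (angle of incidence equals angle of reflection). The horizon $H$ of $D$ is the length of the longest geodesic (great-circle arc) of $\mathbb S^2$ contained in $D$. The phase space is $\Omega=T^1(\mathrm{Int}(D))$, the unit tangent bundle of the interior of $D$. $\tilde\Omega\subseteq\Omega$ is the set of all $(x,v)$ such that the trajectory starting at $(x,v)$ contains no grazing collision (each obstacle is reached with a nonzero angle). The billiard flow is uniformly hyperbolic if there exist $a>0$ and $\lambda\in(0,1)$ such that at each point $x\in\tilde\Omega$ there is a decomposition, stable under the flow, $$T_x\Omega=E^0_x\oplus E^u_x\oplus E^s_x,\qquad E^0_x=\mathbb R\left.\tfrac{d}{dt}\right|_{t=0}\phi^t(x),$$ with $\|D\phi^t_x|_{E^s_x}\|\le a\lambda^t$ and $\|D\phi^{-t}_x|_{E^u_x}\|\le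 a\lambda^t$ for all $t\ge 0$ (for which the image point lies in $\Omega$, i.e. is not at a collision instant); $a$ and $\lambda$ do not depend on $x$. *)

(* Defs.v *)
From mathcomp Require Import all_boot all_order all_algebra.
From mathcomp Require Import all_classical all_reals all_analysis.

Set Implicit Arguments.
Unset Strict Implicit.
Unset Printing Implicit Defensive.

Import Order.TTheory GRing.Theory Num.Theory.
Import numFieldNormedType.Exports.

Local Open Scope classical_set_scope.
Local Open Scope ring_scope.

(** * The round sphere and its unit tangent bundle, embedded in R^3 and R^3 * R^3 *)

Definition dotp (R : realType) (u v : 'rV[R]_3) : R :=
  \sum_(k < 3) u 0 k * v 0 k.

Definition sphere2 (R : realType) : set 'rV[R]_3 := [set x | dotp x x = 1].

(** Meaningful for points of the sphere only. *)
Definition sdist (R : realType) (x y : 'rV[R]_3) : R := acos (dotp x y).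

Definition sdisk (R : realType) (c : 'rV[R]_3) (r : R) : set 'rV[R]_3 :=
  [set x | sphere2 x /\ sdist c x < r].

(** A pair (position, velocity). *)
Notation phase R := ('rV[R]_3 * 'rV[R]_3)%type.

Definition unit_tangent_bundle (R : realType) : set (phase R) :=
  [set z | [/\ sphere2 z.1, dotp z.2 z.2 = 1 & dotp z.1 z.2 = 0]].

(** The geodesic flow of the sphere: the unit speed geodesic with initial
    condition [z], together with its velocity. *)
Definition geodesic (R : realType) (t : R) (z : phase R) : phase R :=
  (cos t *: z.1 + sin t *: z.2, cos t *: z.2 - sin t *: z.1).

(** Tangent space at [z = (x, v)] of the unit tangent bundle: its equations are
    obtained by differentiating <x, x> = 1, <v, v> = 1 and <x, v> = 0. *)
Definition tangent_space (R : realType) (z : phase R) : set (phase R) :=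
  [set w | [/\ dotp z.1 w.1 = 0, dotp z.2 w.2 = 0
             & dotp w.1 z.2 + dotp z.1 w.2 = 0]].

(** Norm of the Sasaki metric: the vertical part of [w] is the covariant
    derivative, i.e. the projection of [w.2] to the plane tangent to the sphere
    at [z.1]. *)
Definition sasaki_norm (R : realType) (z w : phase R) : R :=
  let vert := w.2 - dotp z.1 w.2 *: z.1 in
  Num.sqrt (dotp w.1 w.1 + dotp vert vert).

(** * Spherical billiards with circular obstacles *)

Record spherical_billiard (R : realType) := SphericalBilliard {
  obs_pred : nat ;
  obs_center : 'I_obs_pred.+1 -> 'rV[R]_3 ;
  obs_radius : 'I_obs_pred.+1 -> R ;
  center_sphere : forall i, sphere2 (obs_center i) ;
  radius_gt0 : forall i, 0 < obs_radius i ;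
  radius_lt_pihalf : forall i, obs_radius i < pi / 2 ;
  obstacles_disjoint :
    trivIset setT (fun i => closure (sdisk (obs_center i) (obs_radius i))) }.

Section Billiard.
Variables (R : realType) (B : spherical_billiard R).

Definition obstacle (i : 'I_(obs_pred B).+1) : set 'rV[R]_3 :=
  sdisk (obs_center i) (obs_radius i).

Definition table : set 'rV[R]_3 := @sphere2 R `\` \bigcup_i obstacle i.

(** Interior relative to the sphere. *)
Definition table_int : set 'rV[R]_3 :=
  [set x | sphere2 x /\ \forall y \near x, sphere2 y -> table y].

Definition largest_radius : R := \big[Num.max/0]_i obs_radius (s := B) i.

(** Great-circle arcs are not longer than a great circle; without the bound
    2 pi the set would be unbounded, and its [sup] would be 0, when the table
    contains a great circle. *)
Definition horizon : R :=
  sup [set l | 0 <= l <= 2 * pi /\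
    exists2 z, unit_tangent_bundle z &
      forall s : R, 0 <= s <= l -> table (geodesic s z).1].

Definition phase_space : set (phase R) :=
  [set z | unit_tangent_bundle z /\ table_int z.1].

(** * The billiard flow *)

Definition on_boundary (i : 'I_(obs_pred B).+1) (x : 'rV[R]_3) : Prop :=
  sphere2 x /\ sdist (obs_center i) x = obs_radius i.

(** A normal vector, tangent to the sphere, to the circle bounding the i-th
    obstacle at its point [x] (the projection of the center to the plane
    tangent to the sphere at [x]). *)
Definition obs_normal (i : 'I_(obs_pred B).+1) (x : 'rV[R]_3) : 'rV[R]_3 :=
  obs_center i - dotp (obs_center i) x *: x.

Definition bounce (i : 'I_(obs_pred B).+1) (x v : 'rV[R]_3) : 'rV[R]_3 :=
  let n := obs_normal i x in v - (2 * dotp v n / dotp n n) *: n.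

(** The trajectory is a geodesic on both sides of every instant; this forces
    collisions to be isolated and forbids creeping along the boundary.  At a
    collision the velocity recorded by [g] is the outgoing one and [u] is the
    incoming one; at a grazing collision both coincide. *)
Definition billiard_trajectory (z : phase R) (g : R -> phase R) : Prop :=
  g 0 = z /\
  forall t, table (g t).1 /\
    (\forall s \near 0^'+, g (t + s) = geodesic s (g t)) /\
    exists u : 'rV[R]_3,
      [/\ \forall s \near 0^'-, g (t + s) = geodesic s ((g t).1, u),
          table_int (g t).1 -> (g t).2 = u
        & forall i, on_boundary i (g t).1 -> (g t).2 = bounce i (g t).1 u].

(** This determines [phi t z] for every [t] and every [z] in the phase space;
    the values elsewhere are irrelevant. *)
Definition billiard_flow (phi : R -> phase R -> phase R) : Prop :=
  forall z, phase_space z -> billiard_trajectory z (phi ^~ z).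

Definition nongrazing (phi : R -> phase R -> phase R) : set (phase R) :=
  [set z | phase_space z /\
    forall t i, on_boundary i (phi t z).1 ->
      dotp (phi t z).2 (obs_normal i (phi t z).1) != 0].

(** [L] represents the differential at [z] of a map [f] defined on the phase
    space, a submanifold of R^3 * R^3; only its restriction to
    [tangent_space z] is determined by [f]. *)
Definition is_differential (f : phase R -> phase R) (z : phase R)
    (L : 'End(phase R)) : Prop :=
  forall eps : R, 0 < eps ->
    \forall z' \near z, phase_space z' ->
      `|f z' - f z - L (z' - z)| <= eps * `|z' - z|.

Definition flow_line (phi : R -> phase R -> phase R) (z : phase R) :
    {vspace phase R} :=
  (<[ derive1 (phi ^~ z) 0 ]>)%VS.

Definition uniformly_hyperbolic (phi : R -> phase R -> phase R) : Prop :=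
  exists a lam : R, [/\ 0 < a, 0 < lam < 1 &
  exists Eu Es : phase R -> {vspace phase R},
  forall z, nongrazing phi z ->
    [/\ directv (flow_line phi z + Eu z + Es z),
        forall w, w \in (flow_line phi z + Eu z + Es z)%VS <->
                  tangent_space z w
      & forall t, phase_space (phi t z) ->
        exists2 L : 'End(phase R), is_differential (phi t) z L &
        [/\ [/\ (L @: flow_line phi z)%VS = flow_line phi (phi t z),
                (L @: Eu z)%VS = Eu (phi t z)
              & (L @: Es z)%VS = Es (phi t z)],
            0 <= t -> forall w, w \in Es z ->
              sasaki_norm (phi t z) (L w) <= a * lam `^ t * sasaki_norm z w
          & t <= 0 -> forall w, w \in Eu z ->
              sasaki_norm (phi t z) (L w) <= a * lam `^ (- t) * sasaki_norm z w]]].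

End Billiard.

(* Main.v *)
(** An orthogonal Jacobi field is a pair (J, J'). It rotates during a free flight,
    and a collision with an obstacle of radius r, at angle theta from the normal,
    reflects it and adds (2 cot r / cos theta) J to J'. Let k = 2 cot A, so that
    tan H < k. If J and J' point in the same direction before a collision, then
    J' >= k J after it; a flight of length t <= H < pi/2 keeps J and J' in the same
    direction, and multiplies J' + k J by at least cos t + k sin t, hence by at
    least exp (c t) for some c > 0: both numbers equal 1 at t = 0, and the slope of
    the former is at least k cos H - sin H > 0. So the flow expands this cone
    uniformly, whatever the angles of incidence, and so does the reversed flow. The
    stable direction is a limit of directions pulled back from the cone of the
    reversed flow; it is the only bounded one, because cone vectors are not
    bounded, and this makes it invariant. The unstable direction is the stable one
    of the reversed trajectory. *)

From HB Require Import structures.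
Require Import Defs.
From mathcomp Require Import all_boot all_order all_algebra.
From mathcomp Require Import all_classical all_reals all_analysis.
From mathcomp Require Import ring lra.

Import Order.TTheory GRing.Theory Num.Theory.
Import numFieldNormedType.Exports.

Local Open Scope classical_set_scope.
Local Open Scope ring_scope.

Set Implicit Arguments.
Unset Strict Implicit.
Unset Printing Implicit Defensive.

(** * Vectors of R^3 and geodesics of the sphere *)

(** Differentials of the flow have no uniform upper bound near grazing collisions, so contraction is
    never estimated directly: every bound on the stable side is a lower bound for the reversed flow,
    where a large curvature only helps. The cone and its norm are read at the next collision instead
    of the present instant, since transport up to that collision is an isometry of the pairs (J, J')
    and costs nothing. Collisions are never enumerated: a trajectory is given by its germs on both
    sides of each instant, and what holds near every instant is propagated by real induction, so
    that no count of collisions is needed. The collision time depends on the starting point; the map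
    that moves to the obstacle, bounces, and follows the outgoing geodesic backwards for the same
    time absorbs this dependence and is an explicit algebraic formula. Finally, the orthogonal
    Jacobi fields form a plane: two independent bounded ones would bound all of them, those of the
    cone included. *)

Section DotProduct.
Context {R : realType}.
Implicit Types (u v w : 'rV[R]_3).

Lemma dotpC u v : dotp u v = dotp v u.
Proof. by apply: eq_bigr => k _; rewrite mulrC. Qed.

Lemma dotpDl u v w : dotp (u + v) w = dotp u w + dotp v w.
Proof. by rewrite -big_split; apply: eq_bigr => k _; rewrite !mxE mulrDl. Qed.

Lemma dotpZl a u w : dotp (a *: u) w = a * dotp u w.
Proof. by rewrite mulr_sumr; apply: eq_bigr => k _; rewrite !mxE mulrA. Qed.

Lemma dotpNl u w : dotp (- u) w = - dotp u w.
Proof. by rewrite -scaleN1r dotpZl mulN1r. Qed.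

Lemma dotp0l w : dotp 0 w = 0.
Proof. by rewrite -[0 in LHS](scale0r 0) dotpZl mul0r. Qed.

Lemma dotpDr u v w : dotp w (u + v) = dotp w u + dotp w v.
Proof. by rewrite dotpC dotpDl !(dotpC w). Qed.

Lemma dotpZr a u w : dotp w (a *: u) = a * dotp w u.
Proof. by rewrite dotpC dotpZl (dotpC w). Qed.

Lemma dotpNr u w : dotp w (- u) = - dotp w u.
Proof. by rewrite dotpC dotpNl (dotpC w). Qed.

Lemma dotp0r w : dotp w 0 = 0.
Proof. by rewrite dotpC dotp0l. Qed.

Definition dotpE :=
  (dotpDl, dotpDr, dotpNl, dotpNr, dotpZl, dotpZr, dotp0l, dotp0r).

Lemma dotp_ge0 u : 0 <= dotp u u.
Proof. by apply: sumr_ge0 => k _; rewrite -expr2 sqr_ge0. Qed.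

Lemma dotp_eq0 u : dotp u u = 0 -> u = 0.
Proof.
move=> /eqP; rewrite psumr_eq0 => [/allP h|k _]; last by rewrite -expr2 sqr_ge0.
apply/rowP => k; rewrite mxE; apply/eqP.
by have := h k (mem_index_enum _); rewrite /= mulf_eq0 orbb.
Qed.

Lemma dotp_CS u v : dotp u v ^+ 2 <= dotp u u * dotp v v.
Proof.
have [/dotp_eq0 ->|v0] := eqVneq (dotp v v) 0.
  by rewrite !dotpE expr0n /= mulr0.
have vp : 0 < dotp v v by rewrite lt_def v0 dotp_ge0.
have := dotp_ge0 (dotp v v *: u - dotp u v *: v).
rewrite !dotpE (dotpC v u).
set a := dotp u v; set b := dotp v v; set d := dotp u u => h.
have : 0 <= b * (d * b - a ^+ 2) by move: h; lra.
by rewrite pmulr_rge0 // subr_ge0.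
Qed.

Lemma dotp_unit_bound u v : dotp u u = 1 -> dotp v v = 1 -> -1 <= dotp u v <= 1.
Proof.
move=> u1 v1; have := dotp_CS u v; rewrite u1 v1 mulr1.
by set y := dotp u v => h; apply/andP; split; nra.
Qed.

End DotProduct.

Section PhaseVectors.
Context {R : realType}.
Implicit Types (u n : 'rV[R]_3) (z w : phase R).

Definition reverse z : phase R := (z.1, - z.2).

(* Initial data [(J, J')] of the Jacobi fields orthogonal to the geodesic of [z];
   [geodesic] also transports such data, since J'' = - J. *)
Definition perp z w : Prop :=
  [/\ dotp z.1 w.1 = 0, dotp z.2 w.1 = 0, dotp z.1 w.2 = 0 & dotp z.2 w.2 = 0].

(** The derivative of [geodesic t z] at time 0, hence the direction of the flow. *)
Definition flow_vec z : phase R := (z.2, - z.1).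

Definition frame z n : Prop := [/\ dotp n n = 1, dotp z.1 n = 0 & dotp z.2 n = 0].

(** On orthogonal data this is the square of the Sasaki norm, the vertical part being all of
    [w.2]. *)
Definition norm2 w : R := dotp w.1 w.1 + dotp w.2 w.2.

Lemma fstZ a w : (a *: w).1 = a *: w.1. Proof. by []. Qed.

Lemma sndZ a w : (a *: w).2 = a *: w.2. Proof. by []. Qed.

Lemma fstD z w : (z + w).1 = z.1 + w.1. Proof. by []. Qed.

Lemma sndD z w : (z + w).2 = z.2 + w.2. Proof. by []. Qed.

Definition phaseE := (fstZ, sndZ, fstD, sndD).

Lemma frame_expand z n u : unit_tangent_bundle z -> frame z n ->
  u = dotp z.1 u *: z.1 + dotp z.2 u *: z.2 + dotp n u *: n.
Proof.
move=> [x1 v1 xv] [n1 xn vn].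
pose e (i : 'I_3) := if i == 0 :> nat then z.1 else if i == 1 :> nat then z.2 else n.
pose A : 'M[R]_3 := \matrix_(i, j) e i 0 j.
have AA : A *m A^T = 1%:M.
  apply/matrixP => i j; rewrite !mxE.
  under eq_bigr do rewrite !mxE.
  rewrite -/(dotp (e i) (e j)).
  case: i => -[|[|[|//]]] hi; case: j => -[|[|[|//]]] hj;
  by rewrite /e /= ?x1 ?v1 ?n1 ?xv ?xn ?vn // dotpC.
(* The rows of [A] are orthonormal; a square matrix with a right inverse has it on the left too, and
   [A^T *m A = 1] is the expansion. *)
have := mulmx1C AA => AA'.
rewrite -{1}[u]mulmx1 -AA' mulmxA.
apply/rowP => k; rewrite !mxE !big_ord_recl big_ord0 !mxE addr0.
by rewrite !addrA; congr (_ * _ + _ * _ + _ * _);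
  apply: eq_bigr => i _; rewrite !mxE mulrC.
Qed.

Lemma frame_exists z : unit_tangent_bundle z -> exists n, frame z n.
Proof.
case: z => x v [/= x1 v1 xv].
(* The cross product of [x] and [v], indices of ['I_3] being added modulo 3; Lagrange's identity
   gives its norm. *)
pose n : 'rV[R]_3 := \row_k (x 0 (k + 1) * v 0 (k + 2) - x 0 (k + 2) * v 0 (k + 1)).
have E (a b : 'rV[R]_3) : dotp a b = a 0 0 * b 0 0 + a 0 1 * b 0 1 + a 0 2 * b 0 2.
  rewrite /dotp !big_ord_recl big_ord0 addr0 addrA.
  by congr (_ + a _ _ * b _ _ + a _ _ * b _ _); apply: val_inj.
have i1 : 1 + 1 = 2 :> 'I_3 by apply: val_inj.
have i2 : 1 + 2 = 0 :> 'I_3 by apply: val_inj.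
have i3 : 2 + 1 = 0 :> 'I_3 by apply: val_inj.
have i4 : 2 + 2 = 1 :> 'I_3 by apply: val_inj.
have [n0 nn1 n2] : [/\ n 0 0 = x 0 1 * v 0 2 - x 0 2 * v 0 1,
   n 0 1 = x 0 2 * v 0 0 - x 0 0 * v 0 2 & n 0 2 = x 0 0 * v 0 1 - x 0 1 * v 0 0].
  by split; rewrite mxE ?i1 ?i2 ?i3 ?i4 ?add0r.
move: x1 v1 xv; rewrite /sphere2 /= !E => h1 h2 h3.
exists n; split=> /=; rewrite E n0 nn1 n2;
  move: (x 0 0) (x 0 1) (x 0 2) (v 0 0) (v 0 1) (v 0 2) h1 h2 h3
    => a b c d e f h1 h2 h3; [|by ring|by ring].
transitivity ((a * a + b * b + c * c) * (d * d + e * e + f * f) - (a * d + b * e + c * f) ^+ 2).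
  by ring.
by rewrite h1 h2 h3; ring.
Qed.

Lemma perp_frame z n w : unit_tangent_bundle z -> frame z n -> perp z w ->
  w = (dotp n w.1 *: n, dotp n w.2 *: n).
Proof.
move=> zU zn [h1 h2 h3 h4]; case: w h1 h2 h3 h4 => a b /= h1 h2 h3 h4.
congr pair.
  by rewrite [LHS](frame_expand a zU zn) h1 h2 !scale0r !add0r.
by rewrite [LHS](frame_expand b zU zn) h3 h4 !scale0r !add0r.
Qed.

Lemma frame_perp z n a b : frame z n -> perp z (a *: n, b *: n).
Proof. by move=> [h1 h2 h3]; split; rewrite /= dotpE ?h2 ?h3 mulr0. Qed.

Lemma norm2_frame z n a b : frame z n -> norm2 (a *: n, b *: n) = a ^+ 2 + b ^+ 2.
Proof. by move=> [h _ _]; rewrite /norm2 /= !dotpE h !mulr1 !expr2. Qed.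

Lemma norm2_ge0 w : 0 <= norm2 w.
Proof. by rewrite addr_ge0 ?dotp_ge0. Qed.

Lemma norm2_eq0 w : norm2 w = 0 -> w = 0.
Proof.
move=> /eqP; rewrite paddr_eq0 ?dotp_ge0 // => /andP[/eqP h1 /eqP h2].
by case: w h1 h2 => a b /= /dotp_eq0 -> /dotp_eq0 ->.
Qed.

Lemma norm2Z a w : norm2 (a *: w) = a ^+ 2 * norm2 w.
Proof. by rewrite /norm2 !phaseE !dotpE; ring. Qed.

Lemma perpZ z a w : perp z w -> perp z (a *: w).
Proof.
by move=> [h1 h2 h3 h4]; split; rewrite phaseE dotpE ?h1 ?h2 ?h3 ?h4 mulr0.
Qed.

Lemma reverseK : involutive reverse.
Proof. by case=> x v; rewrite /reverse /= opprK. Qed.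

Lemma reverseN w : reverse (- w) = - reverse w.
Proof. by []. Qed.

Lemma reverseB z w : reverse (z - w) = reverse z - reverse w.
Proof. by case: z w => x v [y u]; rewrite /reverse; congr pair; rewrite opprD. Qed.

Lemma reverseZ a w : reverse (a *: w) = a *: reverse w.
Proof. by case: w => x v; rewrite /reverse; congr pair; rewrite -scalerN. Qed.

Lemma norm2_rev w : norm2 (reverse w) = norm2 w.
Proof. by rewrite /norm2 /= !dotpE opprK. Qed.

Lemma perp_rev z w : perp z w -> perp (reverse z) (reverse w).
Proof. by move=> [h1 h2 h3 h4]; split; rewrite /= ?dotpE ?h1 ?h2 ?h3 ?h4 ?oppr0. Qed.

Lemma unit_tangent_rev z : unit_tangent_bundle z -> unit_tangent_bundle (reverse z).
Proof. by move=> [h1 h2 h3]; split; rewrite /= ?dotpE ?opprK ?h3 ?oppr0. Qed.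

End PhaseVectors.

Section Geodesic.
Context {R : realType}.
Implicit Types (s t : R) (z w : phase R).

Lemma geodesic0 z : geodesic 0 z = z.
Proof. by case: z => x v; rewrite /geodesic cos0 sin0 /= !scale1r !scale0r addr0 subr0. Qed.

Lemma geodesicD s t z : geodesic s (geodesic t z) = geodesic (s + t) z.
Proof.
case: z => x v; rewrite /geodesic /= cosD sinD; congr pair.
  by apply/rowP => k; rewrite !mxE; ring.
by apply/rowP => k; rewrite !mxE; ring.
Qed.

Lemma geodesicNK t z : geodesic (- t) (geodesic t z) = z.
Proof. by rewrite geodesicD addNr geodesic0. Qed.

Lemma geodesic_inj t z w : geodesic t z = geodesic t w -> z = w.
Proof. by move=> h; rewrite -(geodesicNK t z) h geodesicNK. Qed.

Lemma geodesic_unit_tangent t z :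
  unit_tangent_bundle z -> unit_tangent_bundle (geodesic t z).
Proof.
case: z => x v [/=]; rewrite /sphere2 /= => x1 v1 xv.
have cs := cos2Dsin2 t.
by split; rewrite /sphere2 /= !dotpE ?(dotpC v x) x1 v1 xv; move: cs;
  rewrite !expr2; lra.
Qed.

Lemma geodesic_rev t z : geodesic t (reverse z) = reverse (geodesic (- t) z).
Proof.
case: z => x v; rewrite /geodesic /reverse /= cosN sinN.
by congr pair; apply/rowP => k; rewrite !mxE; ring.
Qed.

Lemma geodesicDr t z w : geodesic t (z + w) = geodesic t z + geodesic t w.
Proof.
case: z w => x v [y u]; rewrite /geodesic /=.
by congr pair; apply/rowP => k; rewrite !mxE; ring.
Qed.

Lemma geodesicZr t a w : geodesic t (a *: w) = a *: geodesic t w.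
Proof.
case: w => y u; rewrite /geodesic /=.
by congr pair; apply/rowP => k; rewrite !mxE; ring.
Qed.

Lemma norm2_geodesic t w : norm2 (geodesic t w) = norm2 w.
Proof.
case: w => x v; rewrite /norm2 /= !dotpE (dotpC v x).
transitivity ((cos t ^+ 2 + sin t ^+ 2) * (dotp x x + dotp v v)); first by ring.
by rewrite cos2Dsin2 mul1r.
Qed.

Lemma perp_geodesic t z w : perp z w -> perp (geodesic t z) (geodesic t w).
Proof.
case: z w => x v [a b] [/= h1 h2 h3 h4].
by split; rewrite /= !dotpE h1 h2 h3 h4; ring.
Qed.

Lemma flow_vec_geodesic t z : geodesic t (flow_vec z) = flow_vec (geodesic t z).
Proof.
case: z => x v; rewrite /geodesic /flow_vec /=.
by congr pair; apply/rowP => k; rewrite !mxE; ring.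
Qed.

End Geodesic.

(** * Topology of the table *)

Section RealLine.
Context {R : realType}.

Lemma near_right0P (P : R -> Prop) :
  (\forall s \near 0^'+, P s) <-> exists2 e, 0 < e & forall s, 0 < s < e -> P s.
Proof.
split.
  rewrite near_withinE => /nbhs_ballP[e /= e0 h]; exists e => // s /andP[s0 se].
  by apply: h => //=; rewrite /ball /= sub0r normrN gtr0_norm.
move=> [e e0 h]; rewrite near_withinE; apply/nbhs_ballP; exists e => //= s.
rewrite /ball /= sub0r normrN => se s0; apply: h.
by rewrite s0 (le_lt_trans (ler_norm s) se).
Qed.

Lemma near_left0P (P : R -> Prop) :
  (\forall s \near 0^'-, P s) <-> exists2 e, 0 < e & forall s, - e < s < 0 -> P s.
Proof.
split.
  rewrite near_withinE => /nbhs_ballP[e /= e0 h]; exists e => // s /andP[se s0].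
  by apply: h => //=; rewrite /ball /= sub0r normrN ltr0_norm // ltrNl.
move=> [e e0 h]; rewrite near_withinE; apply/nbhs_ballP; exists e => //= s.
rewrite /ball /= sub0r normrN => se s0; apply: h.
by rewrite s0 andbT; move: se; rewrite ltr0_norm // ltrNl.
Qed.

Lemma near0P (P : R -> Prop) :
  (\forall s \near (0 : R), P s) <-> exists2 e, 0 < e & forall s, `|s| < e -> P s.
Proof.
split.
  move=> /nbhs_ballP[e /= e0 h]; exists e => // s se.
  by apply: h => //=; rewrite /ball /= sub0r normrN.
move=> [e e0 h]; apply/nbhs_ballP; exists e => //= s.
by rewrite /ball /= sub0r normrN; apply: h.
Qed.

(** Real induction: the infimum of the failures can neither satisfy [P] nor violate it. It replaces
    an induction on the collisions, and needs only local information. *)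
Lemma real_ind (P : R -> Prop) : P 0 ->
  (forall t, 0 <= t -> (forall s, 0 <= s <= t -> P s) ->
     exists2 e, 0 < e & forall s, t < s < t + e -> P s) ->
  (forall t, 0 < t -> (forall s, 0 <= s < t -> P s) -> P t) ->
  forall t, 0 <= t -> P t.
Proof.
move=> P0 Pr Pl t t0; apply: contrapT => nPt.
pose S := [set s | 0 <= s /\ ~ P s].
have Sinf : has_inf S by split; [exists t | exists 0 => s []].
have m0 : 0 <= inf S by apply: lb_le_inf Sinf.1 _ => s [].
have Pm s : 0 <= s < inf S -> P s.
  move=> /andP[s0 sm]; apply: contrapT => nPs.
  by have /(ge_inf Sinf.2) : S s by []; rewrite leNgt sm.
have Pinf : P (inf S).
  have [<-//|mn0] := eqVneq 0 (inf S).
  by apply: Pl; rewrite // lt_def eq_sym mn0.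
have [|e e0 he] := Pr _ m0.
  move=> s /andP[s0]; rewrite le_eqVlt => /predU1P[->//|sm].
  by apply: Pm; rewrite s0.
have [s [s0 nPs] sm] := inf_adherent e0 Sinf.
have : inf S <= s by apply: (ge_inf Sinf.2).
rewrite le_eqVlt => /predU1P[e_inf|ms]; first by apply: nPs; rewrite -e_inf.
by apply/nPs/he; rewrite ms.
Qed.

End RealLine.

Lemma continuous_pair (T U V : topologicalType) (f : T -> U) (g : T -> V) x :
  {for x, continuous f} -> {for x, continuous g} ->
  {for x, continuous (fun y => (f y, g y))}.
Proof. by move=> cf cg; apply: cvg_pair. Qed.

Lemma continuous_fst (U V : topologicalType) : continuous (@fst U V).
Proof. by move=> x; apply: cvg_fst. Qed.

Lemma continuous_snd (U V : topologicalType) : continuous (@snd U V).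
Proof. by move=> x; apply: cvg_snd. Qed.

Section Continuity.
Context {R : realType}.
Implicit Types (c x : 'rV[R]_3) (z : phase R).

Lemma dotp_continuous c : continuous (dotp c).
Proof.
apply: (@continuous_big R _ +%R) => [|k _ x]; first by move=> p; apply: add_continuous.
apply: continuousM; first exact: cst_continuous.
exact: coord_continuous.
Qed.

Lemma geodesic_continuous2 :
  continuous (fun p : R * phase R => geodesic p.1 p.2).
Proof.
move=> q; have cz : continuous (fun p : R * phase R => p.2) by apply: continuous_snd.
have cc : continuous (fun p : R * phase R => cos p.1).
  by move=> p; apply: continuous_comp; [exact: continuous_fst | exact: continuous_cos].
have cs : continuous (fun p : R * phase R => sin p.1).
  by move=> p; apply: continuous_comp; [exact: continuous_fst | exact: continuous_sin].
have cx : continuous (fun p : R * phase R => p.2.1).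
  by move=> p; apply: continuous_comp; [exact: cz | exact: continuous_fst].
have cv : continuous (fun p : R * phase R => p.2.2).
  by move=> p; apply: continuous_comp; [exact: cz | exact: continuous_snd].
apply: (@continuous_pair _ _ _ (fun p : R * phase R => cos p.1 *: p.2.1 + sin p.1 *: p.2.2)
  (fun p : R * phase R => cos p.1 *: p.2.2 - sin p.1 *: p.2.1)).
  by apply: continuousD; apply: continuousZ; [exact: cc | exact: cx | exact: cs | exact: cv].
by apply: continuousB; apply: continuousZ; [exact: cc | exact: cv | exact: cs | exact: cx].
Qed.

Lemma geodesic_continuous t : continuous (@geodesic R t).
Proof.
move=> z; apply: (@continuous_comp _ _ _ (fun z => (t, z))
  (fun p : R * phase R => geodesic p.1 p.2)); last exact: geodesic_continuous2.
by apply: continuous_pair; [exact: cst_continuous | by move=> ?; exact: cvg_id].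
Qed.

Lemma geodesic_time_continuous z : continuous (fun t : R => geodesic t z).
Proof.
move=> t; apply: (@continuous_comp _ _ _ (fun t => (t, z))
  (fun p : R * phase R => geodesic p.1 p.2)); last exact: geodesic_continuous2.
by apply: continuous_pair; [by move=> ?; exact: cvg_id | exact: cst_continuous].
Qed.

Lemma height_continuous2 c :
  continuous (fun p : R * phase R => dotp c (geodesic p.1 p.2).1).
Proof.
move=> p; apply: continuous_comp; last exact: dotp_continuous.
by apply: continuous_comp; [exact: geodesic_continuous2 | exact: continuous_fst].
Qed.

Lemma height_time_continuous c z : continuous (fun t => dotp c (geodesic t z).1).
Proof.
move=> t; apply: continuous_comp; last exact: dotp_continuous.
by apply: continuous_comp; [exact: geodesic_time_continuous | exact: continuous_fst].
Qed.

Lemma rev_continuous : continuous (@reverse R).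
Proof.
move=> z; apply: continuous_pair; first exact: continuous_fst.
by apply: continuousN; exact: continuous_snd.
Qed.

End Continuity.

Section Disks.
Context {R : realType}.
Implicit Types (c x : 'rV[R]_3) (r : R).

Lemma cos_sdist c x : sphere2 c -> sphere2 x -> cos (sdist c x) = dotp c x.
Proof. by move=> c1 x1; rewrite acosK // in_itv /= dotp_unit_bound. Qed.

Lemma sdist_itv c x : sphere2 c -> sphere2 x -> 0 <= sdist c x <= pi.
Proof.
by move=> c1 x1; rewrite acos_ge0 ?acos_lepi ?dotp_unit_bound.
Qed.

Lemma sdist_ltE c x r : sphere2 c -> sphere2 x -> 0 < r < pi / 2 ->
  (sdist c x < r) = (cos r < dotp c x).
Proof.
move=> c1 x1 /andP[r0 r1]; rewrite -(cos_sdist c1 x1).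
have := pi_gt0 R => pi0.
by rewrite ltr_cos ?in_itv /= ?sdist_itv //; apply/andP; split; lra.
Qed.

Lemma sdist_eqE c x r : sphere2 c -> sphere2 x -> 0 < r < pi / 2 ->
  sdist c x = r <-> dotp c x = cos r.
Proof.
move=> c1 x1 /andP[r0 r1]; have := pi_gt0 R => pi0; split=> [<-|h].
  by rewrite cos_sdist.
by rewrite /sdist h cosK // in_itv /=; apply/andP; split; lra.
Qed.

(* The geodesic pointing from [x] to the center reaches points at distance
   [r - h] from it. *)
Lemma boundary_approach c x r (U : set 'rV[R]_3) : sphere2 c -> sphere2 x ->
  0 < r < pi / 2 -> dotp c x = cos r -> nbhs x U -> exists2 y, U y & sdisk c r y.
Proof.
move=> c1 x1 r0 cx Ux.
have s0 : 0 < sin r by apply: sin_gt0_pihalf.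
have cs := cos2Dsin2 r.
pose z : phase R := (x, (sin r)^-1 *: (c - dotp c x *: x)).
have zU : unit_tangent_bundle z.
  split => //=; rewrite /sphere2 /= in c1 x1 *; rewrite !dotpE ?(dotpC x c) cx ?c1 x1.
    have : (sin r * (sin r)^-1) ^+ 2 = 1 by rewrite divff ?lt0r_neq0 // expr1n.
    have := congr1 (fun y => (sin r)^-1 ^+ 2 * y) cs.
    by move: ((sin r)^-1) => a /=; lra.
  by rewrite mulr1 subrr mulr0.
have : nbhs (0 : R) [set t | U (geodesic t z).1].
  have Uz : nbhs (geodesic 0 z).1 U by rewrite geodesic0.
  exact: (@continuous_comp _ _ _ (fun t : R => geodesic t z) fst 0
    (@geodesic_time_continuous R z 0) (@continuous_fst _ _ _) U Uz).
move=> /nbhs_ballP[e /= e0 he].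
pose h := Num.min (e / 2) (r / 2).
have h0 : 0 < h by rewrite lt_min !divr_gt0 //; case/andP: r0.
have hr : h <= r / 2 by rewrite ge_min lexx orbT.
have hee : h <= e / 2 by rewrite ge_min lexx.
exists (geodesic h z).1.
  by apply: he; rewrite /ball /= sub0r normrN gtr0_norm //; lra.
have [y1 _ _] := geodesic_unit_tangent h zU.
split=> //; rewrite sdist_ltE //= !dotpE c1 cx.
have -> : cos h * cos r + sin h * ((sin r)^-1 * (1 - cos r * cos r)) = cos (r - h).
  have -> : 1 - cos r * cos r = sin r * sin r by move: cs; rewrite !expr2; lra.
  by rewrite cosB mulKf ?lt0r_neq0 //; ring.
by have := pi_gt0 R; case/andP: r0 => ? ? ?; rewrite ltr_cos ?in_itv /=;
  try (apply/andP; split); lra.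
Qed.

End Disks.

Section Table.
Context {R : realType} (B : spherical_billiard R).
Implicit Types (x : 'rV[R]_3) (i j : 'I_(obs_pred B).+1).

Lemma obs_radius_itv i : 0 < obs_radius i < pi / 2.
Proof. by rewrite radius_gt0 radius_lt_pihalf. Qed.

Lemma cos_radius_gt0 i : 0 < cos (obs_radius i).
Proof.
have /andP[r0 r1] := obs_radius_itv i.
by apply: cos_gt0_pihalf; rewrite r1 andbT; lra.
Qed.

Lemma sin_radius_gt0 i : 0 < sin (obs_radius i).
Proof. exact/sin_gt0_pihalf/obs_radius_itv. Qed.

Lemma tableP x : table B x <->
  sphere2 x /\ forall i, dotp (obs_center i) x <= cos (obs_radius i).
Proof.
split=> [[x1 h]|[x1 h]].
  split=> // i; rewrite leNgt; apply/negP => hi; apply: h; exists i => //.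
  by split=> //; rewrite sdist_ltE ?obs_radius_itv //; exact: center_sphere.
split=> // -[i _ [_]]; rewrite sdist_ltE ?obs_radius_itv //; last exact: center_sphere.
by rewrite ltNge h.
Qed.

Lemma on_boundaryP i x : on_boundary i x <->
  sphere2 x /\ dotp (obs_center i) x = cos (obs_radius i).
Proof.
by split=> -[x1 h]; split=> //; apply/sdist_eqE => //;
  exact: center_sphere || exact: obs_radius_itv.
Qed.

(** A point of a bounding circle is not interior, because the obstacle has points arbitrarily close
    to it. *)
Lemma table_intP x : table_int B x <->
  sphere2 x /\ forall i, dotp (obs_center i) x < cos (obs_radius i).
Proof.
split=> [[x1 h]|[x1 h]]; split=> //.
  move=> i; have /tableP[_ /(_ i)] : table B x by apply: (nbhs_singleton h).
  rewrite le_eqVlt => /predU1P[e|//].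
  have [y /= hy dy] := boundary_approach (center_sphere i) x1 (obs_radius_itv i) e h.
  by case: (hy dy.1) => _ []; exists i.
have : \forall y \near x, forall i, dotp (obs_center i) y < cos (obs_radius i).
  apply: (@filter_forall _ _ (fun i => [set y | dotp (obs_center i) y < cos (obs_radius i)])
    (nbhs x)) => i.
  exact: (@dotp_continuous _ (obs_center i) x _ (lt_nbhsl (h i))).
by apply: filterS => y hy y1; apply/tableP; split=> // i; apply: ltW.
Qed.

Lemma table_int_table x : table_int B x -> table B x.
Proof. by move=> /table_intP[x1 h]; apply/tableP; split=> // i; apply/ltW. Qed.

Lemma table_cases x : table B x -> table_int B x \/ exists i, on_boundary i x.
Proof.
move=> /tableP[x1 h].
have [[i hi]|nb] := pselect (exists i, dotp (obs_center i) x = cos (obs_radius i)).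
  by right; exists i; apply/on_boundaryP.
left; apply/table_intP; split=> // i; rewrite lt_neqAle h andbT.
by apply/eqP => e; apply: nb; exists i.
Qed.

Lemma table_int_boundary x i : table_int B x -> ~ on_boundary i x.
Proof. by move=> /table_intP[_ /(_ i)] h /on_boundaryP[_ e]; rewrite e ltxx in h. Qed.

Lemma boundary_closure x i : on_boundary i x ->
  closure (sdisk (obs_center i) (obs_radius i)) x.
Proof.
move=> /on_boundaryP[x1 e] U Ux.
have [y Uy dy] := boundary_approach (center_sphere i) x1 (obs_radius_itv i) e Ux.
by exists y.
Qed.

(** Disjointness of the closed disks enters here: the table has no corner, so the bounce is
    unambiguous. *)
Lemma on_boundary_inj x i j : on_boundary i x -> on_boundary j x -> i = j.
Proof.
move=> hi hj; apply: (@obstacles_disjoint _ B i j) => //.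
by exists x; split; apply: boundary_closure.
Qed.

Lemma boundary_others x i j : table B x -> on_boundary i x -> j != i ->
  dotp (obs_center j) x < cos (obs_radius j).
Proof.
move=> /tableP[x1 h] hi ji; rewrite lt_neqAle h andbT; apply/eqP => e.
move: ji; rewrite (@on_boundary_inj x j i) ?eqxx //.
by apply/on_boundaryP.
Qed.

End Table.

(** * Billiard trajectories *)

Section Reflection.
Context {R : realType} (B : spherical_billiard R).
Implicit Types (x u v : 'rV[R]_3) (i : 'I_(obs_pred B).+1).

Lemma bounceK i x : involutive (bounce i x).
Proof.
move=> v; rewrite /bounce /=; set n := obs_normal i x.
(* For an arbitrary [x] the normal may vanish; the inverse of 0 being 0, the bounce is then the
   identity. *)
have [n0|n0] := eqVneq (dotp n n) 0.
  by rewrite n0 invr0 !mulr0 !scale0r !subr0.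
rewrite dotpDl dotpNl dotpZl -addrA -opprD -scalerDl.
have -> : 2 * dotp v n / dotp n n +
    2 * (dotp v n - 2 * dotp v n / dotp n n * dotp n n) / dotp n n = 0 by field.
by rewrite scale0r subr0.
Qed.

Lemma bounceN i x v : bounce i x (- v) = - bounce i x v.
Proof. by rewrite /bounce /= dotpNl mulrN mulNr scaleNr opprD. Qed.

Lemma obs_normal_sqr i x : on_boundary i x ->
  dotp (obs_normal i x) (obs_normal i x) = sin (obs_radius i) ^+ 2.
Proof.
move=> /on_boundaryP[]; have := center_sphere i; rewrite /sphere2 /= => c1 x1 e.
rewrite /obs_normal !dotpE (dotpC x) c1 x1 e.
by have := cos2Dsin2 (obs_radius i); rewrite !expr2; lra.
Qed.

Lemma bounce_unit_tangent i z : on_boundary i z.1 -> unit_tangent_bundle z ->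
  unit_tangent_bundle (z.1, bounce i z.1 z.2).
Proof.
move=> ib [z1 v1 zv].
have nn := obs_normal_sqr ib.
have n0 : dotp (obs_normal i z.1) (obs_normal i z.1) != 0.
  by rewrite nn expf_neq0 // lt0r_neq0 // sin_radius_gt0.
have zn : dotp z.1 (obs_normal i z.1) = 0.
  by rewrite /obs_normal !dotpE (dotpC z.1 (obs_center i)) [dotp z.1 z.1]z1; ring.
split=> //=; rewrite /bounce /=; move: (obs_normal i z.1) n0 zn => n n0 zn.
  by rewrite !dotpE (dotpC n z.2) v1; field.
by rewrite !dotpE zv zn mulr0 subr0.
Qed.

End Reflection.

Section Trajectories.
Context {R : realType} (B : spherical_billiard R).
Implicit Types (g : R -> phase R) (z y : phase R) (i : 'I_(obs_pred B).+1).

Lemma trajectory_right z g t : billiard_trajectory B z g ->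
  exists2 e, 0 < e & forall s, 0 <= s < e -> g (t + s) = geodesic s (g t).
Proof.
move=> [_ /(_ t)[_ [/near_right0P[e e0 he] _]]]; exists e => // s /andP[].
rewrite le_eqVlt => /predU1P[<- _|s0 se]; first by rewrite addr0 geodesic0.
by rewrite he // s0.
Qed.

(** The germ on the left determines the position and the incoming velocity, since geodesics that
    agree at one instant are equal. *)
Lemma trajectory_left_limit z g t y d : billiard_trajectory B z g -> 0 < d ->
  (forall s, - d < s < 0 -> g (t + s) = geodesic s y) ->
  [/\ (g t).1 = y.1, table_int B y.1 -> g t = y
    & forall i, on_boundary i y.1 -> g t = (y.1, bounce i y.1 y.2)].
Proof.
move=> [_ /(_ t)[_ [_ [u [/near_left0P[e e0 he] hi hb]]]]] d0 hd.
have [s hs1 hs2] : exists2 s, - d < s < 0 & - e < s < 0.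
  by exists (- (Num.min d e / 2)); case: (ltP d e) => ?; apply/andP; split; lra.
have ey : ((g t).1, u) = y by apply: (@geodesic_inj _ s); rewrite -he // hd.
rewrite -ey /=; split=> // [/hi <-|i /hb <-]; by case: (g t).
Qed.

Lemma trajectory_table z g t : billiard_trajectory B z g -> table B (g t).1.
Proof. by move=> [_ /(_ t)[]]. Qed.

(** Time 0 is left out of the hypothesis, so that the flight may start right after a collision. *)
Lemma trajectory_follow z g t T : billiard_trajectory B z g ->
  (forall s, 0 < s < T -> table_int B (geodesic s (g t)).1) ->
  forall s, 0 <= s < T -> g (t + s) = geodesic s (g t).
Proof.
move=> gz hT s /andP[s0]; move: s s0; apply: real_ind.
- by rewrite addr0 geodesic0.
- move=> s s0 ih; have [e e0 he] := trajectory_right (t + s) gz.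
  exists e => // r /andP[sr re] rT.
  have /he : 0 <= r - s < e by apply/andP; split; lra.
  have -> : t + s + (r - s) = t + r by ring.
  move=> ->; rewrite ih ?lexx ?s0 //; last by lra.
  by rewrite geodesicD subrK.
- move=> s s0 ih sT.
  have hs : table_int B (geodesic s (g t)).1 by apply: hT; rewrite s0.
  have [|_ /(_ hs) //] := @trajectory_left_limit z g (t + s) (geodesic s (g t)) s gz s0.
  move=> r /andP[sr r0]; rewrite -addrA ih ?geodesicD 1?addrC //; last by lra.
  by apply/andP; split; lra.
Qed.

Lemma trajectory_follow_end z g t T : billiard_trajectory B z g -> 0 < T ->
  (forall s, 0 < s < T -> table_int B (geodesic s (g t)).1) ->
  let y := geodesic T (g t) in
  [/\ (g (t + T)).1 = y.1, table_int B y.1 -> g (t + T) = y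
    & forall i, on_boundary i y.1 -> g (t + T) = (y.1, bounce i y.1 y.2)].
Proof.
move=> gz T0 hT y; apply: (trajectory_left_limit gz T0) => s /andP[sT s0].
rewrite -addrA (trajectory_follow gz hT) ?geodesicD 1?addrC //.
by apply/andP; split; lra.
Qed.

(** At a limit time the two trajectories share their germ on the left, hence the incoming velocity,
    hence the outcome of a possible collision. *)
Lemma trajectory_unique_forward z1 z2 g1 g2 t1 t2 :
  billiard_trajectory B z1 g1 -> billiard_trajectory B z2 g2 ->
  g1 t1 = g2 t2 -> forall s, 0 <= s -> g1 (t1 + s) = g2 (t2 + s).
Proof.
move=> gz1 gz2 e12; apply: real_ind.
- by rewrite !addr0.
- move=> s s0 ih; have [e e0 he] := trajectory_right (t1 + s) gz1.
  have [e' e0' he'] := trajectory_right (t2 + s) gz2.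
  exists (Num.min e e'); first by rewrite lt_min e0.
  move=> r /andP[sr]; rewrite -ltrBlDl lt_min => /andP[re re'].
  have rs : 0 <= r - s by lra.
  have -> : t1 + r = t1 + s + (r - s) by ring.
  have -> : t2 + r = t2 + s + (r - s) by ring.
  by rewrite he ?rs ?re // he' ?rs ?re' // ih ?s0 /=.
- move=> s s0 ih.
  have [_ /(_ (t1 + s))[tab [_ [u [/near_left0P[e e0 he] _ _]]]]] := gz1.
  set y := (_, u) in he.
  have [||y1 i1 b1] := @trajectory_left_limit z1 g1 (t1 + s) y (Num.min e s) gz1.
  + by rewrite lt_min e0.
  + move=> r /andP[+ r0]; rewrite ltrNl lt_min => /andP[re rs].
    by apply: he; apply/andP; split; lra.
  have [||y2 i2 b2] := @trajectory_left_limit z2 g2 (t2 + s) y (Num.min e s) gz2.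
  + by rewrite lt_min e0.
  + move=> r /andP[+ r0]; rewrite ltrNl lt_min => /andP[re rs].
    rewrite -he; last by apply/andP; split; lra.
    by rewrite -!addrA ih //; apply/andP; split; lra.
  by case: (table_cases tab) => [h|[i h]]; [rewrite i1 // i2 | rewrite (b1 i) // (b2 i)].
Qed.

Lemma trajectory_unit_tangent z g t : billiard_trajectory B z g ->
  unit_tangent_bundle (g t) -> forall s, 0 <= s -> unit_tangent_bundle (g (t + s)).
Proof.
move=> gz gt; apply: real_ind.
- by rewrite addr0.
- move=> s s0 ih; have [e e0 he] := trajectory_right (t + s) gz.
  exists e => // r /andP[sr re].
  have -> : t + r = t + s + (r - s) by ring.
  rewrite he; last by apply/andP; split; lra.
  by apply/geodesic_unit_tangent/ih; rewrite s0 lexx.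
- move=> s s0 ih.
  have [_ /(_ (t + s))[tab [_ [u [/near_left0P[e e0 he] hi hb]]]]] := gz.
  pose r := - (Num.min e s / 2).
  have [re [r0 rs]] : - e < r /\ r < 0 /\ 0 <= s + r.
    by rewrite /r; case: (ltP e s) => ?; split; try split; lra.
  have yU : unit_tangent_bundle ((g (t + s)).1, u).
    rewrite -(geodesicNK r (_, u)); apply: geodesic_unit_tangent.
    by rewrite -he ?re ?r0 // -addrA; apply: ih; apply/andP; split; lra.
  case: (g (t + s)) tab hi hb yU {he} => x v /= tab hi hb yU.
  case: (table_cases tab) => [/hi -> //|[i ib]].
  by rewrite (hb i ib); apply: (bounce_unit_tangent (z := (x, u))).
Qed.

(* The velocity recorded at a collision being the outgoing one, the reversed
   trajectory records the opposite of the incoming one. *)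
Lemma trajectory_reverse z g : billiard_trajectory B z g -> table_int B z.1 ->
  exists2 g', billiard_trajectory B (reverse z) g' &
    forall t, [/\ (g' t).1 = (g (- t)).1,
      table_int B (g (- t)).1 -> g' t = reverse (g (- t))
    & forall i, on_boundary i (g (- t)).1 ->
        g' t = ((g (- t)).1, - bounce i (g (- t)).1 (g (- t)).2)].
Proof.
move=> gz zi; have [g0 hg] := gz.
pose inc t u := [/\ \forall s \near 0^'-, g (t + s) = geodesic s ((g t).1, u),
          table_int B (g t).1 -> (g t).2 = u
        & forall i, on_boundary i (g t).1 -> (g t).2 = bounce i (g t).1 u].
have /choice[u hu] : forall t, exists u, inc t u.
  by move=> t; have [_ [_ [u hu]]] := hg t; exists u.
(* The incoming velocities [u] are only chosen, but any formula for the germ on the left computes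
   them. *)
have germ t y d : 0 < d -> (forall s, - d < s < 0 -> g (t + s) = geodesic s y) ->
    ((g t).1, u t) = y.
  move=> d0 hd; have [/near_left0P[e e0 he] _ _] := hu t.
  have [s hs1 hs2] : exists2 s, - d < s < 0 & - e < s < 0.
    by exists (- (Num.min d e / 2)); case: (ltP d e) => ?; apply/andP; split; lra.
  by apply: (@geodesic_inj _ s); rewrite -he // hd.
pose g' t : phase R := ((g (- t)).1, - u (- t)).
have hint t : table_int B (g (- t)).1 -> g' t = reverse (g (- t)).
  by move=> h; have [_ /(_ h) e _] := hu (- t); rewrite /g' -e.
exists g'; last first.
  move=> t; split=> [//||i ib]; first exact: hint.
  have [_ _ /(_ _ ib) e] := hu (- t).
  by rewrite /g' e bounceK.
(* The starting point is interior, so incoming and outgoing velocities coincide there. *)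
split; first by rewrite hint oppr0 g0.
move=> t; split; first exact: (trajectory_table (- t) gz).
split.
  apply/near_right0P; have [/near_left0P[e e0 he] _ _] := hu (- t).
  exists e => // s /andP[s0 se].
  have hs : ((g (- t - s)).1, u (- t - s)) = geodesic (- s) ((g (- t)).1, u (- t)).
    apply: (germ _ _ (e - s)); first by lra.
    move=> r /andP[r1 r2]; rewrite geodesicD -addrA (addrC (- s)); apply: he.
    by apply/andP; split; lra.
  rewrite /g' opprD -[(_, - u _)]/(reverse (_, u _)) hs.
  by rewrite -[(_, - u _)]/(reverse (_, u _)) geodesic_rev.
exists (- (g (- t)).2); split.
- apply/near_left0P; have [e e0 he] := trajectory_right (- t) gz.
  exists e => // s /andP[se s0].
  have hs : ((g (- t - s)).1, u (- t - s)) = geodesic (- s) (g (- t)).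
    apply: (germ _ _ (- s)); first by lra.
    move=> r /andP[r1 r2]; rewrite geodesicD -addrA (addrC (- s)); apply: he.
    by apply/andP; split; lra.
  rewrite /g' opprD -[(_, - u _)]/(reverse (_, u _)) hs.
  exact/esym/(geodesic_rev s (g (- t))).
- by move=> h; rewrite hint.
- by move=> i ib; have [_ _ /(_ _ ib) e] := hu (- t); rewrite bounceN e bounceK.
Qed.

(** Negative times are positive times of the reversed trajectories. At a collision these determine
    the outgoing velocity only through a bounce, which is injective. *)
Lemma trajectory_unique z g1 g2 : billiard_trajectory B z g1 ->
  billiard_trajectory B z g2 -> table_int B z.1 -> g1 =1 g2.
Proof.
move=> gz1 gz2 zi t.
have fwd g g' y s : billiard_trajectory B y g -> billiard_trajectory B y g' ->
    0 <= s -> g s = g' s.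
  move=> gy gy' s0; rewrite -[s]add0r.
  by apply: (trajectory_unique_forward gy gy') s0; rewrite gy.1 gy'.1.
have [t0|t0] := leP 0 t; first exact: fwd gz1 gz2 t0.
have [g1' gz1' h1] := trajectory_reverse gz1 zi.
have [g2' gz2' h2] := trajectory_reverse gz2 zi.
have e12 : g1' (- t) = g2' (- t) by apply: (fwd _ _ _ _ gz1' gz2'); lra.
have [] := h1 (- t); have [] := h2 (- t); rewrite opprK e12 => p2 i2 b2 p1 i1 b1.
have p12 : (g1 t).1 = (g2 t).1 by rewrite -p1.
case: (table_cases (trajectory_table t gz1)) => [hi|[i ib]].
  apply: (can_inj (@reverseK R)); rewrite -i1 //.
  by apply: i2; rewrite -p12.
have := b1 i ib; rewrite (b2 i) -?p12 // => -[] /oppr_inj /(can_inj (@bounceK _ _ _ _)) h.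
by move: p12 h; case: (g1 t) (g2 t) => ? ? [? ?] /= -> ->.
Qed.

Lemma trajectory_shift z g t : billiard_trajectory B z g ->
  billiard_trajectory B (g t) (fun s => g (t + s)).
Proof.
move=> [g0 hg]; split; first by rewrite addr0.
move=> s; have [h1 [h2 [u [h3 h4 h5]]]] := hg (t + s); split=> //; split.
  by apply: filterS h2 => r; rewrite addrA.
by exists u; split=> //; apply: filterS h3 => r; rewrite addrA.
Qed.

End Trajectories.

Section Flow.
Context {R : realType} {B : spherical_billiard R} {phi : R -> phase R -> phase R}.
Hypothesis phiB : billiard_flow B phi.
Implicit Types (s t : R) (z : phase R).

Lemma phase_reverse z : phase_space B z -> phase_space B (reverse z).
Proof. by move=> [zU zi]; split=> //; apply: unit_tangent_rev. Qed.

Lemma flow0 z : phase_space B z -> phi 0 z = z.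
Proof. by move=> /phiB[]. Qed.

Lemma flow_reverse t z : phase_space B z ->
  [/\ (phi t (reverse z)).1 = (phi (- t) z).1,
      table_int B (phi (- t) z).1 -> phi t (reverse z) = reverse (phi (- t) z)
    & forall i : 'I_(obs_pred B).+1, on_boundary i (phi (- t) z).1 ->
        phi t (reverse z) =
          ((phi (- t) z).1, - bounce i (phi (- t) z).1 (phi (- t) z).2)].
Proof.
move=> zp; have [g gz hg] := trajectory_reverse (phiB zp) zp.2.
have := hg t; rewrite (@trajectory_unique _ _ _ g (phi^~ (reverse z)) gz) //.
  exact/phiB/phase_reverse.
exact: (phase_reverse zp).2.
Qed.

Lemma flow_unit_tangent t z : phase_space B z -> unit_tangent_bundle (phi t z).
Proof.
move=> zp; have pos s y : phase_space B y -> 0 <= s -> unit_tangent_bundle (phi s y).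
  move=> yp s0; rewrite -[s]add0r; apply: (trajectory_unit_tangent (phiB yp)) => //.
  by rewrite flow0 //; case: yp.
have [t0|t0] := leP 0 t; first exact: pos.
have := pos (- t) (reverse z) (phase_reverse zp); rewrite oppr_ge0 => /(_ (ltW t0)).
have [] := flow_reverse (- t) zp; rewrite opprK => p i b.
case: (table_cases (trajectory_table t (phiB zp))) => [hi|[k hk]].
  by rewrite i // => /unit_tangent_rev; rewrite reverseK.
rewrite (b k) // -bounceN => /(bounce_unit_tangent (i := k)) /= /(_ hk).
by rewrite bounceK => /unit_tangent_rev; rewrite /reverse /= opprK; case: (phi t z).
Qed.

Lemma flow_phase t z : phase_space B z ->
  phase_space B (phi t z) <-> table_int B (phi t z).1.
Proof. by move=> zp; split=> [[]//|]; split=> //; apply: flow_unit_tangent. Qed.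

Lemma flowD s t z : phase_space B z -> phase_space B (phi t z) ->
  phi (t + s) z = phi s (phi t z).
Proof.
move=> zp tp; have := trajectory_shift t (phiB zp).
by move=> /trajectory_unique/(_ (phiB tp) tp.2 s).
Qed.

Lemma flow_opp t z : phase_space B z -> phase_space B (phi t z) ->
  phi (- t) (reverse z) = reverse (phi t z).
Proof. by move=> zp tp; have [_ + _] := flow_reverse (- t) zp; rewrite opprK; apply; case: tp. Qed.

Lemma nongrazing_phase z : nongrazing B phi z -> phase_space B z.
Proof. by case. Qed.

Lemma nongrazing_flow t z : nongrazing B phi z -> phase_space B (phi t z) ->
  nongrazing B phi (phi t z).
Proof.
move=> [zp ng] tp; split=> // s i; rewrite -flowD //; exact: ng.
Qed.

(** A bounce only changes the sign of the normal component of the velocity, so incoming and outgoing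
    velocities graze together. *)
Lemma nongrazing_reverse z : nongrazing B phi z -> nongrazing B phi (reverse z).
Proof.
move=> [zp ng]; split; first exact: phase_reverse.
move=> t i; have [-> _ b] := flow_reverse t zp => ib.
rewrite (b i ib) /= dotpNl oppr_eq0; have := ng (- t) i ib.
rewrite /bounce /=; set n := obs_normal i _; set v := (phi _ _).2 => vn.
have n0 : dotp n n != 0.
  by rewrite obs_normal_sqr // expf_neq0 // lt0r_neq0 // sin_radius_gt0.
by rewrite dotpDl dotpNl dotpZl divfK //; move: vn; apply: contra => /eqP h; apply/eqP; lra.
Qed.

End Flow.

(** * Expansion of the cone, free flights *)

Section Expansion.
Context {R : realType}.

Lemma flight_expansion (H k : R) : 0 <= H < pi / 2 -> tan H < k ->
  exists2 c, 0 < c & forall t, 0 <= t <= H ->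
    [/\ 0 <= sin t, 0 < cos t, 0 <= k * cos t - sin t
      & expR (c * t) <= cos t + k * sin t].
Proof.
move=> /andP[H0 H1] Hk; have pi0 := pi_gt0 R.
have cH : 0 < cos H by apply: cos_gt0_pihalf; apply/andP; split; lra.
have sH : 0 <= sin H by apply: sin_ge0_pi; apply/andP; split; lra.
have b0 : 0 < k * cos H - sin H.
  by rewrite subr_gt0 -ltr_pdivrMr.
have k0 : 0 < k by apply: le_lt_trans Hk; apply: divr_ge0 => //; apply: ltW.
set b := k * cos H - sin H in b0.
have slope t : 0 <= t <= H -> [/\ 0 <= sin t, 0 < cos t & b <= k * cos t - sin t].
  move=> /andP[t0 tH]; split.
  - by apply: sin_ge0_pi; apply/andP; split; lra.
  - by apply: cos_gt0_pihalf; apply/andP; split; lra.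
  - have ct : cos H <= cos t.
      by rewrite leNgt ltr_cos ?in_itv /= -?leNgt //; apply/andP; split; lra.
    have st : sin t <= sin H.
      by rewrite leNgt ltr_sin ?in_itv /= -?leNgt //; apply/andP; split; lra.
    by apply: lerB => //; rewrite ler_pM2l.
(* [b / 2] leaves room for [1 + 2 c t <= 1 + b t]; [1 / 4] gives [c t <= 1 / 2], because
   [t < pi / 2 < 2]. *)
exists (Num.min (b / 2) (1 / 4)); first by rewrite lt_min; apply/andP; split; lra.
set c := Num.min _ _ => t tH; have [t0 tH'] := andP tH.
have [s1 c1 d1] := slope t tH; split=> //; first by lra.
have c4 : c <= 1 / 4 by rewrite ge_min lexx orbT.
have cb : c <= b / 2 by rewrite ge_min lexx.
have c0 : 0 < c by rewrite lt_min; apply/andP; split; lra.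
have pi2 : pi / 2 < 2 :> R by case/andP: (pihalf_02 R).
have ct0 : 0 <= c * t by rewrite mulr_ge0 // ltW.
have ct2 : c * t <= 1 / 2 by nra.
(* From [exp (- x) >= 1 - x] one gets [exp x <= 1 / (1 - x)], which is at most [1 + 2 x] for
   [0 <= x <= 1 / 2]. *)
have e1 : expR (c * t) <= 1 + 2 * (c * t).
  have := expR_ge1Dx (- (c * t)); rewrite expRN => h.
  have e0 := expR_gt0 (c * t).
  have : (1 - c * t) * expR (c * t) <= 1.
    by rewrite -ler_pdivlMr // mul1r.
  by set E := expR _ in e0 *; set x := c * t in ct0 ct2 *; nra.
apply: le_trans e1 _.
pose f (u : R) := cos u + k * sin u.
have df (u : R) : is_derive u 1 f (- sin u + k * cos u).
  exact: (is_deriveD (is_derive_cos u) (is_deriveZ k (is_derive_sin u))).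
have fc : {within `[0, t], continuous f}.
  by apply: derivable_within_continuous => x _; have := df x => -[].
have [u ut fu] := MVT_segment t0 (fun x _ => df x) fc.
have [_ _ d2] : [/\ 0 <= sin u, 0 < cos u & b <= k * cos u - sin u].
  by apply: slope; move: ut; rewrite in_itv /= => /andP[u0 ut]; apply/andP; split; lra.
have f0 : f 0 = 1 by rewrite /f cos0 sin0 mulr0 addr0.
move: fu; rewrite subr0 f0 -/(f t) => fu.
have : b * t <= (- sin u + k * cos u) * t by apply: ler_wpM2r => //; lra.
have : 2 * (c * t) <= b * t by rewrite mulrA; apply: ler_wpM2r => //; lra.
by lra.
Qed.

Local Ltac pos := repeat (assumption || apply: sqr_ge0 || apply: ler0n ||
  apply: addr_ge0 || apply: mulr_ge0).

(* [w2 + kappa w1] is the derivative of the Jacobi field just after a collision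
   of curvature [kappa]; the field starts the next collision in the same cone. *)
Lemma cone_expansion (w1 w2 : 'rV[R]_3) (k kappa t E : R) :
  0 < k -> k <= kappa -> 0 <= E -> 0 <= sin t -> 0 < cos t ->
  0 <= k * cos t - sin t -> E <= cos t + k * sin t -> 0 <= dotp w1 w2 ->
  let w' := geodesic t (w1, w2 + kappa *: w1) in
  0 <= dotp w'.1 w'.2 /\
  E ^+ 2 * dotp (w2 + k *: w1) (w2 + k *: w1) <=
    dotp (w'.2 + k *: w'.1) (w'.2 + k *: w'.1).
Proof.
move=> k0 kk E0 s0 c0 g0 Ef q0 /=.
have p0 := dotp_ge0 w1; have r0 := dotp_ge0 w2.
rewrite !dotpE (dotpC w2 w1).
move: (dotp w1 w1) (dotp w1 w2) (dotp w2 w2) p0 q0 r0 => p q r p0 q0 r0.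
move: (sin t) (cos t) s0 c0 g0 Ef => s c s0 c0 g0 Ef.
have kp0 : 0 <= kappa by lra.
have g1 : 0 <= kappa * c - s.
  by apply: le_trans g0 _; apply: lerB => //; apply: ler_wpM2r => //; apply: ltW.
have c0' := ltW c0; have k0' := ltW k0.
split.
  (* Regrouped so that every factor is nonnegative, [kappa * c - s] included. *)
  rewrite (_ : _ + _ = c ^+ 2 * q + c * (kappa * c - s) * p +
      s * c * (r + kappa * q) + s * (kappa * c - s) * (q + kappa * p)); last by ring.
  by pos.
have y0 : r + 2 * k * q + k ^+ 2 * p <= r + 2 * kappa * q + kappa ^+ 2 * p.
  have kk0 : 0 <= kappa - k by rewrite subr_ge0.
  rewrite -subr_ge0 (_ : _ - _ = 2 * ((kappa - k) * q) +
    (kappa - k) * (kappa + k) * p); last by ring.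
  by pos.
have z0 : 0 <= r + 2 * k * q + k ^+ 2 * p.
  by pos.
have EE : E ^+ 2 <= (c + k * s) ^+ 2.
  by rewrite lerXn2r ?nnegrE //; apply: le_trans Ef.
apply: (@le_trans _ _ ((c + k * s) ^+ 2 * (r + 2 * kappa * q + kappa ^+ 2 * p))).
  rewrite (_ : E ^+ 2 * _ = E ^+ 2 * (r + 2 * k * q + k ^+ 2 * p)); last by ring.
  by apply: ler_pM => //; exact: sqr_ge0.
(* With [u = w2 + kappa w1], the vector [w'.2 + k *: w'.1] is [(c + k s) u + (k c - s) w1], and the
   scalar product of [u] and [w1] is [q + kappa p >= 0]: dropping [w1] only shortens it. *)
rewrite -subr_ge0.
rewrite (_ : _ - _ = 2 * ((c + k * s) * (k * c - s) * (q + kappa * p)) +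
   (k * c - s) ^+ 2 * p); last by ring.
by pos.
Qed.

End Expansion.

(** * Next collision and horizon *)

Section NextCollision.
Context {R : realType} (B : spherical_billiard R).
Implicit Types (z : phase R) (a b s t : R).

(* Nothing is required at time 0, so that the notion makes sense right after a
   collision. *)
Definition next_collision z a : Prop :=
  [/\ 0 < a, forall s, 0 < s < a -> table_int B (geodesic s z).1
    & exists i : 'I_(obs_pred B).+1, on_boundary i (geodesic a z).1].

Lemma next_collision_unique z a b : next_collision z a -> next_collision z b -> a = b.
Proof.
have ge a' b' : next_collision z a' -> next_collision z b' -> a' <= b'.
  move=> [a0 ha _] [b0 _ [i hb]]; rewrite leNgt; apply/negP => ba.
  by apply: (@table_int_boundary _ _ _ i) hb; apply: ha; rewrite b0.
by move=> ha hb; apply/eqP; rewrite eq_le !ge.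
Qed.

Lemma next_collision_geodesic z a t : 0 <= t < a -> next_collision z a ->
  next_collision (geodesic t z) (a - t).
Proof.
move=> /andP[t0 ta] [a0 ha hb]; split; first by lra.
- move=> s /andP[s0 sa]; rewrite geodesicD; apply: ha; apply/andP; split; lra.
- by rewrite geodesicD subrK.
Qed.

Lemma table_int_open z s : unit_tangent_bundle z -> table_int B (geodesic s z).1 ->
  exists2 e, 0 < e & forall r, `|r| < e -> table_int B (geodesic (s + r) z).1.
Proof.
move=> zU /table_intP[_ h].
have : \forall t \near s, forall i,
    dotp (obs_center (s := B) i) (geodesic t z).1 < cos (obs_radius i).
  apply: (@filter_forall _ _ (fun i => [set t | dotp (obs_center (s := B) i)
    (geodesic t z).1 < cos (obs_radius i)]) (nbhs s)) => i.
  exact: (@height_time_continuous _ (obs_center i) z s _ (lt_nbhsl (h i))).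
move=> /nbhs_ballP[e /= e0 he]; exists e => // r re; apply/table_intP; split.
  by case: (@geodesic_unit_tangent _ (s + r) z zU).
by apply: he; rewrite /ball /= opprD addNKr normrN.
Qed.

Lemma table_limit z a : unit_tangent_bundle z -> 0 < a ->
  (forall s, 0 < s < a -> table_int B (geodesic s z).1) -> table B (geodesic a z).1.
Proof.
move=> zU a0 h; apply/tableP; split=> [|i]; first by case: (@geodesic_unit_tangent _ a z zU).
rewrite leNgt; apply/negP => lt.
have := @height_time_continuous _ (obs_center i) z a _ (lt_nbhsr lt).
move=> /nbhs_ballP[e /= e0 he].
pose r := Num.min e a / 2.
have r0 : 0 < r < e /\ r < a.
  by rewrite /r; case: (ltP e a) => ?; split; try (apply/andP; split); lra.
have : ball a e (a - r).
  by rewrite /ball /= opprB addrCA subrr addr0 gtr0_norm; lra.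
move=> /he /=; have /h /table_intP[_ /(_ i)] : 0 < a - r < a by lra.
by move=> /lt_trans h' /h'; rewrite ltxx.
Qed.

Lemma flight_le_horizon z a : horizon B < pi / 2 -> unit_tangent_bundle z ->
  table B z.1 -> (forall s, 0 < s < a -> table_int B (geodesic s z).1) ->
  a <= horizon B.
Proof.
move=> H2 zU z1 h; rewrite leNgt; apply/negP => Ha; have pi0 := pi_gt0 R.
rewrite /horizon in H2 Ha; set S := (X in sup X) in H2 Ha.
have Sup : has_ubound S by exists (2 * pi) => l [/andP[]].
have H0 : 0 <= sup S.
  apply: ub_le_sup => //; split; first by rewrite lexx mulr_ge0 ?pi_ge0.
  by exists z => // s; rewrite -eq_le => /eqP <-; rewrite geodesic0.
(* The horizon is about closed arcs of length at most [2 pi], while the flight is known on an open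
   interval only: [l] lies strictly between [sup S] and both [a] and [2 pi]. *)
pose l := (sup S + Num.min a (2 * pi)) / 2.
have [l1 l2 l3] : [/\ sup S < l, l < a & l < 2 * pi].
  by rewrite /l; case: (ltP a (2 * pi)) => ?; split; lra.
have : S l.
  split; first by apply/andP; split; lra.
  exists z => // s /andP[]; rewrite le_eqVlt => /predU1P[<- _|s0 sl].
    by rewrite geodesic0.
  by apply/table_int_table/h; apply/andP; split; lra.
by move=> /(ub_le_sup Sup); rewrite leNgt l1.
Qed.

(** Otherwise the flight would never end, and its first part of length [pi / 2] would exceed the
    horizon. The initial interval [d] is what starts the induction, as [z] may lie on a boundary. *)
Lemma next_collision_exists z d : horizon B < pi / 2 -> unit_tangent_bundle z ->
  table B z.1 -> 0 < d -> (forall s, 0 < s < d -> table_int B (geodesic s z).1) ->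
  exists2 a, next_collision z a & a <= horizon B.
Proof.
move=> H2 zU z1 d0 hd; have pi0 := pi_gt0 R.
have [[a ha]|nc] := pselect (exists a, next_collision z a).
  by exists a => //; apply: (flight_le_horizon H2 zU z1); case: ha.
(* The redundant [0 < s] makes the base case of the induction vacuous. *)
suff h : forall s, 0 <= s -> 0 < s -> table_int B (geodesic s z).1.
  have : pi / 2 <= horizon B.
    apply: (flight_le_horizon H2 zU z1) => s /andP[s0 _].
    by apply: h => //; apply: ltW.
  by rewrite leNgt H2.
apply: real_ind => [|s|s s0 ih _]; first by rewrite ltxx.
  rewrite le_eqVlt => /predU1P[<- _|s0 ih].
    by exists d => // r /andP[r0 rd] _; apply: hd; apply/andP; split; lra.
  have [|e e0 he] := @table_int_open z s zU; first by apply: ih; rewrite ?lexx ?ltW.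
  exists e => // r /andP[sr re] _; have -> : r = s + (r - s) by ring.
  by apply: he; rewrite gtr0_norm; lra.
have hs r : 0 < r < s -> table_int B (geodesic r z).1.
  by move=> /andP[r0 rs]; apply: ih => //; rewrite rs ltW.
case: (table_cases (table_limit zU s0 hs)) => // -[i ib].
by case: nc; exists s; split=> //; exists i.
Qed.

End NextCollision.

(** * Differential of a collision *)

Section Differentials.
Context {R : realType}.
Implicit Types (V W : normedModType R).

Lemma is_diff_lin V W (f : {linear V -> W}) x : continuous f -> is_diff x f f.
Proof. by move=> cf; apply: DiffDef; [exact: linear_differentiable | exact: diff_lin]. Qed.

Lemma is_diff_add V W (f g df dg : V -> W) x : is_diff x f df -> is_diff x g dg ->
  is_diff x (fun y => f y + g y) (fun h => df h + dg h).
Proof. exact: is_diffD. Qed.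

Lemma is_diff_opp V W (f df : V -> W) x : is_diff x f df ->
  is_diff x (fun y => - f y) (fun h => - df h).
Proof. exact: is_diffN. Qed.

Lemma is_diff_const V W (a : W) (x : V) : is_diff x (fun=> a) (fun=> 0).
Proof. exact: is_diff_cst. Qed.

Lemma is_diff_mul V (f g df dg : V -> R) x : is_diff x f df -> is_diff x g dg ->
  is_diff x (fun y => f y * g y) (fun h => f x * dg h + g x * df h).
Proof. exact: is_diffM. Qed.

Lemma scale_is_bilinear V : bilinear_for
  (GRing.Scale.Law.clone _ _ ( *:%R ) _) (GRing.Scale.Law.clone _ _ ( *:%R ) _)
  (@GRing.scale R V : R -> V -> V).
Proof.
split=> [u' a x y|u a x y] /=; first by rewrite scalerDl scalerA.
by rewrite scalerDr !scalerA mulrC.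
Qed.

HB.instance Definition _ V := bilinear_isBilinear.Build R R V V _ _ (@GRing.scale R V)
  (@scale_is_bilinear V).

Lemma is_diff_scale V W (f df : V -> R) (g dg : V -> W) x :
  is_diff x f df -> is_diff x g dg ->
  is_diff x (fun y => f y *: g y) (fun h => f x *: dg h + df h *: g x).
Proof.
move=> hf hg; have cs := @scale_continuous R W.
pose s (p : R * W) := p.1 *: p.2.
have hs : is_diff (f x, g x) s (fun p => f x *: p.2 + p.1 *: g x).
  apply: DiffDef; first exact: differentiable_bilin.
  exact: (diff_bilin _ cs).
exact: (@is_diff_comp _ _ _ _ _ _ _ _ _ (is_diff_pair hf hg) hs).
Qed.

Lemma is_diff_comp1 V (f df : V -> R) (h : R -> R) x d :
  is_diff x f df -> is_derive (f x) 1 h d ->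
  is_diff x (fun y => h (f y)) (fun v => d * df v).
Proof.
move=> hf [hd hv].
have dh : is_diff (f x) h ( *:%R^~ d).
  apply: DiffDef; first exact/derivable1_diffP.
  by rewrite deriv1E // derive1E hv.
apply: is_diff_eq (is_diff_comp hf dh) _.
by apply/funext => v /=; rewrite mulrC.
Qed.

Lemma is_diff_inv V (f df : V -> R) x : is_diff x f df -> f x != 0 ->
  is_diff x (fun y => (f y)^-1) (fun v => - (f x) ^- 2 * df v).
Proof.
move=> hf f0; have hi : is_diff (f x) (GRing.inv : R -> R) (fun h => - (f x) ^- 2 *: h).
  by apply: DiffDef; [exact: differentiable_Rinv | exact: diff_Rinv].
exact: (is_diff_comp hf hi).
Qed.

Lemma is_diff_continuous V W (f df : V -> W) x : is_diff x f df -> {for x, continuous f}.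
Proof. by case=> hf _; apply: differentiable_continuous. Qed.

End Differentials.

Section LinearMaps.
Context {R : realType}.

(** The cosine of the distance to [c] for points of the sphere. Along [geodesic t z] it equals
    [height * cos t + speed * sin t]. *)
Definition height (c : 'rV[R]_3) (z : phase R) : R := dotp c z.1.

Definition speed (c : 'rV[R]_3) (z : phase R) : R := dotp c z.2.

Fact height_is_linear c : linear (height c).
Proof. by move=> a z w; rewrite /height !phaseE !dotpE. Qed.
HB.instance Definition _ c := GRing.isLinear.Build R (phase R) R _ (height c)
  (height_is_linear c).

Fact speed_is_linear c : linear (speed c).
Proof. by move=> a z w; rewrite /speed !phaseE !dotpE. Qed.
HB.instance Definition _ c := GRing.isLinear.Build R (phase R) R _ (speed c)
  (speed_is_linear c).

Fact geodesic_is_linear t : linear (@geodesic R t).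
Proof. by move=> a z w; rewrite geodesicDr geodesicZr. Qed.
HB.instance Definition _ t := GRing.isLinear.Build R (phase R) (phase R) _
  (@geodesic R t) (geodesic_is_linear t).

Fact reverse_is_linear : linear (@reverse R).
Proof.
move=> a [x v] [y u]; rewrite /reverse !phaseE /=.
by congr pair; apply/rowP => k; rewrite !mxE; ring.
Qed.
HB.instance Definition _ := GRing.isLinear.Build R (phase R) (phase R) _
  (@reverse R) reverse_is_linear.

Lemma is_diff_height c z : is_diff z (height c) (height c).
Proof.
apply: is_diff_lin => w; apply: continuous_comp; last exact: dotp_continuous.
exact: continuous_fst.
Qed.

Lemma is_diff_speed c z : is_diff z (speed c) (speed c).
Proof.
apply: is_diff_lin => w; apply: continuous_comp; last exact: dotp_continuous.
exact: continuous_snd.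
Qed.

Lemma is_diff_geodesic t z : is_diff z (@geodesic R t) (geodesic t).
Proof. exact/is_diff_lin/geodesic_continuous. Qed.

Lemma is_diff_fst (z : phase R) : is_diff z fst fst.
Proof. exact/is_diff_lin/continuous_fst. Qed.

Lemma is_diff_snd (z : phase R) : is_diff z snd snd.
Proof. exact/is_diff_lin/continuous_snd. Qed.

End LinearMaps.

(* [geodesic s z] crosses the circle [dotp c x = C], inwards, at the time [s]
   of cosine [hit_cos] and sine [hit_sin], with radial speed [hit_speed];
   [collision_map] is the bounce there, carried back by the time [s]. *)
Section CollisionMap.
Context {R : realType} (c : 'rV[R]_3) (C : R).
Implicit Types (z w : phase R).

Definition hit_speed z := Num.sqrt (height c z ^+ 2 + speed c z ^+ 2 - C ^+ 2).

(** With [p] the height, [q] the speed and [D] the hitting speed, Cramer's rule for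
    [p cos s + q sin s = C] and [q cos s - p sin s = D]. Working with the cosine and the sine of [s]
    keeps the collision map algebraic. *)
Definition hit_cos z :=
  (height c z * C + speed c z * hit_speed z) / (height c z ^+ 2 + speed c z ^+ 2).

Definition hit_sin z :=
  (speed c z * C - height c z * hit_speed z) / (height c z ^+ 2 + speed c z ^+ 2).

Definition hit_normal z := c - C *: (hit_cos z *: z.1 + hit_sin z *: z.2).

(** By linearity of [geodesic], only the jump [- (2 D / (1 - C ^ 2)) m] of the velocity, with [m]
    the normal, has to be carried back by time [s]; it is added to [z]. *)
Definition collision_map z : phase R :=
  z + (2 / (1 - C ^+ 2)) *: ((hit_speed z * hit_sin z) *: hit_normal z,
                             - ((hit_speed z * hit_cos z) *: hit_normal z)).

Lemma hit_cos2Dsin2 z : C ^+ 2 < height c z ^+ 2 + speed c z ^+ 2 ->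
  hit_cos z ^+ 2 + hit_sin z ^+ 2 = 1.
Proof.
move=> h; rewrite /hit_cos /hit_sin.
have N0 : height c z ^+ 2 + speed c z ^+ 2 != 0.
  by apply: lt0r_neq0; apply: le_lt_trans h; exact: sqr_ge0.
have D2 : hit_speed z ^+ 2 = height c z ^+ 2 + speed c z ^+ 2 - C ^+ 2.
  by rewrite sqr_sqrtr // subr_ge0 ltW.
move: (height c z) (speed c z) (hit_speed z) D2 N0 => p q D D2 N0.
have -> : ((p * C + q * D) / (p ^+ 2 + q ^+ 2)) ^+ 2 +
    ((q * C - p * D) / (p ^+ 2 + q ^+ 2)) ^+ 2 =
    (p ^+ 2 + q ^+ 2) * (C ^+ 2 + D ^+ 2) / (p ^+ 2 + q ^+ 2) ^+ 2 by field.
by rewrite D2 (addrC (C ^+ 2)) subrK -expr2 divff // expf_neq0.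
Qed.

Lemma hit_height z s : C ^+ 2 < height c z ^+ 2 + speed c z ^+ 2 ->
  cos s = hit_cos z -> sin s = hit_sin z ->
  dotp c (geodesic s z).1 = C /\ dotp c (geodesic s z).2 = hit_speed z.
Proof.
move=> h cs sn; rewrite /= !dotpE cs sn -/(height c z) -/(speed c z).
have N0 : height c z ^+ 2 + speed c z ^+ 2 != 0.
  by apply: lt0r_neq0; apply: le_lt_trans h; exact: sqr_ge0.
rewrite /hit_cos /hit_sin.
by move: (height c z) (speed c z) (hit_speed z) N0 => p q D N0; split; field.
Qed.

Variable z0 : phase R.
Hypotheses (C0 : 0 < C) (pC : height c z0 = C) (D0 : 0 < speed c z0).

Lemma hit_speed_base : hit_speed z0 = speed c z0.
Proof.
rewrite /hit_speed pC (_ : _ - _ = speed c z0 ^+ 2); last by ring.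
by rewrite sqrtr_sqr gtr0_norm.
Qed.

Let N0 : C ^+ 2 + speed c z0 ^+ 2 != 0.
Proof. by apply: lt0r_neq0; rewrite addr_gt0 ?exprn_gt0. Qed.

Definition hit_speed_diff w := (C * height c w + speed c z0 * speed c w) / speed c z0.

Lemma is_diff_sumsq : is_diff z0 (fun z => height c z ^+ 2 + speed c z ^+ 2)
  (fun w => 2 * (C * height c w + speed c z0 * speed c w)).
Proof.
apply: is_diff_eq (is_diff_add (is_diff_mul (is_diff_height c z0) (is_diff_height c z0))
  (is_diff_mul (is_diff_speed c z0) (is_diff_speed c z0))) _.
by apply/funext => w; rewrite pC; ring.
Qed.

Lemma is_diff_hit_speed : is_diff z0 hit_speed hit_speed_diff.
Proof.
have d0 : is_diff z0 (fun z => height c z ^+ 2 + speed c z ^+ 2 - C ^+ 2)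
    (fun w => 2 * (C * height c w + speed c z0 * speed c w)).
  apply: is_diff_eq (is_diff_add is_diff_sumsq (is_diff_const (- C ^+ 2) z0)) _.
  by apply/funext => w; rewrite addr0.
have s0 : Num.sqrt (height c z0 ^+ 2 + speed c z0 ^+ 2 - C ^+ 2) = speed c z0 := hit_speed_base.
have i0 : 0 < height c z0 ^+ 2 + speed c z0 ^+ 2 - C ^+ 2.
  by rewrite pC (_ : _ - _ = speed c z0 ^+ 2) ?exprn_gt0 //; ring.
apply: is_diff_eq (is_diff_comp1 d0 (is_derive1_sqrt i0)) _.
apply/funext => w; rewrite [Num.sqrt _]s0 /hit_speed_diff.
by have := lt0r_neq0 D0; move: (speed c z0) (speed c w) => a b a0; field.
Qed.

Lemma is_diff_inv_sumsq : is_diff z0 (fun z => (height c z ^+ 2 + speed c z ^+ 2)^-1)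
  (fun w => - (2 * (C * height c w + speed c z0 * speed c w)) /
     (C ^+ 2 + speed c z0 ^+ 2) ^+ 2).
Proof.
have n0 : height c z0 ^+ 2 + speed c z0 ^+ 2 != 0 by rewrite pC.
apply: is_diff_eq (is_diff_inv is_diff_sumsq n0) _.
by apply/funext => w; rewrite pC !mulNr mulrC.
Qed.

(** At the base point the hitting time is 0, where the cosine is stationary. *)
Lemma is_diff_hit_cos : is_diff z0 hit_cos (fun=> 0).
Proof.
apply: is_diff_eq (is_diff_mul (is_diff_add
  (is_diff_mul (is_diff_height c z0) (is_diff_const C z0))
  (is_diff_mul (is_diff_speed c z0) is_diff_hit_speed)) is_diff_inv_sumsq) _.
apply/funext => w /=; rewrite hit_speed_base pC /hit_speed_diff.
have := lt0r_neq0 D0; move: N0.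
by move: (speed c z0) (speed c w) (height c w) => a b d a0 n0; field; rewrite n0 a0.
Qed.

(** To first order the sine is the hitting time itself, and a point higher by [h] arrives earlier by
    [h / speed]. *)
Lemma is_diff_hit_sin : is_diff z0 hit_sin (fun w => - height c w / speed c z0).
Proof.
apply: is_diff_eq (is_diff_mul (is_diff_add
  (is_diff_mul (is_diff_speed c z0) (is_diff_const C z0))
  (is_diff_opp (is_diff_mul (is_diff_height c z0) is_diff_hit_speed))) is_diff_inv_sumsq) _.
apply/funext => w /=; rewrite hit_speed_base pC /hit_speed_diff.
have := lt0r_neq0 D0; move: N0.
by move: (speed c z0) (speed c w) (height c w) => a b d a0 n0; field; rewrite n0 a0.
Qed.

End CollisionMap.

Section CollisionDifferential.
Context {R : realType} (c : 'rV[R]_3) (C : R) (z0 : phase R).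
Hypotheses (C0 : 0 < C) (pC : height c z0 = C) (D0 : 0 < speed c z0).
Implicit Types w : phase R.

Definition collision_diff w : phase R :=
  w + (2 / (1 - C ^+ 2)) *: ((- height c w) *: (c - C *: z0.1),
    (C * speed c z0) *: (w.1 - (height c w / speed c z0) *: z0.2) -
    ((C * height c w + speed c z0 * speed c w) / speed c z0) *: (c - C *: z0.1)).

Let D0' : speed c z0 != 0 := lt0r_neq0 D0.

Lemma hit_cos_base : hit_cos c C z0 = 1.
Proof.
rewrite /hit_cos (hit_speed_base pC D0) pC -!expr2 divff //.
by apply: lt0r_neq0; rewrite addr_gt0 ?exprn_gt0.
Qed.

Lemma hit_sin_base : hit_sin c C z0 = 0.
Proof. by rewrite /hit_sin (hit_speed_base pC D0) pC [C * _]mulrC subrr mul0r. Qed.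

Lemma is_diff_hit_normal : is_diff z0 (hit_normal c C)
  (fun w => - (C *: (w.1 - (height c w / speed c z0) *: z0.2))).
Proof.
have hc := is_diff_hit_cos C0 pC D0; have hs := is_diff_hit_sin C0 pC D0.
apply: is_diff_eq (is_diff_add (is_diff_const c z0) (is_diff_opp (is_diff_scale
  (is_diff_const C z0) (is_diff_add (is_diff_scale hc (is_diff_fst z0))
     (is_diff_scale hs (is_diff_snd z0)))))) _.
apply/funext => w; rewrite hit_cos_base hit_sin_base; apply/rowP => k; rewrite !mxE.
by ring.
Qed.

Lemma hit_normal_base : hit_normal c C z0 = c - C *: z0.1.
Proof. by rewrite /hit_normal hit_cos_base hit_sin_base scale0r scale1r addr0. Qed.

Lemma is_diff_collision_map : is_diff z0 (collision_map c C) collision_diff.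
Proof.
have hD := is_diff_hit_speed pC D0; have hm := is_diff_hit_normal.
have hc := is_diff_hit_cos C0 pC D0; have hs := is_diff_hit_sin C0 pC D0.
apply: is_diff_eq (is_diff_add (is_diff_id z0) (is_diff_scale
  (is_diff_const (2 / (1 - C ^+ 2)) z0) (is_diff_pair
    (is_diff_scale (is_diff_mul hD hs) hm)
    (is_diff_opp (is_diff_scale (is_diff_mul hD hc) hm))))) _.
apply/funext => w; rewrite hit_cos_base hit_sin_base (hit_speed_base pC D0) hit_normal_base.
rewrite /collision_diff /hit_speed_diff scale0r addr0.
congr (_ + _ *: _); congr pair; apply/rowP => k; rewrite !mxE; field; exact: D0'.
Qed.

Lemma collision_map_base : collision_map c C z0 =
  (z0.1, z0.2 - (2 * speed c z0 / (1 - C ^+ 2)) *: (c - C *: z0.1)).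
Proof.
rewrite /collision_map hit_cos_base hit_sin_base hit_normal_base (hit_speed_base pC D0).
rewrite [2 * _ / _]mulrAC; move: (2 / _) => a; case: (z0) => x v;
  congr pair; apply/rowP => k; rewrite !mxE; ring.
Qed.

Hypotheses (zU : unit_tangent_bundle z0) (c1 : sphere2 c).

(* Mirror equation: [J] becomes [S J] and [J'] becomes [S J' + kappa S J], where
   [S] is the reflection and [kappa] is [2 cot r / cos theta]. *)
Lemma collision_diff_perp w : perp z0 w ->
  let n := c - C *: z0.1 in
  let S u := u - (2 * dotp u n / dotp n n) *: n in
  collision_diff w = (S w.1, S w.2 + (2 * C / speed c z0) *: S w.1).
Proof.
move=> zw /=; have [x1 v1 xv] := zU.
have cc : dotp c c = 1 := c1; have xx : dotp z0.1 z0.1 = 1 := x1.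
have [n zn] := frame_exists zU; rewrite (perp_frame zU zn zw).
set j := dotp n w.1; set j' := dotp n w.2.
have [n1 xn vn] := zn.
set g := dotp c n.
(* The normal has components [speed c z0] along the velocity and [g] along [n]. In this frame the
   mirror equation becomes a rational identity. *)
have ec : c - C *: z0.1 = speed c z0 *: z0.2 + g *: n.
  rewrite {1}(frame_expand c zU zn) (dotpC z0.1) (dotpC z0.2) (dotpC n).
  by rewrite -/(height c z0) -/(speed c z0) pC -/g addrAC [C *: _ + _ - _]addrAC subrr add0r.
have S2 : 1 - C ^+ 2 = speed c z0 ^+ 2 + g ^+ 2.
  have : dotp (c - C *: z0.1) (c - C *: z0.1) = speed c z0 ^+ 2 + g ^+ 2.
    by rewrite ec !dotpE (dotpC n) v1 n1 vn; ring.
  move=> <-; rewrite !dotpE (dotpC z0.1) cc xx.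
  by move: pC; rewrite /height => ->; ring.
have S0 : speed c z0 ^+ 2 + g ^+ 2 != 0.
  by apply: lt0r_neq0; rewrite ltr_wpDr ?sqr_ge0 ?exprn_gt0.
have hj : height c (j *: n, j' *: n) = j * g by rewrite /height dotpZr.
have sj : speed c (j *: n, j' *: n) = j' * g by rewrite /speed dotpZr.
rewrite /collision_diff hj sj ec S2 /=.
have nn : dotp (speed c z0 *: z0.2 + g *: n) (speed c z0 *: z0.2 + g *: n) =
    speed c z0 ^+ 2 + g ^+ 2.
  by rewrite !dotpE (dotpC n) v1 n1 vn; ring.
have nj a : dotp (a *: n) (speed c z0 *: z0.2 + g *: n) = a * g.
  by rewrite !dotpE (dotpC n z0.2) n1 vn; ring.
rewrite nn !nj; congr pair; apply/rowP => k; rewrite !mxE; field.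
  exact: S0.
by rewrite S0 D0'.
Qed.

(** Infinitesimal form of the fact that the collision map commutes with small displacements along
    the geodesic. *)
Lemma collision_diff_flow : collision_diff (flow_vec z0) = flow_vec (collision_map c C z0).
Proof.
have hh : height c (flow_vec z0) = speed c z0 by [].
have hs : speed c (flow_vec z0) = - C by rewrite /speed dotpNr -pC.
rewrite /collision_diff hh hs collision_map_base /flow_vec /=.
have := D0'; rewrite [2 * speed c z0 / _]mulrAC; move: (speed c z0) (2 / (1 - C ^+ 2)) => q a q0.
by congr pair; apply/rowP => k; rewrite !mxE; field.
Qed.

End CollisionDifferential.

(** * The flow near a flight and near a collision *)

Lemma collision_window (R : realType) (a b e1 e2 p s : R) :
  a < e1 -> b < e2 -> a < p / 2 -> b < p / 2 -> `|s| < Num.min a b ->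
  [/\ 0 < a + s < a + b,
    forall r, 0 < r < a + s -> - p < r - (a + s) < 0 /\ `|r - (a + s) + s| < e1
    & forall r, 0 < r <= a + b - (a + s) -> 0 < r < p /\ `|r + s| < e2].
Proof.
move=> ae be ap bp; rewrite lt_min !ltr_norml => /andP[/andP[? ?] /andP[? ?]].
split=> [|r /andP[? ?]|r /andP[? ?]]; first by apply/andP; split; lra.
  by rewrite ltr_norml; split; apply/andP; split; lra.
by rewrite ltr_norml; split; apply/andP; split; lra.
Qed.

Section LocalFlow.
Context {R : realType} {B : spherical_billiard R} {phi : R -> phase R -> phase R}.
Hypothesis phiB : billiard_flow B phi.
Implicit Types (s t a b : R) (z y : phase R) (i j : 'I_(obs_pred B).+1).

Local Notation center i := (obs_center (s := B) i).
Local Notation Cos i := (cos (obs_radius (s := B) i)).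

(** Joint continuity in time and starting point gives one time window for all nearby points. [J]
    serves to leave out the obstacle that is being hit. *)
Lemma local_heights (J : pred 'I_(obs_pred B).+1) z0 :
  (forall j, J j -> dotp (center j) z0.1 < Cos j) ->
  exists2 e, 0 < e & \forall z \near z0, forall s, `|s| < e ->
    forall j, J j -> dotp (center j) (geodesic s z).1 < Cos j.
Proof.
move=> h.
have : \forall p \near ((0, z0) : R * phase R), forall j, J j ->
    dotp (center j) (geodesic p.1 p.2).1 < Cos j.
  apply: (@filter_forall _ _ (fun j => [set p : R * phase R | J j ->
    dotp (center j) (geodesic p.1 p.2).1 < Cos j]) (nbhs ((0, z0) : R * phase R))) => j.
  have [Jj|nJ] := boolP (J j); last by apply: filterE.
  have hj : dotp (center j) (geodesic 0 z0).1 < Cos j by rewrite geodesic0 h.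
  have := @height_continuous2 R (center j) (0, z0) [set x | x < Cos j] (lt_nbhsl hj).
  by move=> hn; apply: (@filterS _ (nbhs ((0, z0) : R * phase R)) _ _ _ _ hn) => p hp _.
move=> [[A U] /= [A0 Uz] AU]; have /near0P[e e0 he] := A0.
exists e => //; apply: filterS Uz => z Uz s se.
by apply: (AU (s, z)); split=> //=; apply: he.
Qed.

Lemma near_geodesic a z0 (P : set (phase R)) : (\forall y \near z0, P y) ->
  \forall z \near geodesic (- a) z0, P (geodesic a z).
Proof.
move=> h; apply: (@geodesic_continuous R a (geodesic (- a) z0)).
by rewrite /= geodesicD subrr geodesic0.
Qed.

Lemma flow_geodesic t z : phase_space B z -> 0 <= t ->
  (forall s, 0 < s <= t -> table_int B (geodesic s z).1) -> phi t z = geodesic t z.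
Proof.
move=> zp; rewrite le_eqVlt => /predU1P[<- _|t0 h].
  by rewrite (flow0 phiB zp) geodesic0.
have h' s : 0 < s < t -> table_int B (geodesic s (phi 0 z)).1.
  by move=> /andP[s0 st]; rewrite (flow0 phiB zp); apply: h; rewrite s0 ltW.
have [_ + _] := trajectory_follow_end (phiB zp) t0 h'.
by rewrite add0r (flow0 phiB zp); apply; apply: h; rewrite t0 lexx.
Qed.

Lemma flow_geodesic_local z0 : phase_space B z0 -> exists2 e, 0 < e &
  forall a b, 0 <= a < e -> 0 <= b < e ->
  [/\ \forall z \near geodesic (- a) z0, phase_space B z ->
        phi (a + b) z = geodesic (a + b) z
    & forall s, - a <= s <= b -> table_int B (geodesic s z0).1].
Proof.
move=> [z0U /table_intP[_ zi]].
have [//|e e0 he] := @local_heights xpredT z0 _.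
exists e => // a b /andP[a0 ae] /andP[b0 be]; split.
  have := near_geodesic a he; apply: filterS => z hz zp.
  apply: flow_geodesic => //; first by rewrite addr_ge0.
  move=> s /andP[s0 sab]; apply/table_intP; split.
    by case: (@geodesic_unit_tangent _ s z zp.1).
  move=> j; have -> : geodesic s z = geodesic (s - a) (geodesic a z).
    by rewrite geodesicD subrK.
  by apply: hz => //; rewrite ltr_norml; apply/andP; split; lra.
move=> s /andP[sa sb]; apply/table_intP; split.
  by case: (@geodesic_unit_tangent _ s z0 z0U).
move=> j; apply: (nbhs_singleton he) => //.
by rewrite ltr_norml; apply/andP; split; lra.
Qed.

Lemma flow_collision t s z i : phase_space B z -> 0 < s < t ->
  (forall r, 0 < r < s -> table_int B (geodesic r z).1) ->
  let y := geodesic s z in on_boundary i y.1 ->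
  let y' := (y.1, bounce i y.1 y.2) in
  (forall r, 0 < r <= t - s -> table_int B (geodesic r y').1) ->
  phi t z = geodesic (t - s) y'.
Proof.
move=> zp /andP[s0 st] h1 y yb y' h2.
have h1' r : 0 < r < s -> table_int B (geodesic r (phi 0 z)).1.
  by rewrite (flow0 phiB zp); exact: h1.
have [_ _ /(_ i)] := trajectory_follow_end (phiB zp) s0 h1'.
rewrite add0r (flow0 phiB zp) => /(_ yb) ey.
have h2' r : 0 < r < t - s -> table_int B (geodesic r (phi s z)).1.
  by move=> /andP[r0 rt]; rewrite ey; apply: h2; rewrite r0 ltW.
have ts : 0 < t - s by rewrite subr_gt0.
have [_ + _] := trajectory_follow_end (phiB zp) ts h2'.
by rewrite ey (addrC s) subrK; apply; apply: h2; rewrite ts lexx.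
Qed.

Lemma one_sub_sqr_cos i : 1 - Cos i ^+ 2 = sin (obs_radius i) ^+ 2.
Proof. by rewrite -(cos2Dsin2 (obs_radius i)) addrC addKr. Qed.

Lemma obs_normalE i y : on_boundary i y.1 ->
  obs_normal i y.1 = center i - Cos i *: y.1.
Proof. by move=> /on_boundaryP[_ e]; rewrite /obs_normal e. Qed.

Lemma bounceE i y : unit_tangent_bundle y -> on_boundary i y.1 -> bounce i y.1 y.2 =
  y.2 - (2 * speed (center i) y / (1 - Cos i ^+ 2)) *: (center i - Cos i *: y.1).
Proof.
move=> [_ _ xv] yb; rewrite /bounce /= (obs_normal_sqr yb) obs_normalE //.
rewrite one_sub_sqr_cos !dotpE (dotpC y.2 y.1) xv mulr0 subr0.
by rewrite /speed (dotpC y.2).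
Qed.

Lemma speed_bounce i y : unit_tangent_bundle y -> on_boundary i y.1 ->
  speed (center i) (y.1, bounce i y.1 y.2) = - speed (center i) y.
Proof.
move=> yU yb; rewrite bounceE // /speed /= !dotpE.
have /on_boundaryP[_ e] := yb; rewrite e.
have -> : dotp (center i) (center i) = 1 := center_sphere i.
have : 1 - Cos i ^+ 2 != 0.
  by rewrite one_sub_sqr_cos expf_neq0 // lt0r_neq0 // sin_radius_gt0.
by move: (Cos i) (dotp _ _) => C D C0; field.
Qed.

Lemma collision_map_bounce i z s : unit_tangent_bundle z ->
  Cos i ^+ 2 < height (center i) z ^+ 2 + speed (center i) z ^+ 2 ->
  cos s = hit_cos (center i) (Cos i) z -> sin s = hit_sin (center i) (Cos i) z ->
  let y := geodesic s z in
  [/\ on_boundary i y.1, speed (center i) y = hit_speed (center i) (Cos i) z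
    & geodesic s (collision_map (center i) (Cos i) z) = (y.1, bounce i y.1 y.2)].
Proof.
move=> zU h cs sn y; have [yc ys] := hit_height h cs sn.
have yU : unit_tangent_bundle y by apply: geodesic_unit_tangent.
have yb : on_boundary i y.1 by apply/on_boundaryP; split=> //; case: yU.
split=> //; rewrite bounceE // [speed _ y]ys.
rewrite /collision_map geodesicDr geodesicZr -/y.
have -> : hit_normal (center i) (Cos i) z = center i - Cos i *: y.1.
  by rewrite /hit_normal -cs -sn.
rewrite -cs -sn; have sc := cos2Dsin2 s.
move: (center i - _) (hit_speed _ _ z) => m D.
have -> : geodesic s ((D * sin s) *: m, - ((D * cos s) *: m)) = (0, - (D *: m)).
  rewrite /geodesic /=; congr pair; apply/rowP => k; rewrite !mxE; first by ring.
  rewrite (_ : _ - _ = - ((cos s ^+ 2 + sin s ^+ 2) * (D * m 0 k))); last by ring.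
  by rewrite sc mul1r.
case: (y) => x v; congr pair; apply/rowP => k; rewrite !mxE; first by ring.
by rewrite [2 * D / _]mulrAC; ring.
Qed.

(** The height is [C cos s + D sin s], where [C > 0] because the radius is less than [pi / 2]. Hence
    the obstacle being hit is harmless for a whole time [pi], and only the others require a short
    window. *)
Lemma boundary_incoming i y s : on_boundary i y.1 -> 0 < speed (center i) y ->
  - pi < s < 0 -> dotp (center i) (geodesic s y).1 < Cos i.
Proof.
move=> /on_boundaryP[_ e] D0 /andP[s1 s0]; rewrite /= !dotpE e -/(speed _ y).
have C0 := cos_radius_gt0 i; have c1 := cos_le1 s.
have : 0 < sin (- s) by apply: sin_gt0_pi; apply/andP; split; lra.
by rewrite sinN; move: (sin s) (cos s) (Cos i) (speed _ y) D0 C0 c1 => *; nra.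
Qed.

Lemma boundary_outgoing i y s : on_boundary i y.1 -> speed (center i) y < 0 ->
  0 < s < pi -> dotp (center i) (geodesic s y).1 < Cos i.
Proof.
move=> /on_boundaryP[_ e] D0 s0; rewrite /= !dotpE e -/(speed _ y).
have C0 := cos_radius_gt0 i; have c1 := cos_le1 s.
have : 0 < sin s by apply: sin_gt0_pi.
by move: (sin s) (cos s) (Cos i) (speed _ y) D0 C0 c1 => *; nra.
Qed.

Lemma near_hitting_time (c : 'rV[R]_3) (C : R) z0 (d : R) : 0 < C ->
  height c z0 = C -> 0 < speed c z0 -> 0 < d -> \forall z \near z0,
    [/\ C ^+ 2 < height c z ^+ 2 + speed c z ^+ 2, 0 < hit_speed c C z &
      exists2 s, `|s| < d & cos s = hit_cos c C z /\ sin s = hit_sin c C z].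
Proof.
move=> C0 pC D0 d0.
have n1 : \forall z \near z0, C ^+ 2 < height c z ^+ 2 + speed c z ^+ 2.
  have h : C ^+ 2 < height c z0 ^+ 2 + speed c z0 ^+ 2 by rewrite pC ltrDl exprn_gt0.
  exact: (is_diff_continuous (is_diff_sumsq pC) (lt_nbhsr h)).
have n2 : \forall z \near z0, 0 < hit_speed c C z.
  have h : 0 < hit_speed c C z0 by rewrite hit_speed_base.
  exact: (is_diff_continuous (is_diff_hit_speed pC D0) (lt_nbhsr h)).
have n3 : \forall z \near z0, 0 < hit_cos c C z.
  have h : 0 < hit_cos c C z0 by rewrite hit_cos_base.
  exact: (is_diff_continuous (is_diff_hit_cos C0 pC D0) (lt_nbhsr h)).
have hs := is_diff_continuous (is_diff_hit_sin C0 pC D0).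
have hs0 := hit_sin_base pC D0.
have n4 : \forall z \near z0, `|asin (hit_sin c C z)| < d.
  have ca : {for z0, continuous (asin \o hit_sin c C)}.
    apply: continuous_comp => //; apply: continuous_asin.
    by rewrite hs0; apply/andP; split; lra.
  have asin0 : asin 0 = 0 :> R.
    have := pi_gt0 R => pi0; rewrite -[in LHS](@sin0 R) sinK // in_itv /=.
    by apply/andP; split; lra.
  apply: (ca [set x | `|x| < d]); apply/nbhs_ballP; exists d => //= x.
  by rewrite /ball /= hs0 asin0 sub0r normrN.
near=> z.
have h1 : C ^+ 2 < height c z ^+ 2 + speed c z ^+ 2 by near: z.
have c0 : 0 < hit_cos c C z by near: z.
split=> //; first by near: z.
have cs1 := hit_cos2Dsin2 h1.
have sn1 : -1 <= hit_sin c C z <= 1.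
  by move: cs1 (sqr_ge0 (hit_cos c C z)); set y := hit_sin c C z => *;
    apply/andP; split; nra.
(* The cosine being positive near [z0], the arcsine is on the right branch. *)
exists (asin (hit_sin c C z)); first by near: z.
split; last by rewrite asinK // in_itv.
rewrite cos_asin // -cs1 addrK sqrtr_sqr gtr0_norm //.
Unshelve. all: by end_near. Qed.

(** A neighbour of [geodesic (- a) z0] collides at time [a + s] with [s] depending on it. Since [K]
    carries the bounce back by [s], the composite on the right has fixed times and can be
    differentiated. *)
Lemma flow_collision_local z0 i : unit_tangent_bundle z0 -> table B z0.1 ->
  on_boundary i z0.1 -> 0 < speed (center i) z0 ->
  let K := collision_map (center i) (Cos i) in
  exists2 e, 0 < e & forall a b, 0 < a < e -> 0 < b < e ->
  [/\ \forall z \near geodesic (- a) z0, phase_space B z ->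
        phi (a + b) z = geodesic b (K (geodesic a z)),
      forall s, - a <= s < 0 -> table_int B (geodesic s z0).1
    & forall s, 0 < s <= b -> table_int B (geodesic s (K z0)).1].
Proof.
move=> z0U z0t z0b D0 K.
have C0 := cos_radius_gt0 i; have pC : height (center i) z0 = Cos i.
  by have /on_boundaryP[] := z0b.
have others j : j != i -> dotp (center j) z0.1 < Cos j.
  exact: boundary_others.
have K0 : K z0 = (z0.1, bounce i z0.1 z0.2).
  by rewrite /K collision_map_base // bounceE.
have K0U : unit_tangent_bundle (K z0) by rewrite K0; apply: bounce_unit_tangent.
have [//|e1 e10 he1] := @local_heights [pred j | j != i] z0 _.
have [|e2 e20 he2] := @local_heights [pred j | j != i] (K z0) _.
  by rewrite K0.
have cK : {for z0, continuous K}.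
  exact: is_diff_continuous (is_diff_collision_map C0 pC D0).
have pi0 := pi_gt0 R.
exists (Num.min (Num.min e1 e2) (pi / 2)).
  by rewrite !lt_min e10 e20; lra.
move=> a b /andP[a0]; rewrite !lt_min => /andP[/andP[ae1 ae2] api].
move=> /andP[b0 /andP[/andP[be1 be2] bpi]].
have off z s y : unit_tangent_bundle y -> dotp (center i) (geodesic s y).1 < Cos i ->
    (forall j, j != i -> dotp (center j) (geodesic s y).1 < Cos j) ->
    geodesic s y = z -> table_int B z.1.
  move=> yU hi hj <-; apply/table_intP; split.
    by case: (@geodesic_unit_tangent _ s y yU).
  by move=> j; have [->//|] := eqVneq j i; exact: hj.
have he1' s j : - a <= s <= b -> j != i -> dotp (center j) (geodesic s z0).1 < Cos j.
  move=> /andP[sa sb]; apply: (nbhs_singleton he1).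
  by rewrite ltr_norml; apply/andP; split; lra.
have he2' s j : - a <= s <= b -> j != i -> dotp (center j) (geodesic s (K z0)).1 < Cos j.
  move=> /andP[sa sb]; apply: (nbhs_singleton he2).
  by rewrite ltr_norml; apply/andP; split; lra.
split; first last.
- move=> s /andP[s0 sb]; apply: (off _ s (K z0)) => // [|j]; last first.
    by apply: he2'; apply/andP; split; lra.
  apply: boundary_outgoing; rewrite ?K0 // ?speed_bounce ?oppr_lt0 //.
  by apply/andP; split; lra.
- move=> s /andP[s0 sb]; apply: (off _ s z0) => // [|j]; last first.
    by apply: he1'; apply/andP; split; lra.
  by apply: boundary_incoming => //; apply/andP; split; lra.
have d0 : 0 < Num.min a b by rewrite lt_min a0.
have nK : \forall y \near z0, forall s, `|s| < e2 -> forall j, j != i ->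
    dotp (center j) (geodesic s (K y)).1 < Cos j.
  exact: (cK _ he2).
have := near_geodesic a (filterI he1 (filterI nK (near_hitting_time C0 pC D0 d0))).
move=> hn; apply: (@filterS _ (nbhs (geodesic (- a) z0)) _ _ _ _
  (hn (nbhs_filter z0) (nbhs_filter z0))) => z [/= hz1 [hz2 [hN hD [s sab [cs sn]]]]] zp.
have [hit before after] := collision_window ae1 be2 api bpi sab.
set y := geodesic a z in hz1 hz2 hN hD cs sn *.
have yU : unit_tangent_bundle y by apply: geodesic_unit_tangent; case: zp.
have [wb ws wK] := collision_map_bounce yU hN cs sn.
set w := geodesic s y in wb ws wK.
have wz : w = geodesic (a + s) z by rewrite /w /y geodesicD addrC.
have wU : unit_tangent_bundle w by apply: geodesic_unit_tangent.
have -> : geodesic b (K y) = geodesic (a + b - (a + s)) (w.1, bounce i w.1 w.2).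
  by rewrite -wK geodesicD; congr geodesic; ring.
rewrite wz; apply: flow_collision => //; rewrite -?wz //.
- move=> r /before[r1 r2]; apply: (off _ (r - (a + s)) w) => //.
  + by apply: boundary_incoming; rewrite ?ws.
  + by move=> j ji; rewrite /w geodesicD; apply: hz1.
  + by rewrite wz geodesicD subrK.
- move=> r /after[r1 r2]; apply: (off _ r (w.1, bounce i w.1 w.2)) => //.
  + exact: bounce_unit_tangent.
  + by apply: boundary_outgoing => //; rewrite speed_bounce ?oppr_lt0 ?ws.
  + by move=> j ji; rewrite -wK geodesicD; apply: hz2.
Qed.

End LocalFlow.

(** * Differentials relative to the phase space *)

Section DifferentialOnPhaseSpace.
Context {R : realType} (B : spherical_billiard R).
Implicit Types (z w : phase R) (f : phase R -> phase R) (L : 'End(phase R)).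

(** The quantitative continuity that the chain rule consumes, carried along with each
    differential. *)
Definition bounded_map L := exists2 C : R, 0 < C & forall w, `|L w| <= C * `|w|.

Lemma is_differential_local f (F : phase R -> phase R) z dF :
  (\forall z' \near z, phase_space B z' -> f z' = F z') -> phase_space B z ->
  is_diff z F dF ->
  exists L, [/\ is_differential B f z L, bounded_map L & forall w, L w = dF w].
Proof.
move=> fF zp hF; have [dFz edF] := hF.
have cont : continuous ('d F z) by apply: diff_continuous.
exists (linfun ('d F z)); split.
- move=> eps eps0; have fFz := nbhs_singleton fF zp.
  have /eqaddoP hlo := diff_locally dFz.
  have /nbhs_ballP[d /= d0 hd] := hlo eps eps0.
  have nd : \forall z' \near z, ball z d z' by apply: nbhsx_ballx.
  have := filterI fF nd => /(_ (nbhs_filter z)).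
  move=> hn; apply: (@filterS _ (nbhs z) _ _ _ _ hn) => z' [fFz' zz'] zp'.
  rewrite fFz' // fFz lfunE /=.
  have := hd (z' - z); rewrite -ball_normE /= sub0r normrN => /(_ _).
  rewrite -ball_normE /= distrC in zz' => /(_ zz').
  have -> // : (F \o shift z - (cst (F z) + 'd F z)) (z' - z) =
    F z' - F z - 'd F z (z' - z).
  by rewrite !fctE /= subrK opprD addrA.
- have [C C0 hC] := linear_lipschitz cont.
  by exists C => // w; rewrite lfunE.
- by move=> w; rewrite lfunE /= edF.
Qed.

Lemma is_differential_comp f g z L L' : phase_space B z -> phase_space B (f z) ->
  (\forall z' \near z, phase_space B z' -> phase_space B (f z')) ->
  is_differential B f z L -> bounded_map L ->
  is_differential B g (f z) L' -> bounded_map L' ->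
  is_differential B (g \o f) z (L' \o L)%VF /\ bounded_map (L' \o L)%VF.
Proof.
move=> zp fzp fp hL [C C0 hC] hL' [C' C0' hC']; split; last first.
  exists (C' * C); first by rewrite mulr_gt0.
  move=> w; rewrite comp_lfunE; apply: le_trans (hC' _) _.
  by rewrite -mulrA ler_pM2l.
move=> eps eps0.
(* The bound 1 makes [C + 1] a Lipschitz constant of [f] at [z]; the two error terms are then at
   most [C' * e1] and [e2 * (C + 1)], each at most [eps / 2]. *)
pose e1 := Num.min 1 (eps / 2 / C').
have e10 : 0 < e1 by rewrite lt_min ltr01 !divr_gt0.
pose e2 := eps / 2 / (C + 1).
have C1 : 0 < C + 1 by rewrite addr_gt0.
have e20 : 0 < e2 by rewrite !divr_gt0.
have /nbhs_ballP[d /= d0 hd] := hL' _ e20.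
have dC : 0 < d / (C + 1) by rewrite divr_gt0.
have near1 : \forall z' \near z, ball z (d / (C + 1)) z' by apply: nbhsx_ballx.
have := filterI fp (filterI (hL _ e10) near1) => /(_ (nbhs_filter z)).
move=> /(_ (nbhs_filter z)) hn.
apply: (@filterS _ (nbhs z) _ _ _ _ hn) => z' [hp [h1 zz']] zp'.
have fp' := hp zp'; have {}h1 := h1 zp'.
rewrite -ball_normE /= distrC in zz'.
have lip : `|f z' - f z| <= (C + 1) * `|z' - z|.
  rewrite -[f z' - f z](subrK (L (z' - z))); apply: le_trans (ler_normD _ _) _.
  rewrite mulrDl mul1r addrC; apply: lerD => //; apply: le_trans h1 _.
  by rewrite ler_piMl // ge_min lexx.
have : ball (f z) d (f z').
  rewrite -ball_normE /= distrC; apply: le_lt_trans lip _.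
  by rewrite mulrC -ltr_pdivlMr.
move=> /hd /(_ fp') h2.
rewrite comp_lfunE /=.
have -> : g (f z') - g (f z) - L' (L (z' - z)) =
    (g (f z') - g (f z) - L' (f z' - f z)) + L' (f z' - f z - L (z' - z)).
  by rewrite [L' (_ - L _)]linearB /= addrA subrK.
apply: le_trans (ler_normD _ _) _; rewrite (splitr eps) mulrDl; apply: lerD.
  apply: le_trans h2 _; apply: le_trans (_ : e2 * ((C + 1) * `|z' - z|) <= _).
    by rewrite ler_pM2l.
  by rewrite mulrA /e2 divfK // lt0r_neq0.
apply: le_trans (hC' _) _; apply: le_trans (_ : C' * (e1 * `|z' - z|) <= _).
  by rewrite ler_pM2l.
rewrite mulrA; apply: ler_wpM2r => //.
by rewrite mulrC -ler_pdivlMr // ge_min lexx orbT.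
Qed.

Lemma is_differential_continuous f z L : is_differential B f z L -> bounded_map L ->
  phase_space B z -> forall U, nbhs (f z) U ->
  \forall z' \near z, phase_space B z' -> U (f z').
Proof.
move=> hL [C C0 hC] zp U /nbhs_ballP[d /= d0 hU].
have C1 : 0 < C + 1 by rewrite addr_gt0.
have dC : 0 < d / (C + 1) by rewrite divr_gt0.
have near1 : \forall z' \near z, ball z (d / (C + 1)) z' by apply: nbhsx_ballx.
have := filterI (hL 1 ltr01) near1 => /(_ (nbhs_filter z)) hn.
apply: (@filterS _ (nbhs z) _ _ _ _ hn) => z' [h1 zz'] zp'; apply: hU.
have {}h1 := h1 zp'; rewrite mul1r in h1.
rewrite -ball_normE /= distrC in zz'; rewrite -ball_normE /= distrC.
have lip : `|f z' - f z| <= (C + 1) * `|z' - z|.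
  rewrite -[f z' - f z](subrK (L (z' - z))); apply: le_trans (ler_normD _ _) _.
  by rewrite mulrDl mul1r addrC; apply: lerD.
by apply: le_lt_trans lip _; rewrite mulrC -ltr_pdivlMr.
Qed.

Lemma near_table_int z : phase_space B z -> \forall z' \near z, unit_tangent_bundle z' ->
  phase_space B z'.
Proof.
move=> [zU /table_intP[_ zi]].
have [//|e e0] := @local_heights R B xpredT z _.
apply: filterS => z' hz' z'U; split=> //; apply/table_intP; split; first by case: z'U.
by move=> j; have := hz' 0 _ j isT; rewrite geodesic0; apply; rewrite normr0.
Qed.

End DifferentialOnPhaseSpace.

(** * Expansion along whole trajectories *)

(** With [C] the cosine of the radius and [D < 0] the incoming radial speed, the geodesic followed
    backwards would enter the obstacle. For [s = 2 h] the excess over [C] factors as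
    [2 sin h (- D cos h - C sin h)]. *)
Lemma inward_excursion (R : realType) (C D d : R) : 0 < C -> D < 0 -> 0 < d ->
  exists2 s, 0 < s < d & C < C * cos s - D * sin s.
Proof.
move=> C0 D0 d0.
have cont : {for 0, continuous (fun h : R => - D * cos h - C * sin h)}.
  apply: continuousB; apply: continuousM; [exact: cst_continuous |
    exact: continuous_cos | exact: cst_continuous | exact: continuous_sin].
have h0 : 0 < - D * cos 0 - C * sin 0 by rewrite cos0 sin0; lra.
have /near0P[e e0 he] := cont _ (lt_nbhsr h0).
have pi0 := pi_gt0 R.
pose h := Num.min e (Num.min d pi) / 4.
have [hp he' hd hpi] : [/\ 0 < h, h < e, 2 * h < d & h < pi].
  have m0 : 0 < Num.min e (Num.min d pi) by rewrite !lt_min e0 d0.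
  have := lexx (Num.min e (Num.min d pi)); rewrite !le_min => /and3P[m1 m2 m3].
  by rewrite /h; split; lra.
exists (2 * h); first by apply/andP; split; lra.
have sh : 0 < sin h by apply: sin_gt0_pi; rewrite hp.
have := he h; rewrite gtr0_norm // => /(_ he') hpos.
rewrite (_ : 2 * h = h + h) ?cosD ?sinD; last by ring.
have cs := cos2Dsin2 h.
rewrite -subr_gt0 (_ : _ - C = 2 * sin h * (- D * cos h - C * sin h)).
  by rewrite !mulr_gt0.
have e1 : C = C * (cos h ^+ 2 + sin h ^+ 2) by rewrite cs mulr1.
by rewrite [X in _ - X = _]e1; ring.
Qed.

Section Hyperbolicity.
Context {R : realType} {B : spherical_billiard R} {phi : R -> phase R -> phase R}.
Hypothesis phiB : billiard_flow B phi.
Context {k c : R}.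
Hypotheses (Hpi : horizon B < pi / 2) (k0 : 0 < k) (c0 : 0 < c).
Hypothesis curvature :
  forall i : 'I_(obs_pred B).+1, k * sin (obs_radius i) <= 2 * cos (obs_radius i).
Hypothesis expansion : forall t, 0 <= t <= horizon B ->
  [/\ 0 <= sin t, 0 < cos t, 0 <= k * cos t - sin t
    & expR (c * t) <= cos t + k * sin t].
Implicit Types (s t a b : R) (z w : phase R) (i : 'I_(obs_pred B).+1).

Local Notation center i := (obs_center (s := B) i).
Local Notation Cos i := (cos (obs_radius (s := B) i)).

(** The cone is read at the next collision, [a] being the time left, so a free flight preserves it
    by definition. *)
Definition in_cone a w := 0 <= dotp (geodesic a w).1 (geodesic a w).2.

(* [a] is the time to the next collision. The factor in front makes the function
   grow like [expR (2 * (c * t))] during a free flight, where the rest of it is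
   constant; a collision then does not decrease it, by [cone_expansion]. *)
Definition lyapunov a w := let w' := geodesic a w in
  expR (- (2 * (c * a))) * dotp (w'.2 + k *: w'.1) (w'.2 + k *: w'.1).

Definition expands t z L := forall a b w, perp z w ->
  next_collision B z a -> next_collision B (phi t z) b -> in_cone a w ->
  in_cone b (L w) /\ expR (2 * (c * t)) * lyapunov a w <= lyapunov b (L w).

Definition tame t z (L : 'End(phase R)) : Prop :=
  [/\ is_differential B (phi t) z L, bounded_map L,
      L (flow_vec z) = flow_vec (phi t z)
    & forall w, perp z w -> perp (phi t z) (L w)].

Definition hyperbolic_step t z : Prop := exists2 L, tame t z L & expands t z L.

Lemma expands_geodesic t z : unit_tangent_bundle z -> 0 <= t ->
  (forall s, 0 <= s <= t -> table_int B (geodesic s z).1) ->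
  phi t z = geodesic t z -> expands t z (geodesic t).
Proof.
move=> zU t0 h e a b w zw na; rewrite e => nb ca.
have ta : t < a.
  rewrite ltNge; apply/negP => at_.
  have [a0 _ [i ib]] := na; apply: (@table_int_boundary _ _ _ i) ib; apply: h.
  by rewrite at_ ltW.
have na' : next_collision B (geodesic t z) (a - t).
  by apply: next_collision_geodesic => //; rewrite t0.
have -> : b = a - t by apply: next_collision_unique nb na'.
rewrite /in_cone /lyapunov geodesicD subrK; split=> //.
rewrite mulrA -expRD.
by rewrite (_ : 2 * (c * t) - 2 * (c * a) = - (2 * (c * (a - t)))) //; ring.
Qed.

Lemma tame_diff t z (F dF : phase R -> phase R) : phase_space B z ->
  (\forall z' \near z, phase_space B z' -> phi t z' = F z') ->
  is_diff z F dF -> dF (flow_vec z) = flow_vec (F z) ->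
  (forall w, perp z w -> perp (F z) (dF w)) ->
  expands t z dF -> hyperbolic_step t z.
Proof.
move=> zp hF dFz hf hp he; have eF := nbhs_singleton hF zp.
have [L [L1 L2 eL]] := is_differential_local hF zp dFz.
exists L; first by split; rewrite ?eL ?eF // => w zw; rewrite eL; apply: hp.
by move=> a b w zw na nb ca; rewrite eL; apply: he.
Qed.

Lemma hyperbolic_step_geodesic z0 : phase_space B z0 -> exists2 e, 0 < e &
  forall a b, 0 <= a < e -> 0 <= b < e ->
  phase_space B (geodesic (- a) z0) -> hyperbolic_step (a + b) (geodesic (- a) z0).
Proof.
move=> zp; have [e e0 he] := flow_geodesic_local phiB zp; exists e => // a b ha hb zap.
have [h1 h2] := he a b ha hb; have [[a0 _] [b0 _]] := (andP ha, andP hb).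
apply: (tame_diff zap h1 (is_diff_geodesic _ _)).
- exact: flow_vec_geodesic.
- by move=> w; apply: perp_geodesic.
- apply: expands_geodesic; [by case: zap | by rewrite addr_ge0 | | ].
    by move=> s /andP[s0 sab]; rewrite geodesicD; apply: h2; apply/andP; split; lra.
  exact: (nbhs_singleton h1).
Qed.

(** * A step across one collision *)

Section Collision.
Context {z0 : phase R} {i : 'I_(obs_pred B).+1}.
Hypotheses (zU : unit_tangent_bundle z0) (zt : table B z0.1) (zb : on_boundary i z0.1).
Hypothesis D0 : 0 < speed (center i) z0.

Local Notation K := (collision_map (center i) (Cos i)).
Local Notation dK := (collision_diff (center i) (Cos i) z0).

Let pC : height (center i) z0 = Cos i.
Proof. by have /on_boundaryP[] := zb. Qed.

Let K0 : K z0 = (z0.1, bounce i z0.1 z0.2).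
Proof. by rewrite collision_map_base ?cos_radius_gt0 // bounceE. Qed.

Lemma bounce_isometry u v :
  dotp (bounce i z0.1 u) (bounce i z0.1 v) = dotp u v.
Proof.
rewrite /bounce /=; have := obs_normal_sqr zb.
move: (obs_normal i z0.1) => n hn.
have n0 : dotp n n != 0 by rewrite hn expf_neq0 // lt0r_neq0 // sin_radius_gt0.
by rewrite !dotpE (dotpC n v); field.
Qed.

Lemma bounceD x u v : bounce i x (u + v) = bounce i x u + bounce i x v.
Proof.
rewrite /bounce /= dotpDl; move: (_^-1) => a.
by apply/rowP => j; rewrite !mxE; ring.
Qed.

Lemma bounceZ x a u : bounce i x (a *: u) = a *: bounce i x u.
Proof.
rewrite /bounce /= dotpZl; move: (_^-1) => b.
by apply/rowP => j; rewrite !mxE; ring.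
Qed.

Lemma collision_diffE w : perp z0 w -> dK w = (bounce i z0.1 w.1,
  bounce i z0.1 w.2 + (2 * Cos i / speed (center i) z0) *: bounce i z0.1 w.1).
Proof.
move=> zw; rewrite (collision_diff_perp pC D0 zU (center_sphere i) zw).
by rewrite /bounce /= obs_normalE.
Qed.

Lemma perp_collision_diff w : perp z0 w -> perp (K z0) (dK w).
Proof.
move=> zw; rewrite collision_diffE // K0; have [h1 h2 h3 h4] := zw.
have bx : bounce i z0.1 z0.1 = z0.1.
  have xx : dotp z0.1 z0.1 = 1 by case: zU.
  rewrite /bounce /= obs_normalE // dotpDr dotpNr dotpZr xx.
  by rewrite (dotpC z0.1) [dotp (center i) z0.1]pC mulr1 subrr mulr0 mul0r scale0r subr0.
have e u : dotp z0.1 (bounce i z0.1 u) = dotp z0.1 u.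
  by rewrite -{1}bx bounce_isometry.
split=> /=; first by rewrite e.
- by rewrite bounce_isometry.
- by rewrite dotpDr dotpZr !e h1 h3 mulr0 addr0.
- by rewrite dotpDr dotpZr !bounce_isometry h2 h4 mulr0 addr0.
Qed.

(** The radial speed is [sin r cos theta]. Hence [kappa = 2 cos r / speed] is at least [2 cot r],
    whatever the angle. *)
Lemma speed_le_sin : speed (center i) z0 <= sin (obs_radius i).
Proof.
have [x1 v1 xv] := zU; have [n zn] := frame_exists zU.
have s0 := sin_radius_gt0 i.
suff : speed (center i) z0 ^+ 2 <= sin (obs_radius i) ^+ 2.
  by rewrite ler_pXn2r // nnegrE ltW.
rewrite -one_sub_sqr_cos -[X in X - _](center_sphere i).
rewrite {3}(frame_expand (center i) zU zn) !dotpE.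
rewrite (dotpC z0.1) (dotpC z0.2) (dotpC n) -/(speed _ z0) -/(height _ z0) pC.
move: (dotp _ n) (speed _ _) (Cos i) => g D C.
by rewrite -subr_ge0 (_ : _ - _ = g ^+ 2); [exact: sqr_ge0 | ring].
Qed.

Lemma expands_collision a b : 0 < a -> 0 < b ->
  phi (a + b) (geodesic (- a) z0) = geodesic b (K z0) ->
  (forall s, - a <= s < 0 -> table_int B (geodesic s z0).1) ->
  (forall s, 0 < s <= b -> table_int B (geodesic s (K z0)).1) ->
  expands (a + b) (geodesic (- a) z0) (fun w => geodesic b (dK (geodesic a w))).
Proof.
move=> a0 b0 e h1 h2 a' b' w zw na; rewrite e => nb.
have nca : next_collision B (geodesic (- a) z0) a.
  split=> //; last by exists i; rewrite geodesicD subrr geodesic0.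
  by move=> s /andP[s0 sa]; rewrite geodesicD; apply: h1; apply/andP; split; lra.
have -> : a' = a by apply: next_collision_unique na nca.
rewrite /in_cone /lyapunov !geodesicD.
have zw' : perp z0 (geodesic a w).
  by have := perp_geodesic a zw; rewrite geodesicD subrr geodesic0.
rewrite collision_diffE //; move: (geodesic a w) zw' => [w1 w2] zw' /= q0.
(* The whole flight between the two collisions, of which [b] belongs to the step and [b'] remains.
   The factors in [lyapunov] make the exponents agree: [2 c (a + b) - 2 c a = 2 c t - 2 c b']. *)
set t := b' + b.
have tH : t <= horizon B.
  apply: (flight_le_horizon (z := K z0) Hpi); rewrite ?K0 //.
    exact: bounce_unit_tangent.
  rewrite -K0 => s /andP[s0 st]; have [sb|bs] := leP s b; first by apply: h2; rewrite s0.
  have [_ hb _] := nb; rewrite (_ : s = s - b + b); last by ring.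
  by rewrite -geodesicD; apply: hb; rewrite /t in st; apply/andP; split; lra.
have t0 : 0 < t by have [b'0 _ _] := nb; rewrite addr_gt0.
have [st ct gt et] : [/\ 0 <= sin t, 0 < cos t, 0 <= k * cos t - sin t
    & expR (c * t) <= cos t + k * sin t] by apply: expansion; rewrite ltW.
set kappa := 2 * Cos i / speed (center i) z0.
have kk : k <= kappa.
  rewrite ler_pdivlMr //; apply: le_trans (curvature i).
  by rewrite ler_pM2l //; exact: speed_le_sin.
have q0' : 0 <= dotp (bounce i z0.1 w1) (bounce i z0.1 w2) by rewrite bounce_isometry.
have [r1 r2] := cone_expansion k0 kk (ltW (expR_gt0 (c * t))) st ct gt et q0'.
split; first exact: r1.
apply: le_trans (ler_wpM2l (expR_ge0 (- (2 * (c * b')))) r2).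
rewrite -(bounceZ _ k) -bounceD bounce_isometry !mulrA.
apply: ler_wpM2r; first exact: dotp_ge0.
by rewrite -!expRD ler_expR /t; lra.
Qed.

Lemma hyperbolic_step_collision : exists2 e, 0 < e &
  (forall s, - e < s < 0 -> table_int B (geodesic s z0).1) /\
  forall a b, 0 < a < e -> 0 < b < e -> phase_space B (geodesic (- a) z0) ->
    hyperbolic_step (a + b) (geodesic (- a) z0).
Proof.
have [e e0 he] := flow_collision_local phiB zU zt zb D0.
exists e => //; split=> [s /andP[s1 s2]|a b ha hb zap].
  have [||_ + _] := he (- s) (- s); [by apply/andP; split; lra.. |].
  by apply; rewrite opprK lexx.
have [h1 h2 h3] := he a b ha hb.
have [[a0 _] [b0 _]] := (andP ha, andP hb).
have za : geodesic a (geodesic (- a) z0) = z0 by rewrite geodesicD subrr geodesic0.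
have dF : is_diff (geodesic (- a) z0) (fun z => geodesic b (K (geodesic a z)))
    (fun w => geodesic b (dK (geodesic a w))).
  have d1 := is_diff_geodesic a (geodesic (- a) z0).
  have d2 : is_diff (geodesic a (geodesic (- a) z0)) K dK.
    by rewrite za; apply: is_diff_collision_map => //; exact: cos_radius_gt0.
  exact: (is_diff_comp (is_diff_comp d1 d2) (is_diff_geodesic b _)).
apply: (tame_diff zap h1 dF).
- rewrite flow_vec_geodesic za collision_diff_flow ?flow_vec_geodesic //.
  exact: cos_radius_gt0.
- move=> w zw; rewrite za; apply/perp_geodesic/perp_collision_diff.
  by have := perp_geodesic a zw; rewrite za.
- apply: expands_collision => //.
  by rewrite (nbhs_singleton h1 zap) za.
Qed.

End Collision.

(** The local input of real induction: [t] may be a collision instant, but the steps start and end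
    in the phase space, hence off collisions. *)
Lemma hyperbolic_step_local z t : nongrazing B phi z -> exists2 e, 0 < e &
  (forall s, t - e < s < t -> phase_space B (phi s z)) /\
  forall s1 s2, t - e < s1 <= t -> t <= s2 < t + e ->
    phase_space B (phi s1 z) -> phase_space B (phi s2 z) ->
    hyperbolic_step (s2 - s1) (phi s1 z).
Proof.
move=> ng; have zp := nongrazing_phase ng; have gz := phiB zp.
have [_ /(_ t)[tab [_ [u [/near_left0P[d d0 hd] hi hb]]]]] := gz.
set y : phase R := ((phi t z).1, u).
have yU : unit_tangent_bundle y.
  rewrite -(geodesicNK (- (d / 2)) y) -hd; last by apply/andP; split; lra.
  exact/geodesic_unit_tangent/(flow_unit_tangent phiB).
have phase_left s : t - d < s < t -> phi s z = geodesic (s - t) y.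
  move=> hs; rewrite -hd; first by rewrite addrC subrK.
  by apply/andP; split; lra.
have [int|[i ib]] := table_cases tab.
  have eu := hi int; have ey : y = phi t z by rewrite /y -eu; case: (phi t z).
  have yp : phase_space B y by split.
  have [e e0 he] := hyperbolic_step_geodesic yp.
  have [e' e'0 he'] := flow_geodesic_local phiB yp.
  exists (Num.min d (Num.min e e')); first by rewrite !lt_min d0 e0.
  split=> [s /andP[]|s1 s2 /andP[] + s1t /andP[ts2]].
    rewrite ltrBlDl -ltrBlDr !lt_min => /andP[sd /andP[se se']] st.
    apply/(flow_phase phiB s zp); rewrite phase_left; last by apply/andP; split; lra.
    have [||_] := he' (t - s) 0; [by apply/andP; split; lra | by rewrite lexx |].
    by apply; apply/andP; split; lra.
  rewrite ltrBlDl -ltrBlDr -ltrBlDl !lt_min => /andP[sd /andP[se _]].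
  move=> /andP[_ /andP[se2 _]] p1 p2.
  have e1 : phi s1 z = geodesic (- (t - s1)) y.
    move: s1t; rewrite le_eqVlt => /predU1P[->|s1t].
      by rewrite subrr oppr0 geodesic0 ey.
    by rewrite phase_left ?opprB //; apply/andP; split; lra.
  rewrite e1 in p1 *; rewrite (_ : s2 - s1 = t - s1 + (s2 - t)); last by ring.
  by apply: he => //; apply/andP; split; lra.
have yb : on_boundary i y.1 by [].
have evt := hb i ib.
have ey' : phi t z = (y.1, bounce i y.1 y.2) by rewrite /= -evt; case: (phi t z).
(* The incoming speed is nonzero since the orbit does not graze, and not negative, since
   [inward_excursion] would put the orbit inside the obstacle just before [t]. *)
have D0 : 0 < speed (center i) y.
  have /on_boundaryP[_ yc] := yb.
  have n0 : speed (center i) y != 0.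
    have := ng.2 t i ib; rewrite /obs_normal dotpDr dotpNr dotpZr.
    have -> : dotp (phi t z).2 (phi t z).1 = 0.
      by rewrite dotpC; have [] := flow_unit_tangent phiB t zp.
    rewrite mulr0 subr0 dotpC -/(speed (center i) (phi t z)) ey' speed_bounce //.
    by rewrite oppr_eq0.
  rewrite lt_def n0 leNgt; apply/negP => D0.
  have pole s : 0 < s < d -> Cos i * cos s - speed (center i) y * sin s <= Cos i.
    move=> /andP[s0 sd]; have := trajectory_table (t - s) gz.
    rewrite phase_left; last by apply/andP; split; lra.
    move=> /tableP[_ /(_ i)]; rewrite /= !dotpE -/(speed (center i) y) yc.
    by rewrite (_ : t - s - t = - s) ?cosN ?sinN; [lra | ring].
  have [s sd] := inward_excursion (cos_radius_gt0 i) D0 d0.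
  by rewrite ltNge pole.
have [e e0 [hint he]] := hyperbolic_step_collision yU tab yb D0.
exists (Num.min d e); first by rewrite lt_min d0.
have minE s : t - Num.min d e < s -> t - d < s /\ t - e < s.
  by rewrite ltrBlDl -ltrBlDr lt_min => /andP[]; split; lra.
have noncol s : phase_space B (phi s z) -> s != t.
  move=> [_ int]; apply/eqP => st; apply: (@table_int_boundary _ _ _ i int).
  by rewrite st.
split=> [s /andP[/minE[sd se] st]|s1 s2 /andP[/minE[sd se] s1t] /andP[ts2 s2e] p1 p2].
  apply/(flow_phase phiB s zp); rewrite phase_left; last by apply/andP; split; lra.
  by apply: hint; apply/andP; split; lra.
have lt1 : s1 < t by rewrite lt_neqAle noncol.
have lt2 : t < s2 by rewrite lt_neqAle eq_sym noncol.
have e1 : phi s1 z = geodesic (- (t - s1)) y.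
  by rewrite phase_left ?opprB //; apply/andP; split; lra.
rewrite e1 in p1 *; rewrite (_ : s2 - s1 = t - s1 + (s2 - t)); last by ring.
have s2e' : s2 - t < e by move: s2e; rewrite -ltrBlDl lt_min => /andP[].
by apply: he => //; apply/andP; split; lra.
Qed.

Lemma hyperbolic_step0 z : nongrazing B phi z -> hyperbolic_step 0 z.
Proof.
move=> ng; have zp := nongrazing_phase ng.
have [e e0 [_ he]] := hyperbolic_step_local 0 ng.
have := he 0 0; rewrite subrr (flow0 phiB zp); apply; rewrite ?lexx //.
  by rewrite sub0r oppr_lt0 e0.
by rewrite add0r.
Qed.

Lemma next_collision_phase z : phase_space B z ->
  exists2 a, next_collision B z a & a <= horizon B.
Proof.
move=> [zU zi]; have zi' : table_int B (geodesic 0 z).1 by rewrite geodesic0.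
have [e e0 he] := table_int_open zU zi'.
apply: (next_collision_exists Hpi zU (table_int_table zi) e0) => s /andP[s0 se].
have es : `|s| < e by rewrite (gtr0_norm s0).
by have := he s es; rewrite (add0r s).
Qed.

Lemma tame_comp s t z L L' : phase_space B z -> phase_space B (phi t z) ->
  tame t z L -> tame s (phi t z) L' -> tame (t + s) z (L' \o L)%VF.
Proof.
move=> zp tp [L1 L2 L3 L4] [M1 M2 M3 M4].
(* The identity [phi (t + s) = phi s \o phi t] is available only at points sent into the phase space
   at time [t]; by continuity all neighbours are. *)
have near_phase : \forall z' \near z, phase_space B z' -> phase_space B (phi t z').
  have hn := is_differential_continuous L1 L2 zp (near_table_int tp).
  apply: (@filterS _ (nbhs z) _ _ _ _ hn) => z' hz' zp'.
  exact/(hz' zp')/(flow_unit_tangent phiB).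
have [N1 N2] := is_differential_comp zp tp near_phase L1 L2 M1 M2.
split; [|exact: N2| |].
- move=> eps eps0; have := filterI near_phase (N1 eps eps0) => /(_ (nbhs_filter z)) hn.
  apply: (@filterS _ (nbhs z) _ _ _ _ hn) => z' [hp h1] zp'.
  by rewrite (flowD phiB s zp' (hp zp')) (flowD phiB s zp tp); exact: h1.
- by rewrite comp_lfunE L3 M3 (flowD phiB).
- by move=> w zw; rewrite comp_lfunE (flowD phiB) //; apply/M4/L4.
Qed.

Lemma hyperbolic_step_comp s t z : phase_space B z -> phase_space B (phi t z) ->
  hyperbolic_step t z -> hyperbolic_step s (phi t z) -> hyperbolic_step (t + s) z.
Proof.
move=> zp tp [L hL eL] [L' hL' eL'].
exists (L' \o L)%VF; first exact: tame_comp.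
move=> a b w zw na nb ca; have [d nd _] := next_collision_phase tp.
have [ca' le1] := eL a d w zw na nd ca.
rewrite (flowD phiB) // in nb.
have [_ _ _ hp] := hL.
have [cb le2] := eL' d b (L w) (hp w zw) nd nb ca'.
rewrite comp_lfunE; split=> //; apply: le_trans le2.
have -> : expR (2 * (c * (t + s))) = expR (2 * (c * s)) * expR (2 * (c * t)).
  by rewrite -expRD; congr expR; ring.
by rewrite -mulrA ler_pM2l ?expR_gt0.
Qed.

Lemma hyperbolic_step_pos z t : nongrazing B phi z -> 0 <= t ->
  phase_space B (phi t z) -> hyperbolic_step t z.
Proof.
move=> ng; have zp := nongrazing_phase ng; move: t; apply: real_ind.
- by move=> _; apply: hyperbolic_step0.
- move=> t t0 ih; have [e e0 [hp he]] := hyperbolic_step_local t ng.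
  exists e => // s /andP[ts se] sp.
  (* [t] itself may be a collision, so the new step starts at an earlier [r] off collisions and
     crosses [t]. *)
  have [r [rt rp re]] : exists r, [/\ 0 <= r <= t, phase_space B (phi r z) & t - e < r].
    have [t1|t1] := leP t 0.
      by exists 0; rewrite (flow0 phiB zp); split=> //; rewrite ?lexx //; lra.
    have m0 : 0 < Num.min e t by rewrite lt_min e0.
    have := lexx (Num.min e t); rewrite !le_min => /andP[m1 m2].
    exists (t - Num.min e t / 2); split; [by apply/andP; split; lra | | by lra].
    by apply: hp; apply/andP; split; lra.
  rewrite -(subrK r s) addrC; apply: hyperbolic_step_comp => //; first exact: ih.
  by apply: he => //; case/andP: rt => *; apply/andP; split; lra.
- move=> t t0 ih tp; have [e e0 [hp he]] := hyperbolic_step_local t ng.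
  have m0 : 0 < Num.min e t by rewrite lt_min e0.
  have := lexx (Num.min e t); rewrite !le_min => /andP[m1 m2].
  set r := t - Num.min e t / 2.
  have rt : 0 <= r < t by apply/andP; rewrite /r; split; lra.
  have rp : phase_space B (phi r z) by apply: hp; apply/andP; rewrite /r; split; lra.
  rewrite -(subrK r t) addrC; apply: hyperbolic_step_comp => //; first exact: ih.
  by apply: he => //; apply/andP; rewrite /r; split; lra.
Qed.

End Hyperbolicity.

(** * Stable and unstable directions *)

Lemma norm_reverse (R : realType) (w : phase R) : `|reverse w| = `|w|.
Proof. by rewrite [LHS]prod_normE [RHS]prod_normE /= normrN. Qed.

Lemma norm2_add_le (R : realType) (w w' : phase R) :
  norm2 (w + w') <= 2 * (norm2 w + norm2 w').
Proof.
have := addr_ge0 (dotp_ge0 (w.1 - w'.1)) (dotp_ge0 (w.2 - w'.2)).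
rewrite /norm2 !phaseE !dotpE (dotpC w'.1) (dotpC w'.2); lra.
Qed.

(** * Uniqueness of the differential on orthogonal data *)

Section DifferentialUnique.
Context {R : realType} (B : spherical_billiard R).
Implicit Types (z w : phase R) (f : phase R -> phase R) (L : 'End(phase R)).

(* [2 sin h q] is exactly the difference between the points of parameters [h] and
   [- h] of the curve, so that the quadratic error of a chord never appears. *)
Lemma is_differential_unique_curve f z L L' (p q : phase R) :
  phase_space B z -> is_differential B f z L -> is_differential B f z L' ->
  (forall h, unit_tangent_bundle (z + ((cos h - 1) *: p + sin h *: q))) ->
  L q = L' q.
Proof.
move=> zp hL hL' curve; apply/eqP; rewrite -subr_eq0 -normr_eq0; apply/negPn/negP => n0.
have {n0}N0 : 0 < `|L q - L' q| by rewrite lt_def n0 normr_ge0.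
pose C := `|p| + `|q| + 1.
have C0 : 0 < C by rewrite ltr_wpDl // addr_ge0.
(* [C] bounds the displacements by [C sin h]. Two maps at two points make four errors, in total
   [4 eps C sin h], that is [sin h] times the norm of [L q - L' q], half of what the chord gives. *)
pose eps := `|L q - L' q| / (4 * C).
have eps0 : 0 < eps by rewrite divr_gt0 // mulr_gt0.
have := filterI (near_table_int zp) (filterI (hL _ eps0) (hL' _ eps0)).
move=> /(_ (nbhs_filter z) (nbhs_filter z)) /nbhs_ballP[d /= d0 hd].
have dC : 0 < d / C by rewrite divr_gt0.
have cs : {for (0 : R), continuous (fun h : R => `|sin h|)}.
  apply: continuous_comp; [exact: continuous_sin | exact: norm_continuous].
have s0 : `|sin 0| < d / C :> R by rewrite sin0 normr0.
have /near0P[e e0 he] := cs _ (lt_nbhsl s0).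
have pi0 := pi_gt0 R.
have [h [h0 h1 h2]] : exists h, [/\ 0 < h, h < e & h < pi / 2].
  have m0 : 0 < Num.min e (pi / 2) by rewrite lt_min e0 divr_gt0.
  have := midf_lt m0; rewrite add0r lt_min => -[? /andP[? ?]].
  by exists (Num.min e (pi / 2) / 2).
have sh : 0 < sin h by apply: sin_gt0_pihalf; rewrite h0.
have ch : 0 < cos h by apply: cos_gt0_pihalf; apply/andP; split; lra.
have sd : sin h < d / C by have := he h; rewrite /= !gtr0_norm // => /(_ h1).
have c1 : `|cos h - 1| <= sin h.
  have := cos_le1 h; have := cos2Dsin2 h => cs2 ch1.
  by rewrite ler0_norm; [nra | lra].
pose u r : phase R := (cos r - 1) *: p + sin r *: q.
have un r : `|cos r - 1| <= sin h -> `|sin r| = sin h -> `|u r| <= sin h * C.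
  move=> cr sr; apply: le_trans (ler_normD _ _) _; rewrite !normrZ sr.
  rewrite /C -addrA mulrDr; apply: lerD; first by apply: ler_wpM2r.
  by rewrite ler_pM2l // lerDl.
have est r : `|cos r - 1| <= sin h -> `|sin r| = sin h ->
    `|L (u r) - L' (u r)| <= 2 * eps * (sin h * C).
  move=> cr sr; have ur := un r cr sr.
  have : ball z d (z + u r).
    rewrite -ball_normE /= opprD addNKr normrN; apply: le_lt_trans ur _.
    by rewrite -ltr_pdivlMr.
  move=> /hd[/(_ (curve r)) zr [/(_ zr) hl /(_ zr) hl']].
  rewrite (addrC z) addrK in hl hl'.
  have -> : L (u r) - L' (u r) =
      (f (u r + z) - f z - L' (u r)) - (f (u r + z) - f z - L (u r)).
    by rewrite opprB [RHS]addrC subrKA.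
  apply: le_trans (ler_normB _ _) _.
  have le1 : eps * `|u r| <= eps * (sin h * C) by rewrite ler_pM2l.
  rewrite -[2 * eps * _]mulrA mulr_natl mulr2n.
  by apply: lerD; [exact: le_trans hl' le1 | exact: le_trans hl le1].
have e2 : (2 * sin h) *: q = u h - u (- h).
  rewrite /u cosN sinN opprD addrACA subrr add0r scaleNr opprK.
  by rewrite mulr_natl mulr2n scalerDl.
have := lerD (est h c1 (gtr0_norm sh)) (est (- h) _ _).
rewrite cosN sinN normrN => /(_ c1 (gtr0_norm sh)) le4.
have : `|(2 * sin h) *: (L q - L' q)| <= 4 * eps * (sin h * C).
  have -> : (2 * sin h) *: (L q - L' q) =
      (L (u h) - L' (u h)) - (L (u (- h)) - L' (u (- h))).
    rewrite scalerBr -!linearZ_LR e2 (linearB L) (linearB L') !opprD !opprK !addrA.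
    by congr (_ + _); exact: addrAC.
  apply: le_trans (ler_normB _ _) _; apply: le_trans le4 _; lra.
rewrite normrZ gtr0_norm ?mulr_gt0 // /eps.
have -> : 4 * (`|L q - L' q| / (4 * C)) * (sin h * C) = `|L q - L' q| * sin h.
  by field; exact: lt0r_neq0.
move: (`|L q - L' q|) (sin h) N0 sh => N s N0 s0'; nra.
Qed.

Lemma is_differential_unique f z L L' w : phase_space B z ->
  is_differential B f z L -> is_differential B f z L' -> perp z w -> L w = L' w.
Proof.
move=> zp hL hL' zw; have [zU _] := zp; have [n zn] := frame_exists zU.
have [x1 v1 xv] := zU; have [n1 xn vn] := zn; rewrite /sphere2 /= in x1.
(* The curve turns the position in the plane of [z.1] and [n] with the velocity fixed; the next one
   turns the velocity. Both stay in the unit tangent bundle. *)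
have d1 : L (n, 0) = L' (n, 0).
  apply: (is_differential_unique_curve (p := (z.1, 0)) zp hL hL') => h.
  have -> : z + ((cos h - 1) *: (z.1, 0) + sin h *: (n, 0)) =
      (cos h *: z.1 + sin h *: n, z.2).
    by case: (z) => x v; congr pair; apply/rowP => j; rewrite !mxE; ring.
  have cs := cos2Dsin2 h.
  split; rewrite /sphere2 /= ?dotpE ?(dotpC n) ?x1 ?xn ?n1 ?v1 ?xv ?vn //; last by ring.
  by move: cs; rewrite !expr2; lra.
have d2 : L (0, n) = L' (0, n).
  apply: (is_differential_unique_curve (p := (0, z.2)) zp hL hL') => h.
  have -> : z + ((cos h - 1) *: (0, z.2) + sin h *: (0, n)) =
      (z.1, cos h *: z.2 + sin h *: n).
    by case: (z) => x v; congr pair; apply/rowP => j; rewrite !mxE; ring.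
  have cs := cos2Dsin2 h.
  split; rewrite /sphere2 /= ?dotpE ?(dotpC n) ?x1 ?xn ?n1 ?v1 ?xv ?vn //; last by ring.
  by move: cs; rewrite !expr2; lra.
rewrite (perp_frame zU zn zw); set a := dotp n w.1; set b := dotp n w.2.
have -> : (a *: n, b *: n) = a *: (n, 0) + b *: (0, n).
  by congr pair; apply/rowP => j; rewrite !mxE; ring.
by rewrite !linearD !linearZ_LR; congr (_ *: _ + _ *: _).
Qed.

End DifferentialUnique.

Section Splitting.
Context {R : realType} {B : spherical_billiard R} {phi : R -> phase R -> phase R}.
Hypothesis phiB : billiard_flow B phi.
Context {k c : R}.
Hypotheses (Hpi : horizon B < pi / 2) (k0 : 0 < k) (c0 : 0 < c).
Hypothesis curvature :
  forall i : 'I_(obs_pred B).+1, k * sin (obs_radius i) <= 2 * cos (obs_radius i).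
Hypothesis expansion : forall t, 0 <= t <= horizon B ->
  [/\ 0 <= sin t, 0 < cos t, 0 <= k * cos t - sin t
    & expR (c * t) <= cos t + k * sin t].
Implicit Types (s t a b : R) (z w : phase R).

Local Notation ng := (nongrazing B phi).
Local Notation ps := (phase_space B).
Local Notation tm := (@tame R B phi).

Lemma reverse_lfunE w : linfun (@reverse R) w = reverse w.
Proof. by rewrite lfunE. Qed.

Lemma tame_opp t z L : ps z -> ps (phi (- t) z) -> tm t (reverse z) L ->
  tm (- t) z (linfun (@reverse R) \o L \o linfun (@reverse R))%VF.
Proof.
move=> zp tp [L1 [C C0 L2] L3 L4].
have rp := phase_reverse zp.
have [_ /(_ tp.2) erev _] := flow_reverse phiB t zp.
have back z' : ps z' -> ps (phi t (reverse z')) ->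
    phi (- t) z' = reverse (phi t (reverse z')).
  move=> zp' tp'; have [e1 e2 _] := flow_reverse phiB t zp'.
  by rewrite e2 ?reverseK //; rewrite -e1; case: tp'.
have rtp : ps (phi t (reverse z)) by rewrite erev; apply: phase_reverse.
split.
- move=> eps eps0.
  have hint := is_differential_continuous L1 (ex_intro2 _ _ C C0 L2) rp (near_table_int rtp).
  have := filterI hint (L1 eps eps0) => /(_ (nbhs_filter (reverse z))) hn.
  have := @rev_continuous R z _ hn.
  move=> {}hn; apply: (@filterS _ (nbhs z) _ _ _ _ hn) => z' /= [h1 h2] zp'.
  have rp' := phase_reverse zp'.
  have tp' : ps (phi t (reverse z')).
    exact: h1 rp' (flow_unit_tangent phiB _ rp').
  rewrite back // [phi (- t) z]back // !comp_lfunE !reverse_lfunE.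
  by have := h2 rp'; rewrite -!reverseB !norm_reverse -(norm_reverse (z' - z)) reverseB.
- exists C => [//|w]; rewrite !comp_lfunE !reverse_lfunE norm_reverse.
  by rewrite -(norm_reverse w); exact: L2.
- rewrite !comp_lfunE !reverse_lfunE.
  have frev y : reverse (flow_vec y) = - flow_vec (reverse y) :> phase R.
    by case: y => x v; rewrite /reverse /flow_vec /= opprK; congr pair; rewrite opprK.
  have LN : L (- flow_vec (reverse z)) = - flow_vec (phi t (reverse z)).
    by rewrite -L3; exact: linearN.
  by rewrite frev LN reverseN frev opprK erev reverseK.
- move=> w zw; rewrite !comp_lfunE !reverse_lfunE.
  have := L4 _ (perp_rev zw); rewrite erev => /perp_rev.
  by rewrite reverseK.
Qed.

Lemma tame_exists t z : ng z -> ps (phi t z) -> exists L, tm t z L.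
Proof.
move=> zn tp; have zp := nongrazing_phase zn; have [t0|t0] := leP 0 t.
  by have [L hL _] := hyperbolic_step_pos phiB Hpi k0 curvature expansion zn t0 tp; exists L.
have rp : ps (phi (- t) (reverse z)).
  by rewrite (flow_opp phiB) //; apply: phase_reverse.
have t0' : 0 <= - t by lra.
have [L hL _] := hyperbolic_step_pos phiB Hpi k0 curvature expansion
  (nongrazing_reverse phiB zn) t0' rp.
have := tame_opp (t := - t) zp; rewrite opprK => /(_ _ tp hL) ?.
by eexists; eassumption.
Qed.

(* Only the values on [perp z] and [flow_vec z] are meaningful; this is 0 when
   there is no differential. *)
Definition flow_diff t z : 'End(phase R) := xget 0 [set L | tm t z L].

Lemma flow_diff_tame t z : ng z -> ps (phi t z) -> tm t z (flow_diff t z).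
Proof.
move=> zn tp; have [L hL] := tame_exists zn tp.
by apply: (@xgetPex _ _ [set L | tm t z L]); exists L.
Qed.

Lemma flow_diff_unique t z L w : ps z -> tm t z L -> perp z w -> flow_diff t z w = L w.
Proof.
move=> zp hL zw; have [h _ _ _] : tm t z (flow_diff t z).
  by apply: (@xgetPex _ _ [set L | tm t z L]); exists L.
by have [h' _ _ _] := hL; apply: is_differential_unique h h' zw.
Qed.

Lemma perp_flow_diff t z w : ng z -> ps (phi t z) -> perp z w ->
  perp (phi t z) (flow_diff t z w).
Proof. by move=> zn tp; have [_ _ _] := flow_diff_tame zn tp; apply. Qed.

Lemma flow_diffD s t z w : ng z -> ps (phi t z) -> ps (phi (t + s) z) -> perp z w ->
  flow_diff (t + s) z w = flow_diff s (phi t z) (flow_diff t z w).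
Proof.
move=> zn tp tsp zw; have zp := nongrazing_phase zn.
have hL := flow_diff_tame zn tp.
have hM : tm s (phi t z) (flow_diff s (phi t z)).
  by apply: flow_diff_tame; [exact: nongrazing_flow | rewrite -(flowD phiB)].
by rewrite (flow_diff_unique zp (tame_comp phiB zp tp hL hM) zw) comp_lfunE.
Qed.

Lemma flow_diff0 z w : ng z -> perp z w -> flow_diff 0 z w = w.
Proof.
move=> zn zw; have zp := nongrazing_phase zn.
rewrite (@flow_diff_unique 0 z \1%VF) ?id_lfunE //; split.
- move=> eps eps0; apply: (@filterE _ (nbhs z)) => z' zp'.
  by rewrite !(flow0 phiB) // id_lfunE subrr normr0 mulr_ge0 // ltW.
- by exists 1 => // u; rewrite id_lfunE mul1r.
- by rewrite id_lfunE (flow0 phiB).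
- by move=> u; rewrite id_lfunE (flow0 phiB).
Qed.

Lemma flow_phase_opp t z : ps z -> ps (phi t z) -> ps (phi (- t) (reverse z)).
Proof. by move=> zp tp; rewrite (flow_opp phiB) //; apply: phase_reverse. Qed.

Lemma flow_diff_opp t z w : ng z -> ps (phi t z) -> perp z w ->
  flow_diff (- t) (reverse z) (reverse w) = reverse (flow_diff t z w).
Proof.
move=> zn tp zw; have zp := nongrazing_phase zn; have rp := phase_reverse zp.
have hL := flow_diff_tame (nongrazing_reverse phiB zn) (flow_phase_opp zp tp).
have := tame_opp (t := - t) zp; rewrite opprK => /(_ _ tp hL) hM.
by rewrite (flow_diff_unique zp hM zw) !comp_lfunE !reverse_lfunE reverseK.
Qed.

Lemma flow_diffK t z w : ng z -> ps (phi t z) -> perp z w ->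
  flow_diff (- t) (phi t z) (flow_diff t z w) = w.
Proof.
move=> zn tp zw; have zp := nongrazing_phase zn.
have t0 : ps (phi (t + - t) z) by rewrite addrN (flow0 phiB zp).
by rewrite -(flow_diffD zn tp t0 zw) addrN flow_diff0.
Qed.

(** Ratio of the constants in [lyapunov_le_norm2] and [norm2_le_lyapunov]. *)
Definition distortion := (1 + k ^+ 2) * expR (2 * (c * horizon B)) / Num.min 1 (k ^+ 2).

Lemma min1k_gt0 : 0 < Num.min 1 (k ^+ 2).
Proof. by rewrite lt_min ltr01 exprn_gt0. Qed.

Lemma distortion_gt0 : 0 < distortion.
Proof.
by rewrite divr_gt0 ?min1k_gt0 // mulr_gt0 ?expR_gt0 // ltr_wpDr // sqr_ge0.
Qed.

(** The cone enters through the cross term [2 k <J, J'> >= 0]; the opposite bound holds for every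
    vector. *)
Lemma norm2_le_lyapunov a w : a <= horizon B -> in_cone a w ->
  expR (- (2 * (c * horizon B))) * Num.min 1 (k ^+ 2) * norm2 w <= @lyapunov R k c a w.
Proof.
move=> aH; rewrite /in_cone /lyapunov -(norm2_geodesic a w) /norm2.
move: (geodesic a w) => [w1 w2] /= q0.
rewrite -mulrA; apply: ler_pM; first exact: expR_ge0.
- by rewrite mulr_ge0 ?addr_ge0 ?dotp_ge0 // ltW // min1k_gt0.
- by rewrite ler_expR lerN2 !ler_pM2l.
rewrite !dotpE (dotpC w2 w1); have p0 := dotp_ge0 w1; have r0 := dotp_ge0 w2.
move: (dotp w1 w1) (dotp w1 w2) (dotp w2 w2) p0 q0 r0 => p q r p0 q0 r0.
have m1 : Num.min 1 (k ^+ 2) <= 1 by rewrite ge_min lexx.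
have m2 : Num.min 1 (k ^+ 2) <= k ^+ 2 by rewrite ge_min lexx orbT.
have : Num.min 1 (k ^+ 2) * p <= k ^+ 2 * p by apply: ler_wpM2r.
have : Num.min 1 (k ^+ 2) * r <= 1 * r by apply: ler_wpM2r.
have : 0 <= k * q by rewrite mulr_ge0 // ltW.
by rewrite expr2; lra.
Qed.

Lemma lyapunov_le_norm2 a w : 0 <= a ->
  @lyapunov R k c a w <= (1 + k ^+ 2) * norm2 w.
Proof.
move=> a0; rewrite /lyapunov -(norm2_geodesic a w) /norm2.
move: (geodesic a w) => [w1 w2] /=; rewrite -[leRHS]mul1r.
apply: ler_pM; [exact: expR_ge0 | exact: dotp_ge0 | |].
  by rewrite -expR0 ler_expR oppr_le0 !mulr_ge0 // ltW.
(* This square is exactly the defect in the Cauchy-Schwarz bound of the norm of [J' + k J]. *)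
have := dotp_ge0 (w1 - k *: w2); rewrite !dotpE (dotpC w2 w1).
by rewrite expr2; lra.
Qed.

Lemma cone_growth t z a w : ng z -> 0 <= t -> ps (phi t z) -> perp z w ->
  next_collision B z a -> in_cone a w ->
  norm2 w * expR (2 * (c * t)) <= distortion * norm2 (flow_diff t z w) /\
  forall b, next_collision B (phi t z) b -> in_cone b (flow_diff t z w).
Proof.
move=> zn t0 tp zw na ca; have zp := nongrazing_phase zn.
have [L hL eL] := hyperbolic_step_pos phiB Hpi k0 curvature expansion zn t0 tp.
rewrite (flow_diff_unique zp hL zw); split; last first.
  by move=> b nb; have [] := eL a b w zw na nb ca.
have [b nb _] := next_collision_phase Hpi tp.
have [cb le1] := eL a b w zw na nb ca.
have aH : a <= horizon B.
  have [a' na' a'H] := next_collision_phase Hpi zp.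
  by rewrite (next_collision_unique na na').
have b0 : 0 <= b by have [/ltW] := nb.
have le2 := le_trans le1 (lyapunov_le_norm2 (L w) b0).
have le3 := norm2_le_lyapunov aH ca.
have E0 := expR_gt0 (2 * (c * t)).
rewrite /distortion [leRHS]mulrAC ler_pdivlMr ?min1k_gt0 //.
have eH : expR (2 * (c * horizon B)) * expR (- (2 * (c * horizon B))) = 1.
  by rewrite -expRD subrr expR0.
have H0 := expR_gt0 (2 * (c * horizon B)).
rewrite [X in _ <= X](_ : _ = expR (2 * (c * horizon B)) * ((1 + k ^+ 2) * norm2 (L w)));
  last by ring.
apply: le_trans (ler_wpM2l (ltW H0) le2).
apply: le_trans (ler_wpM2l (ltW H0) (ler_wpM2l (ltW E0) le3)).
rewrite le_eqVlt (_ : expR (2 * (c * horizon B)) * _ =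
  (expR (2 * (c * horizon B)) * expR (- (2 * (c * horizon B)))) *
  (expR (2 * (c * t)) * (Num.min 1 (k ^+ 2) * norm2 w))); last by ring.
by rewrite eH mul1r (_ : _ == _) //; apply/eqP; ring.
Qed.

(** The differential is taken at instants off collisions; as collisions are isolated, there are such
    instants arbitrarily late. *)
Lemma admissible_time z T : ng z -> exists2 t, T <= t & ps (phi t z).
Proof.
move=> zn; have [e e0 [hp _]] :=
  hyperbolic_step_local phiB Hpi k0 curvature expansion (T + 1) zn.
have m0 : 0 < Num.min e 1 by rewrite lt_min e0 ltr01.
have := lexx (Num.min e 1); rewrite !le_min => /andP[m1 m2].
exists (T + 1 - Num.min e 1 / 2); first by lra.
by apply: hp; apply/andP; split; lra.
Qed.

Lemma expR_unbounded (M d : R) : 0 < d -> exists T, 0 <= T /\ forall t, T <= t -> M < expR (d * t).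
Proof.
move=> d0; exists (`|M| / d); split; first by rewrite divr_ge0 // ltW.
move=> t; rewrite ler_pdivrMr // mulrC => Mt.
apply: lt_le_trans (expR_ge1Dx _); apply: le_lt_trans (ler_norm M) _; lra.
Qed.

Definition contracted z w := forall s, 0 <= s -> ps (phi s z) ->
  norm2 (flow_diff s z w) * expR (2 * (c * s)) <= distortion * norm2 w.

(** Unlike [contracted], whose constant is fixed, this is preserved by sums, which makes the linear
    argument of [bounded_collinear] possible. *)
Definition forward_bounded z w := exists M, forall s, 0 <= s -> ps (phi s z) ->
  norm2 (flow_diff s z w) <= M.

Lemma contracted_bounded z w : contracted z w -> forward_bounded z w.
Proof.
move=> h; exists (distortion * norm2 w) => s s0 sp; apply: le_trans (h s s0 sp).
have : 1 <= expR (2 * (c * s)) by rewrite -expR0 ler_expR !mulr_ge0 // ltW.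
by have := norm2_ge0 (flow_diff s z w); move: (norm2 _) (expR _) => x y *; nra.
Qed.

Lemma forward_boundedZ z a w : forward_bounded z w -> forward_bounded z (a *: w).
Proof.
move=> [M h]; exists (a ^+ 2 * M) => s s0 sp; rewrite linearZ /= norm2Z.
by apply: ler_wpM2l (h s s0 sp); exact: sqr_ge0.
Qed.

Lemma forward_boundedD z w w' : forward_bounded z w -> forward_bounded z w' ->
  forward_bounded z (w + w').
Proof.
move=> [M h] [M' h']; exists (2 * (M + M')) => s s0 sp; rewrite linearD.
apply: le_trans (norm2_add_le _ _) _.
by rewrite ler_pM2l // lerD // ?h ?h'.
Qed.

Lemma cone_vector z : ng z -> exists a e,
  [/\ next_collision B z a, perp z e, in_cone a e & norm2 e = 1].
Proof.
move=> zn; have zp := nongrazing_phase zn; have [a na _] := next_collision_phase Hpi zp.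
have gU := geodesic_unit_tangent a zp.1.
have [n gn] := frame_exists gU.
(* The field with J = [n] and J' = 0 at the next collision, on the edge of the cone. *)
exists a, (geodesic (- a) (1 *: n, 0 *: n)); split=> //.
- by rewrite -[z](geodesicNK a); apply: perp_geodesic; apply: frame_perp.
- by rewrite /in_cone geodesicD subrr geodesic0 /= dotpZr mul0r.
- by rewrite norm2_geodesic (norm2_frame _ _ gn) expr1n expr0n addr0.
Qed.

Lemma cone_unbounded z a e : ng z -> next_collision B z a -> perp z e ->
  in_cone a e -> norm2 e = 1 -> ~ forward_bounded z e.
Proof.
move=> zn na ze ce e1 [M h].
have c2 : 0 < 2 * c by rewrite mulr_gt0.
have [T [T0 hT]] := expR_unbounded (distortion * M) c2.
have [t Tt tp] := admissible_time T zn.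
have t0 : 0 <= t by lra.
have [+ _] := cone_growth zn t0 tp ze na ce.
rewrite e1 mul1r mulrA leNgt => /negP; apply.
apply: le_lt_trans (hT t Tt); rewrite ler_pM2l ?distortion_gt0 //; exact: h.
Qed.

Lemma perp_independent z w w' : unit_tangent_bundle z -> perp z w -> perp z w' ->
  w != 0 -> (exists a, w' = a *: w) \/
  forall u, perp z u -> exists a b, u = a *: w + b *: w'.
Proof.
move=> zU zw zw' w0; have [n zn] := frame_exists zU.
have ew := perp_frame zU zn zw; have ew' := perp_frame zU zn zw'.
move: ew ew' w0; move: (dotp n w.1) (dotp n w.2) (dotp n w'.1) (dotp n w'.2).
move=> a b a' b' -> -> w0.
have pairZ (x y r : R) : r *: ((x *: n, y *: n) : phase R) = ((r * x) *: n, (r * y) *: n).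
  by congr pair; rewrite scalerA.
have pairD (x y x' y' : R) : ((x *: n, y *: n) : phase R) + (x' *: n, y' *: n) =
    ((x + x') *: n, (y + y') *: n).
  by congr pair; rewrite scalerDl.
have [d0|d0] := eqVneq (a * b' - b * a') 0; [left|right].
  have n0 : a ^+ 2 + b ^+ 2 != 0.
    apply: contra w0 => /eqP h; apply/eqP/norm2_eq0.
    by rewrite (norm2_frame _ _ zn).
  exists ((a * a' + b * b') / (a ^+ 2 + b ^+ 2)).
  rewrite pairZ; congr (_ *: n, _ *: n); apply: (mulIf n0).
    rewrite mulrAC divfK //; transitivity ((a * a' + b * b') * a - b * (a * b' - b * a')).
      by ring.
    by rewrite d0 mulr0 subr0.
  rewrite mulrAC divfK //; transitivity ((a * a' + b * b') * b + a * (a * b' - b * a')).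
    by ring.
  by rewrite d0 mulr0 addr0.
move=> u zu; rewrite (perp_frame zU zn zu); move: (dotp n u.1) (dotp n u.2) => x y.
exists ((x * b' - y * a') / (a * b' - b * a')), ((a * y - b * x) / (a * b' - b * a')).
by rewrite !pairZ pairD; congr (_ *: n, _ *: n); field.
Qed.

(* Otherwise all orthogonal Jacobi fields would be bounded, those of the cone
   included. *)
Lemma bounded_collinear z w w' : ng z -> perp z w -> perp z w' -> w != 0 ->
  forward_bounded z w -> forward_bounded z w' -> exists a, w' = a *: w.
Proof.
move=> zn zw zw' w0 bw bw'.
have [//|span] := perp_independent (nongrazing_phase zn).1 zw zw' w0.
have [a [e [na ze ce e1]]] := cone_vector zn.
have [x [y exy]] := span e ze.
exfalso; apply: (cone_unbounded zn na ze ce e1); rewrite exy.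
by apply: forward_boundedD; apply: forward_boundedZ.
Qed.

(* [w] is carried by the flow to a vector which lies, for the reversed orbit, in
   the cone at time [T]: it is contracted until then because the reversed flow
   expands the cone. *)
Lemma contracted_until z T : ng z -> 0 <= T -> ps (phi T z) -> exists w,
  [/\ perp z w, w != 0 & forall s, 0 <= s <= T -> ps (phi s z) ->
    norm2 (flow_diff s z w) * expR (2 * (c * s)) <= distortion * norm2 w].
Proof.
move=> zn T0 Tp; have zp := nongrazing_phase zn.
set y := phi T z; have yn : ng y by apply: nongrazing_flow.
have rn : ng (reverse y) by apply: nongrazing_reverse.
have [a [e [na ye ce e1]]] := cone_vector rn.
have back s : phi (s - T) y = phi s z.
  by rewrite -(flowD phiB) //; congr phi; ring.
have ez : phi (- T) y = z by rewrite -[- T]add0r back (flow0 phiB).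
have ye' : perp y (reverse e) by rewrite -[y]reverseK; apply: perp_rev.
have Tp' : ps (phi (- T) y) by rewrite ez.
pose w := flow_diff (- T) y (reverse e).
have zw : perp z w by rewrite -ez; apply: perp_flow_diff.
exists w; split=> //.
  apply/eqP => w0; have := flow_diffK yn Tp' ye'.
  rewrite -/w w0 linear0 => /(congr1 (@reverse R)); rewrite reverseK => e0.
  move: e1; rewrite -e0 /reverse /norm2 /= oppr0 dotp0l addr0.
  by move/eqP; rewrite eq_sym oner_eq0.
move=> s /andP[s0 sT] sp; set x := phi s z.
have xn : ng x by apply: nongrazing_flow.
have ex : phi (s - T) y = x := back s.
have xp : ps (phi (s - T) y) by rewrite ex.
have r0 : 0 <= T - s by lra.
have erx : phi (T - s) (reverse y) = reverse x.
  by have := flow_opp phiB (nongrazing_phase yn) xp; rewrite opprB ex.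
have rp : ps (phi (T - s) (reverse y)) by rewrite erx; exact: phase_reverse sp.
pose f := flow_diff (T - s) (reverse y) e.
have ef : reverse (flow_diff s z w) = f.
  rewrite /f -opprB -[e in RHS]reverseK (flow_diff_opp yn xp ye'); congr reverse.
  have est : s - T = - T + s by rewrite addrC.
  have sTp : ps (phi (- T + s) y) by rewrite -est.
  by rewrite est (flow_diffD yn Tp' sTp ye') ez.
have [_ cf] := cone_growth rn r0 rp ye na ce.
have rxn : ng (reverse x) by apply: nongrazing_reverse.
have [b nb _] := next_collision_phase Hpi (nongrazing_phase rxn).
have cf' : in_cone b f by apply: cf; rewrite erx.
have pf : perp (reverse x) f by rewrite -erx; apply: perp_flow_diff.
have xz : phi (- s) x = z by rewrite -(flowD phiB) // addrN (flow0 phiB).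
have erz : phi s (reverse x) = reverse z.
  have := @flow_opp _ _ _ phiB (- s) x (nongrazing_phase xn).
  by rewrite opprK xz; apply.
have rzp : ps (phi s (reverse x)) by rewrite erz; apply: phase_reverse.
(* The reversed flow has brought [e] to [f] above [reverse x], still in the cone; its growth during
   the remaining time [s] is the contraction of [w] up to time [s]. *)
have [gr _] := cone_growth rxn s0 rzp pf nb cf'.
rewrite -(norm2_rev (flow_diff s z w)) ef; apply: le_trans gr _.
have eT : T - s + s = T by rewrite subrK.
have eTz : phi T (reverse y) = reverse z.
  by have := flow_opp phiB (nongrazing_phase yn) Tp'; rewrite opprK ez.
have Tsp : ps (phi (T - s + s) (reverse y)) by rewrite eT eTz; apply: phase_reverse.
rewrite ler_pM2l ?distortion_gt0 // -erx /f -(flow_diffD rn rp Tsp ye) eT.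
have := flow_diff_opp yn Tp' ye'; rewrite opprK reverseK => ->.
by rewrite norm2_rev.
Qed.

(** The sign goes into [r], so that directions are parametrized by the compact interval from 0 to
    [pi]. *)
Lemma polar_perp z n w : unit_tangent_bundle z -> frame z n -> perp z w -> w != 0 ->
  exists t r, [/\ 0 <= t <= pi, r != 0 & w = r *: (cos t *: n, sin t *: n)].
Proof.
move=> zU zn zw w0; have ew := perp_frame zU zn zw.
move: ew w0; move: (dotp n w.1) (dotp n w.2) => a b -> w0.
have pos (a' b' : R) : 0 <= b' -> 0 < a' ^+ 2 + b' ^+ 2 -> exists t r,
    [/\ 0 <= t <= pi, r != 0 & (a' *: n, b' *: n) = r *: (cos t *: n, sin t *: n)].
  move=> b0 N0; pose r := Num.sqrt (a' ^+ 2 + b' ^+ 2).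
  have r0 : 0 < r by rewrite sqrtr_gt0.
  have r2 : r ^+ 2 = a' ^+ 2 + b' ^+ 2 by rewrite sqr_sqrtr // ltW.
  have i1 : -1 <= a' / r <= 1.
    by rewrite ler_pdivlMr // ler_pdivrMr // mulN1r mul1r; apply/andP; split; nra.
  exists (acos (a' / r)), r; split; first by rewrite acos_ge0 ?acos_lepi.
    exact: lt0r_neq0.
  rewrite acosK ?in_itv //= sin_acos //.
  have -> : 1 - (a' / r) ^+ 2 = (b' / r) ^+ 2.
    rewrite !expr_div_n; apply: (@mulIf _ (r ^+ 2)); first by rewrite expf_neq0 // lt0r_neq0.
    rewrite mulrBl !divfK ?expf_neq0 ?lt0r_neq0 // r2; ring.
  rewrite sqrtr_sqr ger0_norm ?divr_ge0 ?(ltW r0) //.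
  congr pair; rewrite scalerA mulrC divfK ?lt0r_neq0 //.
have N0 : 0 < a ^+ 2 + b ^+ 2.
  rewrite lt_def addr_ge0 ?sqr_ge0 // andbT; apply: contra w0 => /eqP h.
  by apply/eqP/norm2_eq0; rewrite (norm2_frame _ _ zn).
have [b0|b0] := leP 0 b; first exact: pos.
have [||t [r [t1 r0 e]]] := pos (- a) (- b); [by lra | by rewrite !sqrrN |].
exists t, (- r); split; rewrite ?oppr_eq0 //.
by rewrite scaleNr -e; congr pair; apply/rowP => j; rewrite !mxE; ring.
Qed.

Lemma norm2_polar_continuous (L : 'End(phase R)) (n : 'rV[R]_3) :
  continuous (fun t : R => norm2 (L (cos t *: n, sin t *: n))).
Proof.
set X := L (n, 0); set Y := L (0, n).
have -> : (fun t => norm2 (L (cos t *: n, sin t *: n))) =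
    (fun t : R => cos t * (cos t * norm2 X) + (cos t * (sin t *
      (2 * (dotp X.1 Y.1 + dotp X.2 Y.2))) + sin t * (sin t * norm2 Y))).
  apply/funext => t.
  have -> : (cos t *: n, sin t *: n) = cos t *: (n, 0) + sin t *: (0, n) :> phase R.
    by congr pair; apply/rowP => j; rewrite !mxE; ring.
  rewrite linearD !linearZ_LR -/X -/Y /norm2 !phaseE !dotpE.
  by rewrite (dotpC Y.1 X.1) (dotpC Y.2 X.2); ring.
have cc : continuous (@cos R) by exact: continuous_cos.
have cs : continuous (@sin R) by exact: continuous_sin.
have cm (f g : R -> R) (a : R) : continuous f -> continuous g ->
    continuous (fun t => f t * (g t * a)).
  move=> cf cg t; apply: (continuousM (cf t)); apply: (continuousM (cg t)).
  exact: cst_continuous.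
move=> t; exact: (continuousD (cm _ _ _ cc cc t)
  (continuousD (cm _ _ _ cc cs t) (cm _ _ _ cs cs t))).
Qed.

(* A limit of the directions provided by [contracted_until] as [T] grows. *)
Lemma contracted_exists z : ng z -> exists w, [/\ perp z w, w != 0 & contracted z w].
Proof.
move=> zn; have [zU _] := nongrazing_phase zn; have [n fn] := frame_exists zU.
pose v (t : R) : phase R := (cos t *: n, sin t *: n).
have vp t : perp z (v t) by apply: frame_perp.
have v1 t : norm2 (v t) = 1 by rewrite (norm2_frame _ _ fn) cos2Dsin2.
(* [th m] is the angle of a direction contracted up to time [m]; both sides being quadratic, the
   radius cancels. *)
have /choice[th hth] : forall m : nat, exists t, 0 <= t <= pi /\
    forall s, 0 <= s <= m%:R -> ps (phi s z) ->
    norm2 (flow_diff s z (v t)) * expR (2 * (c * s)) <= distortion.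
  move=> m; have [T mT Tp] := admissible_time m%:R zn.
  have T0 : 0 <= T by apply: le_trans mT.
  have [w [zw w0 hw]] := contracted_until zn T0 Tp.
  have [t [r [ht r0 ew]]] := polar_perp zU fn zw w0.
  exists t; split=> // s /andP[s0 sm] sp.
  have := hw s _ sp; rewrite ew linearZ /= !norm2Z -/(v t) v1 mulr1.
  rewrite -mulrA [distortion * _]mulrC ler_pM2l; first by apply; rewrite s0 (le_trans sm).
  by rewrite lt_def sqrf_eq0 r0 sqr_ge0.
have [t [_ ht]] : `[0, pi]%classic `&` cluster (th @ \oo) !=set0.
  apply: (@segment_compact R 0 pi (th @ \oo)).
  by exists 0%N => // m _; rewrite /= in_itv /=; case: (hth m).
exists (v t); split=> //.
  by apply/eqP => e; move: (v1 t); rewrite e /norm2 dotp0l addr0 => /eqP; rewrite eq_sym oner_eq0.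
(* A strict failure at [s] would persist at nearby angles, among them some [th l] with [l >= s]. *)
move=> s s0 sp; rewrite v1 mulr1 leNgt; apply/negP => lt.
have ct : {for t, continuous (fun t => norm2 (flow_diff s z (v t)) * expR (2 * (c * s)))}.
  by apply: continuousM; [exact: norm2_polar_continuous | exact: cst_continuous].
have [m sm] : exists m : nat, s <= m%:R.
  by exists (Num.trunc s).+1; apply/ltW/truncnS_gt.
have tail : (th @ \oo) [set r | exists2 l, (m <= l)%N & r = th l].
  by exists m => // l /= ml; exists l.
have [r [[l ml ->] /=]] := ht _ _ tail (ct _ (lt_nbhsr lt)).
rewrite ltNge => /negP; apply; apply: (hth l).2 => //.
by rewrite s0 (le_trans sm) // ler_nat.
Qed.

Definition stable_vec z := xget 0 [set w | [/\ perp z w, w != 0 & contracted z w]].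

Lemma stable_vecP z : ng z ->
  [/\ perp z (stable_vec z), stable_vec z != 0 & contracted z (stable_vec z)].
Proof.
move=> /contracted_exists[w hw].
by apply: (@xgetPex _ _ [set w | [/\ perp z w, w != 0 & contracted z w]]); exists w.
Qed.

Lemma flow_diff_neq0 t z w : ng z -> ps (phi t z) -> perp z w -> w != 0 ->
  flow_diff t z w != 0.
Proof.
move=> zn tp zw; apply: contra => /eqP h.
by rewrite -(flow_diffK zn tp zw) h linear0.
Qed.

(** The image of a contracted vector need not be contracted with the same constant, but it is
    bounded, and bounded vectors are collinear. Negative times follow by inverting the
    differential. *)
Lemma stable_vec_flow t z : ng z -> ps (phi t z) ->
  exists2 a, a != 0 & flow_diff t z (stable_vec z) = a *: stable_vec (phi t z).
Proof.
have fwd s y : 0 <= s -> ng y -> ps (phi s y) ->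
    exists2 a, a != 0 & flow_diff s y (stable_vec y) = a *: stable_vec (phi s y).
  move=> s0 yn sp; have [p1 n1 c1] := stable_vecP yn.
  have sn := nongrazing_flow phiB yn sp.
  have [p2 n2 c2] := stable_vecP sn.
  have p3 := perp_flow_diff yn sp p1.
  have bd : forward_bounded (phi s y) (flow_diff s y (stable_vec y)).
    have [M hM] := contracted_bounded c1; exists M => r r0 rp.
    rewrite -(flowD phiB) // in rp; last exact: nongrazing_phase yn.
    by rewrite -flow_diffD //; apply: hM => //; rewrite addr_ge0.
  have [a ea] := bounded_collinear sn p2 p3 n2 (contracted_bounded c2) bd.
  exists a => //; have := flow_diff_neq0 yn sp p1 n1; rewrite ea.
  by apply: contra => /eqP ->; rewrite scale0r.
move=> zn tp; have [t0|t0] := leP 0 t; first exact: fwd.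
have zp := nongrazing_phase zn.
have yn := nongrazing_flow phiB zn tp.
have yz : phi (- t) (phi t z) = z by rewrite -(flowD phiB) // addrN (flow0 phiB).
have mp : ps (phi (- t) (phi t z)) by rewrite yz.
have t0' : 0 <= - t by lra.
have [a a0 ea] := fwd (- t) (phi t z) t0' yn mp.
have [p1 _ _] := stable_vecP yn.
have := flow_diffK yn mp p1; rewrite ea yz opprK linearZ /= => e.
exists a^-1; first by rewrite invr_eq0.
by rewrite -e scalerA mulVf // scale1r.
Qed.

Lemma contractedZ z a w : contracted z w -> contracted z (a *: w).
Proof.
move=> h s s0 sp; rewrite linearZ /= !norm2Z -mulrA [leRHS]mulrCA.
by apply: ler_wpM2l (h s s0 sp); exact: sqr_ge0.
Qed.

Definition unstable_vec z := reverse (stable_vec (reverse z)).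

Lemma unstable_vecP z : ng z -> [/\ perp z (unstable_vec z), unstable_vec z != 0 &
  forall t a, t <= 0 -> ps (phi t z) ->
    norm2 (flow_diff t z (a *: unstable_vec z)) * expR (2 * (c * - t)) <=
    distortion * norm2 (a *: unstable_vec z)].
Proof.
move=> zn; have rn := nongrazing_reverse phiB zn.
have [p1 n1 c1] := stable_vecP rn.
have p2 : perp z (unstable_vec z) by have := perp_rev p1; rewrite reverseK.
split=> //.
  apply: contra n1 => /eqP e; apply/eqP; rewrite -[LHS]reverseK -/(unstable_vec z) e.
  by rewrite /reverse /= oppr0.
move=> t a t0 tp; have zp := nongrazing_phase zn.
have t0' : 0 <= - t by lra.
have := contractedZ a c1 t0' (flow_phase_opp zp tp).
have e : a *: stable_vec (reverse z) = reverse (a *: unstable_vec z).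
  by rewrite reverseZ reverseK.
by rewrite e (flow_diff_opp zn tp (perpZ a p2)) !norm2_rev.
Qed.

Lemma unstable_vec_flow t z : ng z -> ps (phi t z) ->
  exists2 a, a != 0 & flow_diff t z (unstable_vec z) = a *: unstable_vec (phi t z).
Proof.
move=> zn tp; have zp := nongrazing_phase zn; have rn := nongrazing_reverse phiB zn.
have rp := flow_phase_opp zp tp; have [a a0 ea] := stable_vec_flow rn rp.
exists a => //; rewrite /unstable_vec -(flow_opp phiB zp tp).
have [p1 _ _] := stable_vecP rn.
have := flow_diff_opp rn rp p1; rewrite opprK reverseK => ->; rewrite ea.
exact: reverseZ.
Qed.

(* A common direction would be contracted by the flow and by its inverse. *)
Lemma unstable_not_stable z a : ng z -> unstable_vec z != a *: stable_vec z.
Proof.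
move=> zn; have zp := nongrazing_phase zn; apply/eqP => e.
have [p1 n1 c1] := stable_vecP zn; have [p2 n2 c2] := unstable_vecP zn.
have c20 : 0 < 2 * c by rewrite mulr_gt0.
have [T [T0 hT]] := expR_unbounded distortion c20.
have rn := nongrazing_reverse phiB zn.
have [t Tt tp] := admissible_time T rn.
have t0 : 0 <= t by lra.
have tp' : ps (phi (- t) z).
  by have := flow_phase_opp (nongrazing_phase rn) tp; rewrite reverseK.
have t0' : - t <= 0 by lra.
have := c2 (- t) 1 t0' tp'; rewrite !scale1r opprK => h1.
set y := phi (- t) z in tp'.
have yn : ng y by apply: nongrazing_flow.
have yz : phi t y = z.
  by have := flowD phiB t zp tp'; rewrite addNr (flow0 phiB) // => <-.
have typ : ps (phi t y) by rewrite yz.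
set w := flow_diff (- t) z (unstable_vec z) in h1.
have [b b0 eb] := stable_vec_flow zn tp'.
have cw : contracted y w.
  by rewrite /w e linearZ /= eb; do 2! apply: contractedZ; have [] := stable_vecP yn.
have := cw t t0 typ.
have -> : flow_diff t y w = unstable_vec z.
  by have := flow_diffK zn tp' p2; rewrite opprK.
have u0 : 0 < norm2 (unstable_vec z).
  rewrite lt_def norm2_ge0 andbT; apply: contra n2 => /eqP h; exact/eqP/norm2_eq0.
have := hT t Tt; rewrite -mulrA.
have := norm2_ge0 w; have A0 := distortion_gt0.
move: h1 u0; rewrite /w.
move: (norm2 (unstable_vec z)) (norm2 _) (expR _) distortion A0.
move=> x y0 E A A0 h1 u0 y00 AE h2.
(* With [E > A], contraction both ways gives [E x <= A y0 <= E y0 <= A x < E x]. *)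
have : A * y0 <= E * y0 by apply: ler_wpM2r => //; exact: ltW.
have : A * x < E * x by rewrite ltr_pM2r.
by lra.
Qed.

End Splitting.

(** * Uniform hyperbolicity *)

Section FlowDirection.
Context {R : realType} {B : spherical_billiard R} {phi : R -> phase R -> phase R}.
Hypothesis phiB : billiard_flow B phi.
Implicit Types z : phase R.

Lemma is_derive_geodesic z : is_derive (0 : R) 1 (fun t : R => geodesic t z) (flow_vec z).
Proof.
have dc : is_diff (0 : R) (@cos R) (fun h => - sin 0 * h).
  exact: (is_diff_comp1 (is_diff_id (0 : R)) (is_derive_cos 0)).
have ds : is_diff (0 : R) (@sin R) (fun h => cos 0 * h).
  exact: (is_diff_comp1 (is_diff_id (0 : R)) (is_derive_sin 0)).
have [hd hv] := is_diff_pair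
  (is_diff_add (is_diff_scale dc (is_diff_const z.1 (0 : R)))
    (is_diff_scale ds (is_diff_const z.2 (0 : R))))
  (is_diff_add (is_diff_scale dc (is_diff_const z.2 (0 : R)))
    (is_diff_opp (is_diff_scale ds (is_diff_const z.1 (0 : R))))).
apply: DeriveDef; first exact: (diff_derivable hd).
rewrite (deriveE _ hd) hv /flow_vec cos0 sin0.
by rewrite oppr0 !mul0r !scale0r !scaler0 mulr1 !scale1r !add0r.
Qed.

(** The point is interior, so its incoming velocity is [z.2] and the orbit is a single geodesic on
    both sides of time 0. *)
Lemma flow_lineE z : phase_space B z -> flow_line phi z = <[flow_vec z]>%VS.
Proof.
move=> zp; rewrite /flow_line derive1E; congr (<[_]>)%VS.
have gz := phiB zp; have [e e0 he] := trajectory_right 0 gz.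
have [_ /(_ 0)[_ [_ [u [/near_left0P[d d0 hd] hi _]]]]] := gz.
have z0 := flow0 phiB zp.
have eu : u = z.2 by rewrite -hi ?z0 //; case: zp.
have near : \forall t \near (0 : R), geodesic t z = phi t z.
  apply/near0P; exists (Num.min e d); first by rewrite lt_min e0.
  move=> t; rewrite lt_min !ltr_norml => /andP[/andP[t1 t2] /andP[t3 t4]].
  have [t0|t0] := leP 0 t.
    have te : 0 <= t < e by rewrite t0 t2.
    by have := he t te; rewrite add0r z0.
  have td : - d < t < 0 by rewrite t3 t0.
  have := hd t td; rewrite add0r z0 eu => ->.
  by case: (z).
have := near_eq_is_derive near (is_derive_geodesic z).
by case.
Qed.

Lemma flow_vec_tangent z : unit_tangent_bundle z -> tangent_space z (flow_vec z).
Proof.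
move=> [x1 v1 xv]; have xx : dotp z.1 z.1 = 1 := x1.
by split; rewrite /flow_vec /= ?dotpNr ?(dotpC z.2 z.1) ?xv ?oppr0 // v1 xx subrr.
Qed.

Lemma perp_tangent z w : perp z w -> tangent_space z w.
Proof. by move=> [h1 h2 h3 h4]; split=> //; rewrite (dotpC w.1) h2 h3 addr0. Qed.

Lemma tangentD z w w' : tangent_space z w -> tangent_space z w' -> tangent_space z (w + w').
Proof.
move=> [h1 h2 h3] [h1' h2' h3']; split; rewrite !phaseE !dotpE ?h1 ?h2 ?h1' ?h2' ?addr0 //.
by rewrite addrACA h3 h3' addr0.
Qed.

Lemma tangentZ z a w : tangent_space z w -> tangent_space z (a *: w).
Proof.
move=> [h1 h2 h3]; split; rewrite !phaseE !dotpE ?h1 ?h2 ?mulr0 //.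
by rewrite -mulrDr h3 mulr0.
Qed.

Lemma tangent_perp z w : unit_tangent_bundle z -> tangent_space z w ->
  perp z (w - dotp z.2 w.1 *: flow_vec z).
Proof.
case: z w => x v [a b] [/= x1 v1 xv] [/= h1 h2 h3]; have xx : dotp x x = 1 := x1.
split; rewrite /= !dotpE ?(dotpC v x) ?xv ?v1 ?xx ?h1 ?h2; try ring.
by rewrite (dotpC v a); move: h3; lra.
Qed.

Lemma sasaki_norm_perp z w : perp z w -> sasaki_norm z w = Num.sqrt (norm2 w).
Proof. by move=> [_ _ h3 _]; rewrite /sasaki_norm h3 scale0r subr0. Qed.

End FlowDirection.

Lemma flow_splitting (R : realType) (z u e : phase R) : unit_tangent_bundle z ->
  perp z u -> perp z e -> e != 0 -> u != 0 -> (forall a, u != a *: e) ->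
  directv (<[flow_vec z]> + <[u]> + <[e]>) /\
  forall w, w \in (<[flow_vec z]> + <[u]> + <[e]>)%VS <-> tangent_space z w.
Proof.
move=> zU zu ze e0 u0 ue; have [_ v1 _] := zU.
(* The functional [w |-> dotp z.2 w.1] reads off the flow component, as it vanishes on orthogonal
   data. *)
have fw a b : perp z b -> dotp z.2 (a *: flow_vec z + b).1 = a.
  by move=> [_ h _ _]; rewrite !phaseE !dotpE h v1; ring.
split.
  rewrite !directv_addE /= !directv_trivial /=; apply/andP; split; last first.
    apply/eqP/vspaceP => w; rewrite memv0; apply/idP/eqP => [|->]; last exact: mem0v.
    move=> /memv_capP[/memv_addP[_ /vlineP[a ->] [_ /vlineP[b ->] ew]] /vlineP[d ed]].
    have a0 : a = 0.
      have := fw a (b *: u) (perpZ b zu); rewrite -ew ed phaseE dotpZr.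
      by have [_ -> _ _] := ze; rewrite mulr0.
    move: ew; rewrite a0 scale0r add0r ed => ew.
    have [b0|b0] := eqVneq b 0; first by rewrite ew b0 scale0r.
    have /eqP[] := ue (b^-1 * d).
    by rewrite -scalerA ew scalerA mulVf // scale1r.
  apply/eqP/vspaceP => w; rewrite memv0; apply/idP/eqP => [|->]; last exact: mem0v.
  move=> /memv_capP[/vlineP[a ea] /vlineP[b eb]].
  have := fw a 0; rewrite addr0 -ea eb phaseE dotpZr.
  have [_ -> _ _] := zu; rewrite mulr0 => /(_ _) a0.
  by rewrite -eb ea -a0 ?scale0r //; split; rewrite dotp0r.
move=> w; split.
  move=> /memv_addP[_ /memv_addP[_ /vlineP[a ->] [_ /vlineP[b ->] ->]] [_ /vlineP[d ->] ->]].
  by apply: tangentD; [apply: tangentD|]; apply: tangentZ;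
    [exact: flow_vec_tangent | exact: perp_tangent | exact: perp_tangent].
move=> zw; have [[a ea]|span] := perp_independent zU ze zu e0.
  by have /eqP := ue a.
have [a [b eab]] := span _ (tangent_perp zU zw).
apply/memv_addP; exists (dotp z.2 w.1 *: flow_vec z + b *: u).
  apply/memv_addP; exists (dotp z.2 w.1 *: flow_vec z); first by apply/vlineP; eexists.
  by exists (b *: u) => //; apply/vlineP; eexists.
exists (a *: e); first by apply/vlineP; eexists.
by rewrite -addrA (addrC (b *: u)) -eab addrC subrK.
Qed.

(** From squared norms to norms: the rate [2 c] becomes [c], and the constant its square root. *)
Lemma sqrt_decay (R : realType) (A c x y s : R) : 0 <= A -> 0 <= x ->
  y * expR (2 * (c * s)) <= A * x ->
  Num.sqrt y <= Num.sqrt A * expR (- c) `^ s * Num.sqrt x.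
Proof.
move=> A0 x0 h.
have -> : expR (- c) `^ s = expR (- (c * s)).
  by rewrite /powR gt_eqF ?expR_gt0 // expRK mulrN mulrC.
set E := expR (- (c * s)); have E0 : 0 <= E by exact: expR_ge0.
have -> : Num.sqrt A * E * Num.sqrt x = Num.sqrt (A * E ^+ 2 * x).
  rewrite sqrtrM; last by apply: mulr_ge0 => //; exact: sqr_ge0.
  by rewrite sqrtrM // sqrtr_sqr ger0_norm.
apply: ler_wsqrtr; rewrite mulrAC.
have -> : E ^+ 2 = (expR (2 * (c * s)))^-1.
  by rewrite expr2 -expRD -expRN; congr expR; ring.
by rewrite ler_pdivlMr ?expR_gt0.
Qed.

Lemma uniformly_hyperbolic_of_expansion (R : realType) (B : spherical_billiard R)
    (phi : R -> phase R -> phase R) (k c : R) : billiard_flow B phi ->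
  horizon B < pi / 2 -> 0 < k -> 0 < c ->
  (forall i : 'I_(obs_pred B).+1, k * sin (obs_radius i) <= 2 * cos (obs_radius i)) ->
  (forall t, 0 <= t <= horizon B ->
    [/\ 0 <= sin t, 0 < cos t, 0 <= k * cos t - sin t
      & expR (c * t) <= cos t + k * sin t]) ->
  uniformly_hyperbolic B phi.
Proof.
move=> phiB Hpi k0 c0 curv expd.
have A0 := distortion_gt0 (B := B) (c := c) k0.
pose Eu z := <[unstable_vec (B := B) (phi := phi) (k := k) (c := c) z]>%VS.
pose Es z := <[stable_vec (B := B) (phi := phi) (k := k) (c := c) z]>%VS.
exists (Num.sqrt (distortion (B := B) (k := k) (c := c))), (expR (- c)); split.
- by rewrite sqrtr_gt0.
- by rewrite expR_gt0 expR_lt1 oppr_lt0.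
exists Eu, Es => z zn; have zp := nongrazing_phase zn; have [zU _] := zp.
have [p1 n1 c1] := stable_vecP phiB Hpi k0 c0 curv expd zn.
have [p2 n2 c2] := unstable_vecP phiB Hpi k0 c0 curv expd zn.
have ind a := unstable_not_stable phiB Hpi k0 c0 curv expd a zn.
have [dir tan_] := flow_splitting zU p2 p1 n1 n2 ind.
rewrite (flow_lineE phiB zp); split=> // t tp.
have [L1 L2 L3 L4] := flow_diff_tame phiB Hpi k0 curv expd zn tp.
exists (flow_diff (B := B) (phi := phi) t z) => //.
split.
- split.
  + by rewrite limg_line L3 (flow_lineE phiB tp).
  + rewrite limg_line; have [a a0 ->] := unstable_vec_flow phiB Hpi k0 c0 curv expd zn tp.
    by apply/eqP; rewrite eqEsubv -!memvE; apply/andP; split; apply/vlineP;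
      [exists a | exists a^-1; rewrite scalerA mulVf // scale1r].
  + rewrite limg_line; have [a a0 ->] := stable_vec_flow phiB Hpi k0 c0 curv expd zn tp.
    by apply/eqP; rewrite eqEsubv -!memvE; apply/andP; split; apply/vlineP;
      [exists a | exists a^-1; rewrite scalerA mulVf // scale1r].
- move=> t0 _ /vlineP[a ->].
  have pa : perp z (a *: stable_vec (B := B) (phi := phi) (k := k) (c := c) z) by apply: perpZ.
  rewrite !sasaki_norm_perp //; last exact: L4.
  by apply: sqrt_decay; rewrite ?norm2_ge0 ?(ltW A0) //; apply: contractedZ.
- move=> t0 _ /vlineP[a ->].
  have pa : perp z (a *: unstable_vec (B := B) (phi := phi) (k := k) (c := c) z) by apply: perpZ.
  rewrite !sasaki_norm_perp //; last exact: L4.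
  by apply: sqrt_decay; rewrite ?norm2_ge0 ?(ltW A0) //; apply: c2.
Qed.

(** * Bounds on the horizon and on the radii *)

Section Horizon.
Context {R : realType} (B : spherical_billiard R).

Lemma horizon_ge0 : 0 <= horizon B.
Proof.
rewrite /horizon; set S := (X in sup X).
have Sup : has_ubound S by exists (2 * pi) => l [/andP[]].
(* The supremum of the empty set is 0 by convention. *)
have [->|/set0P[l Sl]] := eqVneq S set0; first by rewrite sup0.
by apply: le_trans (ub_le_sup Sup Sl); case: Sl => /andP[].
Qed.

Lemma radius_le_largest (i : 'I_(obs_pred B).+1) : obs_radius i <= largest_radius B.
Proof. exact: le_bigmax. Qed.

Lemma largest_radius_itv : 0 < largest_radius B < pi / 2.
Proof.
have pi0 := pi_gt0 R.
apply/andP; split.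
  exact: lt_le_trans (radius_gt0 ord0) (radius_le_largest ord0).
by apply: bigmax_lt => [|i _]; [lra | exact: radius_lt_pihalf].
Qed.

Lemma tan_pihalfB (x : R) : tan (pi / 2 - x) = cos x / sin x.
Proof. by rewrite /tan sinB cosB sin_pihalf cos_pihalf !mul0r !mul1r subr0 add0r. Qed.

End Horizon.

Theorem theorem2p1 (R : realType) (B : spherical_billiard R)
    (phi : R -> phase R -> phase R) (phiB : billiard_flow B phi) :
  (horizon B < pi / 2 ->
   tan (horizon B) < 2 * tan (pi / 2 - largest_radius B) ->
   uniformly_hyperbolic B phi) /\
  (largest_radius B + horizon B < pi / 2 -> uniformly_hyperbolic B phi).
Proof.
have pi0 := pi_gt0 R; have H0 := horizon_ge0 B.
have /andP[A0 A1] := largest_radius_itv B.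
have main : horizon B < pi / 2 ->
    tan (horizon B) < 2 * tan (pi / 2 - largest_radius B) -> uniformly_hyperbolic B phi.
  move=> H1 HA; set k := 2 * _ in HA.
  have H01 : 0 <= horizon B < pi / 2 by rewrite H0.
  have [c c0 hc] := flight_expansion H01 HA.
  have sA : 0 < sin (largest_radius B) by apply: sin_gt0_pihalf; rewrite A0.
  have cA : 0 < cos (largest_radius B) by apply: cos_gt0_pihalf; apply/andP; split; lra.
  have k0 : 0 < k by rewrite /k tan_pihalfB mulr_gt0 // divr_gt0.
  apply: (uniformly_hyperbolic_of_expansion phiB H1 k0 c0) => // i.
  have s0 := sin_radius_gt0 i; have := radius_le_largest i.
  have /andP[r0 r1] := obs_radius_itv i.
  (* The cotangent is decreasing, so the largest obstacle has the least curvature term; it is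
     compared as a tangent of the complementary angle. *)
  rewrite -ler_pdivlMr // /k -mulrA ler_pM2l // -tan_pihalfB => iA.
  by rewrite leNgt ltr_tan ?in_itv /= -?leNgt ?lerD2l ?lerN2 //; apply/andP; split; lra.
split=> // AH; have H1 : horizon B < pi / 2 by lra.
apply: main => //.
(* The tangent increases and [H < pi / 2 - A]; the factor 2 is then to spare. *)
have lt : tan (horizon B) < tan (pi / 2 - largest_radius B).
  by rewrite ltr_tan ?in_itv /=; try (apply/andP; split); lra.
have tA : 0 < tan (pi / 2 - largest_radius B).
  rewrite tan_pihalfB divr_gt0 ?sin_gt0_pihalf ?A0 ?cos_gt0_pihalf //.
  by apply/andP; split; lra.
by lra.
Qed.
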